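(* Let $\tilde\lambda\in\mathcal Y(m,p,n)$ and $\delta\in C_\lambda$. Then $$\mathrm{Res}^{G(r,p,n)}_{L(r,p,n)}\big(V^{(\tilde\lambda,\delta)}\big)\cong\bigoplus_{i=1}^m\ \bigoplus_{j\in J(i)}\Big(\bigoplus_{\tilde\mu^{(n,i,j)}\in\tilde\lambda\downarrow(i,j)}V^{\tilde\mu^{(n,i,j)}}\Big),$$ and the branching rule from $G(r,p,n)$ to $L(r,p,n)$ is multiplicity free.
   Context: $r,p,n$ are positive integers, $p\mid r$, $m=r/p$, $\zeta$ a primitive $r$-th root of unity. $G(r,1,n)$: $n\times n$ generalized permutation matrices with nonzero entries $r$-th roots of unity; $G(r,p,n)$: those for which the $m$-th power of the product of nonzero entries is $1$; $L(r,p,n)$: matrices in $G(r,p,n)$ with nonzero $(n,n)$-entry. $L(r,1,n)=G(r,1,n-1)\times G(n)$ with $G(n)\cong\mathbb Z/r\mathbb Z$ acting in the last coordinate. Modules are finite-dimensional over $\mathbb C$. $\mathcal Y(r,n)$: $r$-tuples $\lambda=(\lambda_1,\dots,\lambda_r)$ of Young diagrams with $n$ boxes in total. With $\sigma_i(\zeta)=\zeta^{i-1}$, $V^\lambda$ is the irreducible $G(r,1,n)$-module induced from $\prod_iG(r,1,|\lambda_i|)$ of the external product of $S^{\lambda_i}\otimes\sigma_i^{\otimes|\lambda_i|}$ ($S^{\lambda_i}$ Specht module). Necklaces: $\tilde\lambda_{(i,j)}=\lambda_{(j-1)m+i}$ ($1\le i\le m$, $1\le j\le p$); equivalence is simultaneous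 rotation $j\mapsto j+t\pmod p$ in all components; $\mathcal Y(m,p,n)$ is the set of necklaces with $n$ boxes up to equivalence. An $(n,i,j)$-colored necklace $\tilde\mu^{(n,i,j)}$ is a necklace $\tilde\mu$ with $n-1$ boxes with node $(i,j)$ colored; $\tilde\mu^{(n,i,j)}$ and $\tilde\nu^{(n,s,t)}$ are equivalent if $i=s$ and for some $l$, $j\equiv t+l\pmod p$ and $\tilde\mu_{(a,b)}=\tilde\nu_{(a,(b+l)\bmod p)}$ whenever these are compared under the same rotation that carries one colored node to the other (i.e. one simultaneous rotation carries one colored necklace, including its colored node, to the other). $\mathcal Y^n(m,p,n-1)$ is the set of classes. $V^{\tilde\mu^{(n,i,j)}}$ is the irreducible $L(r,p,n)$-module obtained by restricting the $L(r,1,n)$-module $V^\mu\otimes\sigma_{(j-1)m+i}$. $\delta_0$ sends a matrix to the product of its nonzero entries; $C=\langle\delta_0^m\rangle$, of order $p$, acts on irreducible $G(r,1,n)$-modules by tensoring; $C_\lambda$ is the stabilizer of $V^\lambda$, of order $u(\lambda)$; $b(\lambda)=p/u(\lambda)$. $\mathrm{Res}^{G(r,1,n)}_{G(r,p,n)}V^\lambda$ is the direct sum of $u(\lambda)$ inequivalent irreducibles $V^{(\tilde\lambda,\delta)}$, $\delta\in C_\lambda$: the eigenspaces of an associator, a linear map $A$ with $A(hv)=\delta_0^{mb(\lambda)}(h)hA(v)$ for $h\in G(r,1,n)$ and $A^{u(\lambda)}=1$, where $\delta=\delta_0^{tmb(\lambda)}$ corresponds to eigenvalue $\zeta^{tmb(\lambda)}$.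 Every irreducible $G(r,p,n)$-module is of this form. $\tilde\lambda\downarrow(i,j)\subseteq\mathcal Y^n(m,p,n-1)$ is the set of all elements obtained by deleting a box from an inner (removable) corner of $\tilde\lambda_{(i,j)}$ and coloring that node by $n$. For fixed $i$, any two of the sets $\tilde\lambda\downarrow(i,s)$, $\tilde\lambda\downarrow(i,t)$ are either disjoint or equal; $J(i)\subseteq\{1,\dots,p\}$ is a maximal subset such that $\tilde\lambda\downarrow(i,s)\cap\tilde\lambda\downarrow(i,t)=\emptyset$ for all $s\ne t$ in $J(i)$. *)

(* Defs.v *)
From HB Require Import structures.
From mathcomp Require Import all_boot all_order all_fingroup all_algebra.
From mathcomp Require Import all_solvable all_field all_character.
From mathcomp Require Import boolp.

Set Implicit Arguments.
Unset Strict Implicit.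
Unset Printing Implicit Defensive.

Import Order.TTheory GRing.Theory Num.Theory.
Local Open Scope ring_scope.

(* Z/r, assuming 0 < r; unlike 'Z_r this is also correct for r = 1. *)
Notation Zmod r := 'I_r.-1.+1.

Lemma ZmodD r (a b : Zmod r) : (0 < r)%N ->
  nat_of_ord (a + b) = ((a + b) %% r)%N.
Proof. by case: r a b. Qed.

Section Gpm.

Variables r n : nat.

(* The generalized permutation matrix with entry zeta ^ (gpm_exp i) at        *)
(* position (i, gpm_perm i), for a fixed primitive r-th root of unity zeta;   *)
(* see gpm_mx below.                                                          *)
Record gpm := Gpm {gpm_perm : {perm 'I_n}; gpm_exp : {ffun 'I_n -> Zmod r}}.

Definition gpm_pair g := (gpm_perm g, gpm_exp g).
Definition pair_gpm (x : {perm 'I_n} * {ffun 'I_n -> Zmod r}) :=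
  Gpm x.1 x.2.
Lemma gpm_pairK : cancel gpm_pair pair_gpm. Proof. by case. Qed.
HB.instance Definition _ := Finite.copy gpm (can_type gpm_pairK).

Definition gpm_mul g h :=
  Gpm (gpm_perm g * gpm_perm h)%g
      [ffun i => gpm_exp g i + gpm_exp h (gpm_perm g i)].
Definition gpm_one := Gpm 1%g [ffun=> 0].
Definition gpm_inv g :=
  Gpm (gpm_perm g)^-1%g [ffun i => - gpm_exp g ((gpm_perm g)^-1%g i)].

Lemma gpm_eq g h : gpm_perm g = gpm_perm h -> gpm_exp g =1 gpm_exp h -> g = h.
Proof. by case: g h => [s a] [t b] /= -> /ffunP->. Qed.

Lemma gpm_mulA : associative gpm_mul.
Proof.
move=> g h k; apply: gpm_eq => [|i] /=; first by rewrite mulgA.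
by rewrite !ffunE /= permM addrA.
Qed.

Lemma gpm_mul1 : left_id gpm_one gpm_mul.
Proof.
move=> g; apply: gpm_eq => [|i] /=; first by rewrite mul1g.
by rewrite !ffunE perm1 add0r.
Qed.

Lemma gpm_mulV : left_inverse gpm_one gpm_inv gpm_mul.
Proof.
move=> g; apply: gpm_eq => [|i] /=; first by rewrite mulVg.
by rewrite !ffunE addNr.
Qed.

HB.instance Definition _ :=
  Finite_isGroup.Build gpm gpm_mulA gpm_mul1 gpm_mulV.

Lemma gpm_permM : {morph gpm_perm : g h / (g * h)%g}.
Proof. by []. Qed.
Canonical gpm_perm_morphism := @Morphism _ _ setT gpm_perm (in2W gpm_permM).

Lemma gpm_expM g h i :
  gpm_exp (g * h)%g i = gpm_exp g i + gpm_exp h (gpm_perm g i).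
Proof. by rewrite ffunE. Qed.

Definition gpm_deg g : Zmod r := \sum_i gpm_exp g i.

Lemma gpm_degM : {morph gpm_deg : g h / (g * h)%g >-> g + h}.
Proof.
move=> g h; rewrite /gpm_deg.
rewrite [X in _ = _ + X](reindex_inj (@perm_inj _ (gpm_perm g))) /=.
by rewrite -big_split; apply: eq_bigr => i _; rewrite gpm_expM.
Qed.

Lemma gpm_deg1 : gpm_deg 1%g = 0.
Proof. by rewrite /gpm_deg big1 // => i _; rewrite ffunE. Qed.

End Gpm.

Section Subgroups.

Variables r p n : nat.

(* zeta ^ (gpm_deg g) is the product of the nonzero entries of g; see in_Grp. *)
Definition Grp_set := [set g : gpm r n | gpm_deg g *+ (r %/ p) == 0].

Lemma Grp_group_set : group_set Grp_set.
Proof.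
apply/group_setP; split=> [|g h]; rewrite !inE; first by rewrite gpm_deg1 mul0rn.
by rewrite gpm_degM mulrnDl => /eqP-> /eqP->; rewrite addr0.
Qed.
Canonical Grp := Group Grp_group_set.

End Subgroups.

Section LastCoordinate.

Variables r n : nat.

(* The embedding of G(r,1,n) x Z/r in G(r,1,n+1), Z/r acting in the last      *)
(* coordinate; its image is L(r,1,n+1).                                       *)
Definition last_emb (x : gpm r n * Zmod r) : gpm r n.+1 :=
  Gpm (lift_perm ord_max ord_max (gpm_perm x.1))
      [ffun i => oapp (gpm_exp x.1) x.2 (unlift ord_max i)].

Lemma last_embM : {morph last_emb : x y / (x * y)%g}.
Proof.
move=> [g a] [h b]; apply: gpm_eq => [|i] /=; first by rewrite lift_permM.
rewrite !ffunE /=; case: unliftP => [j|] -> /=; last first.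
  by rewrite lift_perm_id unlift_none.
by rewrite lift_perm_lift liftK /= ffunE.
Qed.
Canonical last_emb_morphism := @Morphism _ _ setT last_emb (in2W last_embM).

Lemma last_emb_inj : ('injm last_emb_morphism)%g.
Proof.
apply/injmP => -[[s a] x] [[t b] y] _ _ /= [Hst /ffunP Hab].
have -> : s = t.
  apply/permP => i; have := congr1 (fun u : 'S_n.+1 => u (lift ord_max i)) Hst.
  by rewrite /= !lift_perm_lift => /lift_inj.
have -> : a = b.
  by apply/ffunP => i; have := Hab (lift ord_max i); rewrite !ffunE liftK.
by have := Hab ord_max; rewrite !ffunE unlift_none /= => ->.
Qed.

Definition Lrp_set p := [set g in Grp r p n.+1 | gpm_perm g ord_max == ord_max].

Lemma in_Lrp p g :
  (g \in Lrp_set p) = (g \in Grp r p n.+1) && (gpm_perm g ord_max == ord_max).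
Proof. exact: in_set. Qed.

Lemma Lrp_group_set p : group_set (Lrp_set p).
Proof.
apply/group_setP; split=> [|g h]; rewrite !in_Lrp ?group1 ?perm1 //=.
case/andP=> Gg /eqP fg /andP[Gh /eqP fh].
by rewrite groupM // permM fg fh eqxx.
Qed.
Canonical Lrp p := Group (Lrp_group_set p).

Lemma Lrp_sub p : Lrp p \subset Grp r p n.+1.
Proof. by apply/subsetP => g; rewrite in_Lrp => /andP[]. Qed.

Lemma Lrp_sub_last p : Lrp p \subset (last_emb_morphism @* setT)%g.
Proof.
apply/subsetP => g; rewrite in_Lrp => /andP[_ /eqP fg].
pose f (i : 'I_n) := odflt i (unlift ord_max (gpm_perm g (lift ord_max i))).
have fE i : lift ord_max (f i) = gpm_perm g (lift ord_max i).
  rewrite /f; case: unliftP => [j -> //|e].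
  have /perm_inj ei : gpm_perm g (lift ord_max i) = gpm_perm g ord_max by rewrite fg.
  by have := neq_lift ord_max i; rewrite -[X in X != _]ei eqxx.
have f_inj : injective f.
  move=> i j e; apply: (@lift_inj _ ord_max); apply: (@perm_inj _ (gpm_perm g)).
  by rewrite -!fE e.
apply/morphimP; exists (Gpm (perm f_inj) [ffun i => gpm_exp g (lift ord_max i)],
                        gpm_exp g ord_max); rewrite ?inE //.
apply: gpm_eq => [|i] /=; last by rewrite ffunE; case: unliftP => [j|] -> //=; rewrite ffunE.
apply/permP => i; case: (unliftP ord_max i) => [j|] ->.
  by rewrite lift_perm_lift permE fE.
by rewrite lift_perm_id.
Qed.

End LastCoordinate.

Section Blocks.

Variables (r q n : nat) (al : 'I_q -> nat) (al_n : (\sum_k al k)%N = n).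

Definition block_sig (x : 'I_n) : {k : 'I_q & 'I_(al k)} :=
  tagnat.sig (cast_ord (esym al_n) x).
Definition block_rank (u : {k : 'I_q & 'I_(al k)}) : 'I_n :=
  cast_ord al_n (tagnat.rank u).

Lemma block_sigK : cancel block_sig block_rank.
Proof. by move=> x; rewrite /block_rank tagnat.sigK cast_ordKV. Qed.
Lemma block_rankK : cancel block_rank block_sig.
Proof. by move=> x; rewrite /block_sig cast_ordK tagnat.rankK. Qed.

Notation blocks := {dffun forall k : 'I_q, gpm r (al k)}.

Definition block_fun (g : blocks) (x : 'I_n) : 'I_n :=
  let u := block_sig x in
  block_rank (Tagged (fun k => 'I_(al k)) (gpm_perm (g (tag u)) (tagged u))).

Lemma block_fun_inj g : injective (block_fun g).
Proof.
move=> x y /(can_inj block_rankK); rewrite -[x]block_sigK -[y]block_sigK.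
rewrite !block_rankK.
case: (block_sig x) (block_sig y) => k i [l j] /= /eqP.
rewrite -tag_eqE /tag_eq /=; case: eqP => //= ekl.
by case: l / ekl j => j; rewrite tagged_asE => /eqP/perm_inj->.
Qed.

(* The block diagonal embedding of prod_k G(r,1,al_k) in G(r,1,n). *)
Definition block_emb (g : blocks) : gpm r n :=
  Gpm (perm (@block_fun_inj g))
      [ffun x => let u := block_sig x in gpm_exp (g (tag u)) (tagged u)].

Lemma block_embM : {morph block_emb : g h / (g * h)%g}.
Proof.
move=> g h; apply: gpm_eq => [|x] /=.
  apply/permP => x; rewrite permM !permE /block_fun block_rankK /=.
  by rewrite ffunE permM.
by rewrite !ffunE /= permE /block_fun block_rankK.
Qed.
Canonical block_emb_morphism := @Morphism _ _ setT block_emb (in2W block_embM).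

Lemma block_emb_inj : ('injm block_emb_morphism)%g.
Proof.
apply/injmP => g h _ _ /= [/permP Hp /ffunP He].
apply/ffunP => k; apply: gpm_eq => [|i].
  apply/permP => i; have := Hp (block_rank (Tagged (fun k => 'I_(al k)) i)).
  rewrite !permE /block_fun block_rankK /= => /(can_inj block_rankK)/eqP.
  by rewrite -tag_eqE /tag_eq /= eqxx /= tagged_asE => /eqP.
by have := He (block_rank (Tagged (fun k => 'I_(al k)) i)); rewrite !ffunE block_rankK.
Qed.

End Blocks.

Section Representations.

Variable F : fieldType.

(* The pullback of a representation along a morphism. *)
Lemma pull_mx_repr (aT rT : finGroupType) (D : {group aT}) (G : {group rT})
    (f : {morphism D >-> rT}) (W : representation F G) :
  (f @* D)%g \subset G -> mx_repr D (fun x => W (f x)).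
Proof.
move=> sfDG; have fG x : x \in D -> f x \in G.
  by move=> Dx; apply: (subsetP sfDG); apply: mem_morphim.
by split=> [|x y Dx Dy]; rewrite ?morph1 ?repr_mx1 // morphM // repr_mxM ?fG.
Qed.
Definition pull_repr aT rT D G f W sfDG :=
  Representation (MxRepresentation (@pull_mx_repr aT rT D G f W sfDG)).

Section OneGroup.

Variables (gT : finGroupType) (G : {group gT}).

Definition res_repr (H : {group gT}) (sHG : H \subset G)
    (W : representation F G) : representation F H :=
  Representation (subg_repr W sHG).

Lemma one_mx_repr : mx_repr G (fun _ => 1%:M : 'M[F]_1).
Proof. by split=> // x y _ _; rewrite mulmx1. Qed.
Definition one_repr := Representation (MxRepresentation one_mx_repr).

Definition tensor_repr (W1 W2 : representation F G) :=
  Representation (prod_repr W1 W2).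

(* The tensor product with a one-dimensional representation chi. *)
Lemma twist_mx_repr (chi : gT -> F) (W : representation F G) :
    chi 1%g = 1 -> {in G &, {morph chi : x y / (x * y)%g >-> x * y}} ->
  mx_repr G (fun x => chi x *: W x).
Proof.
move=> chi1 chiM; split=> [|x y Gx Gy]; first by rewrite chi1 repr_mx1 scale1r.
by rewrite chiM // repr_mxM // -scalemxAl -scalemxAr scalerA.
Qed.
Definition twist_repr chi W chi1 chiM :=
  Representation (MxRepresentation (@twist_mx_repr chi W chi1 chiM)).

End OneGroup.

Section Induced.

Variables (gT : finGroupType) (G H : {group gT}) (sHG : H \subset G).
Variable W : representation F H.

Definition coset_rep (i : 'I_#|rcosets H G|) : gT := repr (enum_val i).

Definition ind_block (g : gT) (i j : 'I_#|rcosets H G|) : 'M[F]_(rdegree W) :=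
  let h := (coset_rep i * g * (coset_rep j)^-1)%g in
  if h \in H then W h else 0.

Definition ind_mx (g : gT) : 'M[F]_(\sum_(i < #|rcosets H G|) rdegree W) :=
  \mxblock_(i < #|rcosets H G|, j < #|rcosets H G|) ind_block g i j.

Lemma coset_repE i : (H :* coset_rep i)%g = enum_val i.
Proof.
have /rcosetsP[x Gx e] := enum_valP i; rewrite e.
by apply/rcoset_eqP; rewrite /coset_rep e mem_repr_rcoset.
Qed.

Lemma coset_repG i : coset_rep i \in G.
Proof.
have /rcosetsP[x Gx e] := enum_valP i; rewrite /coset_rep e.
have /rcosetP[h Hh ->] := mem_repr_rcoset H x.
by rewrite groupM // (subsetP sHG).
Qed.

Lemma coset_rep_in i (g : gT) : g \in G ->
  exists j, forall k, ((coset_rep i * g * (coset_rep k)^-1)%g \in H) = (k == j).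
Proof.
move=> Gg; have Hc : (H :* (coset_rep i * g))%g \in rcosets H G.
  by apply/rcosetsP; exists (coset_rep i * g)%g; rewrite ?groupM ?coset_repG.
exists (enum_rank_in Hc (H :* (coset_rep i * g))%g) => k.
rewrite -mem_rcoset; apply/rcoset_eqP/eqP => [|->]; rewrite coset_repE; last by rewrite enum_rankK_in.
by move=> e; apply: enum_val_inj; rewrite enum_rankK_in.
Qed.

Lemma ind_mx_repr : mx_repr G ind_mx.
Proof.
split=> [|g h Gg Gh].
  rewrite -[RHS]mxdiagZ; apply/eq_mxblock => i j; rewrite /ind_block mulg1.
  rewrite conform_mx_id -mem_rcoset; case: (eqVneq i j) => [->|/eqP nij].
    by rewrite rcoset_refl mulgV repr_mx1.
  by case: rcoset_eqP => // /[!coset_repE]/enum_val_inj.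
rewrite mul_mxblock; apply/eq_mxblock => i k; rewrite /ind_block.
have [j Hj] := coset_rep_in i Gg; rewrite (bigD1 j) //= Hj eqxx big1 => [|l nlj].
  have -> : (coset_rep i * (g * h) * (coset_rep k)^-1 =
      (coset_rep i * g * (coset_rep j)^-1) * (coset_rep j * h * (coset_rep k)^-1))%g.
    by rewrite -!mulgA mulKg.
  have Hij : (coset_rep i * g * (coset_rep j)^-1)%g \in H by rewrite Hj.
  rewrite groupMl // addr0; case: ifP => Hjk; last by rewrite mulmx0.
  by rewrite repr_mxM.
by rewrite Hj (negPf nlj) mul0mx.
Qed.

Definition ind_repr := Representation (MxRepresentation ind_mx_repr).

End Induced.

End Representations.

Section Specht.

Variables (F : fieldType) (s : seq nat).

Notation S := [set: 'S_(sumn s)]%G.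

(* Row stabilizer and column stabilizer of the tableau of shape s that is     *)
(* filled row by row: x lies in row reshape_index s x and column              *)
(* reshape_offset s x.                                                        *)
Definition row_stab : {set 'S_(sumn s)} :=
  [set g : 'S_(sumn s) |
    [forall x, reshape_index s (g x) == reshape_index s x]].
Definition col_stab : {set 'S_(sumn s)} :=
  [set g : 'S_(sumn s) |
    [forall x, reshape_offset s (g x) == reshape_offset s x]].

(* Realized in the right regular module: the right ideal generated by the sum *)
(* of row_stab is the permutation module on tabloids, with that sum as the    *)
(* tabloid of the tableau, and the polytabloid is its image under the signed  *)
(* column sum. Polytabloids span the Specht module.                           *)
Definition polytabloid : 'rV[F]_#|S| :=
  \sum_(g in row_stab) \sum_(h in col_stab)
    (-1) ^+ odd_perm h *: delta_mx 0 (gring_index S (g * h)%g).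

Definition specht : representation F S :=
  Representation
    (submod_repr (cyclic_mx_module (regular_repr F S) polytabloid)).

End Specht.

(* A Young diagram is the list of its row lengths. *)
Definition is_part (s : seq nat) := sorted geq s && (0%N \notin s).

(* r-tuples of Young diagrams with n boxes in total. *)
Record mpart (r n : nat) := MPart {
  mpart_val :> r.-tuple (seq nat);
  _ : all is_part mpart_val &&
      ((\sum_(k < r) sumn (tnth mpart_val k))%N == n) }.
HB.instance Definition _ r n := [isSub for @mpart_val r n].
HB.instance Definition _ r n := [Countable of mpart r n by <:].

Section MpartFinite.

Variables r n : nat.

Lemma mpart_part (l : mpart r n) k : is_part (tnth l k).
Proof. by case: l => l /= /andP[/all_tnthP]. Qed.

Lemma mpart_sum (l : mpart r n) : (\sum_(k < r) sumn (tnth l k))%N = n.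
Proof. by case: l => l /= /andP[_ /eqP]. Qed.

Lemma filter_mkseq_nth (t : seq nat) N : (0%N \notin t) -> (sumn t <= N)%N ->
  [seq v <- mkseq (nth 0%N t) N | v != 0%N] = t.
Proof.
elim: t N => [|v t IHt] N.
  by move=> _ _; rewrite /mkseq; elim: (iota 0 N) => //= a e ->; rewrite nth_nil.
rewrite inE negb_or eq_sym -lt0n /= => /andP[v_gt0 nz] le_n.
case: N le_n => [|N] le_n; first by move: le_n v_gt0; case: v.
rewrite /mkseq /= -lt0n v_gt0; congr cons.
rewrite -[1%N]addn0 iotaDl -map_comp; apply: IHt => //.
by move: le_n; case: v v_gt0 => // v _; rewrite addSn ltnS; apply/leq_trans/leq_addl.
Qed.

Definition mpart_encode (l : mpart r n) : {ffun 'I_r * 'I_n -> 'I_n.+1} :=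
  [ffun x : 'I_r * 'I_n => inord (nth 0%N (tnth l x.1) x.2)].
Definition mpart_decode (f : {ffun 'I_r * 'I_n -> 'I_n.+1}) : option (mpart r n) :=
  insub [tuple [seq v <- [seq nat_of_ord (f (k, a)) | a <- enum 'I_n] | v != 0%N]
          | k < r].

Lemma mpart_encodeK : pcancel mpart_encode mpart_decode.
Proof.
move=> l; rewrite /mpart_decode; set u := mktuple _.
suff -> : u = val l by rewrite valK.
apply: eq_from_tnth => k; rewrite tnth_mktuple.
have /andP[_ nz] := mpart_part l k.
have le_n : (sumn (tnth l k) <= n)%N.
  by rewrite -[X in (_ <= X)%N](mpart_sum l) (bigD1 k) //= leq_addr.
have -> : [seq nat_of_ord (mpart_encode l (k, a)) | a <- enum 'I_n]
          = mkseq (nth 0%N (tnth l k)) n.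
  rewrite /mkseq -val_enum_ord -map_comp; apply: eq_map => a /=.
  rewrite ffunE /= inordK // ltnS (leq_trans _ le_n) //.
  have [lt_a|le_a] := ltnP a (size (tnth l k)); last by rewrite nth_default.
  by rewrite (sumnE (tnth l k)) (big_nth 0%N) big_mkord (bigD1 (Ordinal lt_a)) //= leq_addr.
exact: filter_mkseq_nth.
Qed.

HB.instance Definition _ := isFinite.Build (mpart r n) (pcan_enumP mpart_encodeK).

End MpartFinite.

Section DeleteBox.

Variable s : seq nat.

Definition inner_corner (a : nat) := (nth 0%N s a.+1 < nth 0%N s a)%N.
Definition delete_box (a : nat) :=
  [seq x <- set_nth 0%N s a (nth 0%N s a).-1 | x != 0%N].
Definition box_deletions : seq (seq nat) :=
  [seq delete_box a | a <- iota 0 (size s) & inner_corner a].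

End DeleteBox.

Section Necklaces.

Variables r p n : nat.

Notation m := (r %/ p)%N.

(* The component (i+1, j+1) of the necklace, i.e. lambda_(j m + i + 1). *)
Definition neck k (l : mpart r k) (i j : nat) : seq nat :=
  nth [::] l (j * m + i)%N.

(* (mu, i, j) is the (n+1,i,j)-colored necklace with mu having n boxes. *)
Definition colored : finType := (mpart r n * 'I_m * 'I_p)%type : finType.

Definition colored_equiv (c d : colored) : bool :=
  let: (mu, i, j) := c in let: (nu, s, t) := d in
  [exists l : 'I_p, [&& i == s, nat_of_ord t == ((j + l) %% p)%N &
    [forall a : 'I_m, forall b : 'I_p, neck mu a b == neck nu a ((b + l) %% p)]]].

Definition colored_class (c : colored) : {set colored} :=
  [set d | colored_equiv c d].

Definition down (l : mpart r n.+1) (i : 'I_m) (j : 'I_p) : {set {set colored}} :=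
  [set colored_class (mu, i, j) | mu : mpart r n &
    (neck mu i j \in box_deletions (neck l i j)) &&
    [forall a : 'I_m, forall b : 'I_p,
      ((a, b) != (i, j)) ==> (neck mu a b == neck l a b)]].

Definition pairwise_disjoint (l : mpart r n.+1) (i : 'I_m) : pred {set 'I_p} :=
  fun J => [forall s in J, forall t in J,
    (s != t) ==> [disjoint down l i s & down l i t]].

End Necklaces.

Section Modules.

Variables (C : numClosedFieldType) (r : nat) (z : C).
Hypothesis z_prim : r.-primitive_root z.

Lemma z_expD (a b : Zmod r) : z ^+ (a + b)%R = z ^+ a * z ^+ b.
Proof. by rewrite ZmodD ?(prim_order_gt0 z_prim) // prim_expr_mod // exprD. Qed.

Definition gpm_mx n (g : gpm r n) : 'M[C]_n :=
  \matrix_(i, j) (if j == gpm_perm g i then z ^+ gpm_exp g i else 0).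

Definition delta0 n (g : gpm r n) : C := z ^+ gpm_deg g.

Lemma delta0M n : {morph @delta0 n : g h / (g * h)%g >-> g * h}.
Proof. by move=> g h; rewrite /delta0 gpm_degM z_expD. Qed.

Lemma delta01 n : delta0 (1%g : gpm r n) = 1.
Proof. by rewrite /delta0 gpm_deg1. Qed.

Lemma delta0X1 n k : delta0 (1%g : gpm r n) ^+ k = 1.
Proof. by rewrite delta01 expr1n. Qed.

Lemma delta0XM n k (G : {group gpm r n}) :
  {in G &, {morph (fun g => delta0 g ^+ k) : g h / (g * h)%g >-> g * h}}.
Proof. by move=> g h _ _; rewrite delta0M exprMn. Qed.

(* W (x) delta0 ^ k *)
Definition delta0_twist n (G : {group gpm r n}) k (W : representation C G) :=
  twist_repr W (delta0X1 n k) (@delta0XM n k G).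

Lemma gpm_mxM n (g h : gpm r n) : gpm_mx (g * h)%g = gpm_mx g *m gpm_mx h.
Proof.
apply/matrixP => i k; rewrite !mxE (bigD1 (gpm_perm g i)) //= !mxE eqxx.
rewrite big1 => [|j /negPf nj]; last by rewrite !mxE nj mul0r.
by rewrite permM gpm_expM addr0; case: eqP => _; rewrite ?mulr0 // z_expD.
Qed.

Lemma gpm_mx1 n : gpm_mx (1%g : gpm r n) = 1%:M.
Proof.
by apply/matrixP => i j; rewrite !mxE perm1 ffunE eq_sym; case: eqP.
Qed.

Lemma z_neq0 k : z ^+ k != 0.
Proof.
rewrite expf_neq0 //; apply/eqP => z0; have := prim_expr_order z_prim.
by rewrite z0 expr0n (gtn_eqF (prim_order_gt0 z_prim)) => /esym/eqP; rewrite oner_eq0.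
Qed.

Lemma Zmod_lt (a : Zmod r) : (a < r)%N.
Proof. by rewrite -[X in (_ < X)%N](prednK (prim_order_gt0 z_prim)). Qed.

Lemma z_exp_inj (a b : Zmod r) : z ^+ a = z ^+ b -> a = b.
Proof.
move=> /eqP; rewrite (eq_prim_root_expr z_prim) !modn_small ?Zmod_lt // => /eqP.
exact: val_inj.
Qed.

Lemma gpm_mx_inj n : injective (@gpm_mx n).
Proof.
move=> g h /matrixP e.
have ep i : gpm_perm h i = gpm_perm g i.
  apply: contraTeq isT => np; have := e i (gpm_perm h i).
  by rewrite !mxE eqxx (negPf np) => /esym/eqP; rewrite (negPf (z_neq0 _)).
apply: gpm_eq => [|i]; first by apply/permP => i; rewrite ep.
by apply: z_exp_inj; have := e i (gpm_perm g i); rewrite !mxE ep eqxx.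
Qed.

Lemma gpm_mxP n (M : 'M[C]_n) :
  (exists g, M = gpm_mx g) <->
  (exists s : 'S_n, forall i j, if j == s i then M i j ^+ r = 1 else M i j = 0).
Proof.
split=> [[g ->]|[s Ms]].
  exists (gpm_perm g) => i j; rewrite !mxE; case: eqP => // _.
  by rewrite exprAC (prim_expr_order z_prim) expr1n.
have ME i : {a : Zmod r | M i (s i) = z ^+ a}.
  have := Ms i (s i); rewrite eqxx => /(prim_rootP z_prim)[a ->].
  by exists (cast_ord (esym (prednK (prim_order_gt0 z_prim))) a).
exists (Gpm s [ffun i => sval (ME i)]); apply/matrixP => i j; rewrite mxE /= ffunE.
by have := Ms i j; case: eqP => // -> _; case: (ME i).
Qed.

Lemma delta0E n (g : gpm r n) :
  delta0 g = \prod_i \prod_(j | gpm_mx g i j != 0) gpm_mx g i j.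
Proof.
rewrite /delta0 /gpm_deg.
have -> : z ^+ (\sum_i gpm_exp g i)%R = \prod_i z ^+ gpm_exp g i.
  by apply: (big_rec2 (fun (a : Zmod r) b => z ^+ a = b)) => // i a b _ <-; rewrite z_expD.
apply: eq_bigr => i _; rewrite (big_pred1 (gpm_perm g i)) => [|j]; rewrite mxE /= ?eqxx //.
by case: (j == _); rewrite ?z_neq0 ?eqxx.
Qed.

Lemma in_Grp p n (g : gpm r n) : (g \in Grp r p n) = (delta0 g ^+ (r %/ p) == 1).
Proof.
rewrite inE /delta0; set a := gpm_deg g.
have -> : (z ^+ a) ^+ (r %/ p) = z ^+ (a *+ (r %/ p))%R.
  by elim: (r %/ p)%N => [|k IHk] //; rewrite exprS mulrS z_expD IHk.
apply/eqP/eqP => [-> //|e]; exact: z_exp_inj.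
Qed.

Lemma in_Lrp_mx p n (g : gpm r n.+1) :
  (g \in Lrp r n p) = (g \in Grp r p n.+1) && (gpm_mx g ord_max ord_max != 0).
Proof.
by rewrite in_Lrp !mxE eq_sym; case: ifP; rewrite ?z_neq0 ?eqxx.
Qed.

Section Vlambda.

Variables (n : nat) (l : mpart r n).

Notation blocks := {dffun forall k : 'I_r, gpm r (sumn (tnth l k))}.

(* S^(lambda_(k+1)) (x) sigma_(k+1)^(|lambda_(k+1)|) *)
Definition colored_specht (k : 'I_r) :
    representation C [set: gpm r (sumn (tnth l k))] :=
  delta0_twist k
    (@pull_repr C _ _ _ _ (@gpm_perm_morphism r (sumn (tnth l k)))
       (specht C (tnth l k)) (subsetT _)).

Definition external_product : representation C [set: blocks] :=
  \big[@tensor_repr C _ _/one_repr C _]_(k < r)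
    @pull_repr C _ _ _ _
      (@dffun_morphism _ (fun k : 'I_r => gpm r (sumn (tnth l k))) k)
      (colored_specht k) (subsetT _).

Definition Vlam : representation C [set: gpm r n] :=
  ind_repr (subsetT _)
    (@pull_repr C _ _ _ _ (invm_morphism (block_emb_inj r (mpart_sum l)))
       external_product (subsetT _)).

End Vlambda.

Lemma sigma_last1 n k : z ^+ ((1%g : gpm r n * Zmod r).2 * k) = 1.
Proof. by rewrite mul0n. Qed.

Lemma sigma_lastM n k (G : {group gpm r n * Zmod r}) :
  {in G &, {morph (fun x : gpm r n * Zmod r => z ^+ (x.2 * k)) :
     x y / (x * y)%g >-> x * y}}.
Proof. by move=> x y _ _ /=; rewrite !exprM z_expD exprMn. Qed.

(* V^mu (x) sigma_(k+1) as a module for L(r,1,n+1) = G(r,1,n) x Z/r. *)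
Definition last_repr n (l : mpart r n) (k : nat) :
    representation C (last_emb_morphism r n @* setT)%g :=
  @pull_repr C _ _ _ _ (invm_morphism (last_emb_inj r n))
    (twist_repr
       (@pull_repr C _ _ _ _ (fst_morphism (gpm r n) (Zmod r)) (Vlam l) (subsetT _))
       (sigma_last1 n k) (@sigma_lastM n k _))
    (subsetT _).

Section Necklace.

Variables (p n : nat).

Notation m := (r %/ p)%N.

(* The module of a class, computed on any of the colored necklaces in it. *)
Definition Vcolored (X : {set colored r p n}) : representation C (Lrp r n p) :=
  if [pick c in X] is Some (mu, i, j)
  then res_repr (Lrp_sub_last r n p) (last_repr mu (j * m + i))
  else grepr0.

Section Associator.

Variable l : mpart r n.

(* The character delta0 ^ (m e) of C is represented by its exponent e < p. *)
Definition Cstab : {set 'I_p} :=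
  [set e : 'I_p | `[< mx_rsim (delta0_twist (m * e) (Vlam l)) (Vlam l) >]].

Definition stab_order := #|Cstab|.
Definition stab_index := (p %/ stab_order)%N.

(* Modules are spaces of row vectors: h acts by v |-> v *m V h and A by       *)
(* v |-> v *m A.                                                              *)
Definition associator (A : 'M[C]_(rdegree (Vlam l))) :=
  (forall h (v : 'rV_(rdegree (Vlam l))),
     v *m Vlam l h *m A = delta0 h ^+ (m * stab_index) *: (v *m A *m Vlam l h)) /\
  A ^+ stab_order = 1.

Lemma associator_module A (e : C) : associator A ->
  mxmodule (res_repr (subsetT (Grp r p n)) (Vlam l)) (eigenspace A e).
Proof.
case=> hA _; apply/mxmoduleP => g Gg; apply/row_subP => i.
rewrite row_mul; set v := row i _.
have /eigenspaceP vA : (v <= eigenspace A e)%MS by apply: row_sub.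
apply/eigenspaceP; rewrite hA vA -scalemxAl.
by move: Gg; rewrite in_Grp exprM => /eqP->; rewrite expr1n scale1r.
Qed.

(* V^(lambda, delta) for delta = delta0 ^ (m e), which corresponds to the     *)
(* eigenvalue zeta ^ (m e).                                                   *)
Definition Vdelta A (hA : associator A) (e : 'I_p) :
    representation C (Grp r p n) :=
  Representation (submod_repr (associator_module (z ^+ (m * e)) hA)).

End Associator.
End Necklace.
End Modules.

(* In characteristic 0 the socle is the whole module. *)
Definition multiplicity_free (C : numClosedFieldType) (gT : finGroupType)
    (G : {group gT}) (W : representation C G) :=
  forall X : DecSocleType W, socle_mult X = 1%N.

(* Main.v *)
(* The modules V^lambda and V^mu (x) sigma are recognized by Young-type pairs:  *)
(* a signed column sum times a row sum attached to a tableau acts nontrivially  *)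
(* on exactly one irreducible module, up to isomorphism, also after restriction *)
(* to L(r,p,n). This gives irreducibility and the isomorphisms between these    *)
(* modules, and the embedding of V^mu (x) sigma in the restriction of V^lambda  *)
(* when mu is lambda with a box removed. On the functions on r-tuples of Young  *)
(* diagrams the operators of adding and removing a box satisfy [U, D] = 1, so   *)
(* that the dimension bounds from these embeddings and from Frobenius           *)
(* reciprocity are sharp; they yield the branching rule from G(r,1,n) and that  *)
(* the V^lambda are all the irreducible modules.                                *)
(* Projecting to an eigenspace of the associator keeps each V^mu (x) sigma,     *)
(* since the powers of the associator have distinct weights for the diagonal    *)
(* matrices diag(1,...,1,x). A class of colored necklaces contains at most      *)
(* |C_lambda| of the pairs (mu, sigma), because rotations carrying one to       *)
(* another stabilize lambda, so by counting dimensions each of the |C_lambda|   *)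
(* eigenspaces is the sum of one module for each class.                         *)
Require Import Defs.
From HB Require Import structures.
From mathcomp Require Import all_boot all_order all_fingroup all_algebra.
From mathcomp Require Import all_solvable all_field all_character.
From mathcomp Require Import boolp zify.

Set Implicit Arguments.
Unset Strict Implicit.
Unset Printing Implicit Defensive.

Import Order.TTheory GRing.Theory Num.Theory.
Local Open Scope ring_scope.

(** * Intertwiners *)

(** The decomposition is a squeeze between dimensions. Let u be [stab_order] and [A] an associator
    of V^lambda. [A] commutes with G(r,p,n) up to a character that is trivial there, so its
    eigenspaces are G(r,p,n)-modules. Let S be the sum of the degrees of the modules of all classes
    of colored necklaces obtained from lambda by deleting a box.

    Lower bound: if mu is lambda without a box of component k, then V^mu (x) sigma_k embeds in the
    restriction of V^lambda by some f ([cover_embeds]). The matrices diag(1,...,1,x) act on the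
    images of f A^t by characters that differ for different t < u, so no projection to an eigenspace
    kills f ([eigen_proj_neq0], [down_embeds]). Modules of distinct classes are irreducible and not
    isomorphic, so each of the u eigenspaces has dimension at least S ([classes_leq]). Upper bound:
    the degree of V^lambda is the sum over all deletions of a box ([branching_dim]), and a class
    contains at most u deletions, because a rotation between two deletions of lambda stabilizes
    lambda ([covered_rotated], [card_fiber]). So the degree is at most u S, and every eigenspace has
    dimension S ([eigen_rank]). The sets J(i) meet each class exactly once ([removal_down],
    [total_embeds]).

    The modules are identified by Young pairs: subgroups P, Q with linear characters whose weighted
    sums A, B have a product e = AB with e x e a multiple of e for all x and e e nonzero
    ([young_scalar]). Up to isomorphism at most one irreducible module is not killed by e
    ([young_embeds]), and a module generated by a polytabloid is such a module
    ([young_generated_irr]). The row and column groups of a tableau of an r-tuple of diagrams form a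
    Young pair ([young_tableau]), in G(r,1,n) and also in L(r,p,n). Isomorphisms come from
    relabelling a tableau ([has_type_relabel]), distinctness from comparing two tableaux on one
    module ([young_types_compare]).

    For [branching_dim], the embeddings bound the degree of V^lambda from below, Frobenius
    reciprocity bounds the sum of the degrees above mu from above, and the commutation relation
    [up_down] makes both bounds sharp. The same count leaves no room for other irreducible modules
    ([Vlam_complete]). Hence every irreducible G(r,p,n)-module embeds in an eigenspace of an
    associator, which over L(r,p,n) is a sum of pairwise nonisomorphic irreducibles; this gives
    multiplicity one ([restriction_free]). *)

Section Intertwiners.

Variables (C : numClosedFieldType) (gT : finGroupType) (G : {group gT}).
Notation reprG := (mx_representation C G).

Definition intertwines n1 n2 (U : reprG n1) (W : reprG n2) (f : 'M_(n1, n2)) :=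
  forall g, g \in G -> U g *m f = f *m W g.

Definition embeds n1 n2 (U : reprG n1) (W : reprG n2) :=
  exists2 f, row_free f & intertwines U W f.

Lemma card_neq0 : #|G|%:R != 0 :> C.
Proof. by rewrite pnatr_eq0 -lt0n cardG_gt0. Qed.

Lemma intertwines_mul n1 n2 n3 (U : reprG n1) (V : reprG n2) (W : reprG n3) f g :
  intertwines U V f -> intertwines V W g -> intertwines U W (f *m g).
Proof. by move=> hf hg x Gx; rewrite mulmxA hf // -!mulmxA hg. Qed.

Lemma embeds_trans n1 n2 n3 (U : reprG n1) (V : reprG n2) (W : reprG n3) :
  embeds U V -> embeds V W -> embeds U W.
Proof.
move=> [f ff hf] [g fg hg]; exists (f *m g); last exact: intertwines_mul hf hg.
by rewrite /row_free mxrankMfree.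
Qed.

Lemma rsim_embeds n1 n2 (U : reprG n1) (W : reprG n2) : mx_rsim U W -> embeds U W.
Proof. by case=> f _ ff hf; exists f. Qed.

Lemma embeds_rsim n1 n2 (U : reprG n1) (W : reprG n2) :
  embeds U W -> n1 = n2 -> mx_rsim U W.
Proof. by move=> [f ff hf] e; exists f. Qed.

Lemma embeds_leq n1 n2 (U : reprG n1) (W : reprG n2) : embeds U W -> (n1 <= n2)%N.
Proof. by move=> [f /eqP ff _]; rewrite -ff rank_leq_col. Qed.

(** Maschke averaging without the factor 1/|G|, which is supplied where it is wanted. *)
Definition average n1 n2 (U : reprG n1) (W : reprG n2) (F : 'M_(n1, n2)) :=
  \sum_(g in G) U g^-1%g *m F *m W g.

Lemma average_intertwines n1 n2 (U : reprG n1) (W : reprG n2) F :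
  intertwines U W (average U W F).
Proof.
move=> x Gx; rewrite /average mulmx_sumr mulmx_suml.
rewrite [RHS](reindex_acts 'R _ (groupVr Gx)) ?astabsR //=.
apply: eq_bigr => g Gg; rewrite -!mulmxA -repr_mxM ?groupM ?groupV // mulgKV.
by rewrite invMg invgK !mulmxA -repr_mxM ?groupV.
Qed.

(** Maschke: the average of a linear inverse of [f] is still an inverse, because [f] intertwines. *)
Lemma embeds_retract n1 n2 (U : reprG n1) (W : reprG n2) f :
  row_free f -> intertwines U W f ->
  exists2 f', f *m f' = 1%:M & intertwines W U f'.
Proof.
move=> /row_freeP[f' ff'] hf; exists (#|G|%:R^-1 *: average W U f').
  rewrite -scalemxAr mulmx_sumr (eq_bigr (fun=> 1%:M)) => [|g Gg].
    by rewrite sumr_const -scaler_nat scalerA mulVf ?card_neq0 // scale1r.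
  rewrite !mulmxA -hf ?groupV // -(mulmxA (U _)) ff' mulmx1.
  by rewrite -repr_mxM ?groupV // mulVg repr_mx1.
by move=> g Gg; rewrite -scalemxAr average_intertwines // -scalemxAl.
Qed.

(** Maschke for a surjection: averaging a linear section splits it. *)
Lemma intertwines_full_embeds n1 n2 (U : reprG n1) (W : reprG n2) f :
  row_full f -> intertwines U W f -> embeds W U.
Proof.
move=> /row_fullP[f' ff'] hf; exists (#|G|%:R^-1 *: average W U f'); last first.
  by move=> g Gg; rewrite -scalemxAr average_intertwines // -scalemxAl.
apply/row_freeP; exists f; rewrite -scalemxAl mulmx_suml (eq_bigr (fun=> 1%:M)).
  by rewrite sumr_const -scaler_nat scalerA mulVf ?card_neq0 // scale1r.
move=> g Gg; rewrite -!mulmxA hf // (mulmxA f') ff' mul1mx.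
by rewrite -repr_mxM ?groupV // mulVg repr_mx1.
Qed.

Lemma intertwines_ker n1 n2 (U : reprG n1) (W : reprG n2) f :
  intertwines U W f -> mxmodule U (kermx f).
Proof.
move=> hf; apply/mxmoduleP => g Gg; apply/sub_kermxP.
by rewrite -mulmxA hf // mulmxA mulmx_ker mul0mx.
Qed.

Lemma intertwines_im n1 n2 (U : reprG n1) (W : reprG n2) f :
  intertwines U W f -> mxmodule W f.
Proof. by move=> hf; apply/mxmoduleP => g Gg; rewrite -hf // submxMl. Qed.

Lemma irr_intertwines_free n1 n2 (U : reprG n1) (W : reprG n2) f :
  mx_irreducible U -> intertwines U W f -> f != 0 -> row_free f.
Proof.
case/mx_irrP=> _ irrU hf f0; rewrite -kermx_eq0; apply: contraNT f0 => k0.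
have := irrU _ (intertwines_ker hf) k0; rewrite -sub1mx => /sub_kermxP.
by rewrite mul1mx => ->.
Qed.

Lemma irr_intertwines_full n1 n2 (U : reprG n1) (W : reprG n2) f :
  mx_irreducible W -> intertwines U W f -> f != 0 -> row_full f.
Proof.
case/mx_irrP=> _ irrW hf f0.
have := irrW <<f>>%MS; rewrite (eqmx_module _ (genmxE f)) => /(_ (intertwines_im hf)).
rewrite -mxrank_eq0 genmxE mxrank_eq0 => /(_ f0).
by rewrite /row_full genmxE.
Qed.

Lemma irr_intertwines_rsim n1 n2 (U : reprG n1) (W : reprG n2) f :
  mx_irreducible U -> mx_irreducible W -> intertwines U W f -> f != 0 -> mx_rsim U W.
Proof.
move=> iU iW hf f0; have := irr_intertwines_full iW hf f0.
have ff := irr_intertwines_free iU hf f0; rewrite /row_full (eqP ff) => /eqP e.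
by exists f.
Qed.

Lemma irr_endo_scalar n (U : reprG n) f :
  mx_irreducible U -> intertwines U U f -> exists c, f = c%:M.
Proof.
move=> iU hf; apply/is_scalar_mxP.
apply: (mx_abs_irr_cent_scalar (group_closure_closed_field iU)).
by apply/centgmxP => g Gg; rewrite hf.
Qed.

Lemma embeds_irr_submod n (W : reprG n) : (0 < n)%N ->
  exists U : representation C G, mx_irreducible U /\ embeds U W.
Proof.
move=> n_gt0; have nz1 : (1%:M : 'M[C]_n) != 0.
  by rewrite -mxrank_eq0 mxrank1 -lt0n.
have [V simV _] : exists2 V, mxsimple W V & (V <= 1%:M)%MS.
  (* [mxsimple_exists] gives its witness only towards a boolean goal, hence the detour through a
     contradiction. *)
  apply: contrapT => nV; suff: false by [].
  by apply: (mxsimple_exists (mxmodule1 W) nz1) => eV; case: nV.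
exists (Representation (submod_repr (mxsimple_module simV))); split.
  exact/submod_mx_irr.
exists (row_base V); first exact: row_base_free.
move=> g Gg; have := val_submodJ (mxsimple_module simV) 1%:M Gg.
by rewrite /val_submod /= !mul1mx.
Qed.

Lemma dadd_inl (U V : representation C G) :
  intertwines U (dadd_grepr U V) (row_mx 1%:M 0).
Proof.
move=> g Gg /=; rewrite mul_mx_row mul_row_block.
by rewrite !mulmx0 !mul1mx mul0mx mulmx1 !addr0.
Qed.

Lemma dadd_inr (U V : representation C G) :
  intertwines V (dadd_grepr U V) (row_mx 0 1%:M).
Proof.
move=> g Gg /=; rewrite mul_mx_row mul_row_block.
by rewrite !mulmx0 !mul1mx mul0mx mulmx1 !add0r.
Qed.

Lemma intertwines_daddr (n : nat) (W : reprG n) (U V : representation C G)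
    (f : 'M_(n, rdegree U + rdegree V)) :
  intertwines W (dadd_grepr U V) f ->
  intertwines W U (lsubmx f) /\ intertwines W V (rsubmx f).
Proof.
move=> hf; split=> g Gg; have := hf g Gg; rewrite /= -{1 2}[f]hsubmxK;
  rewrite mul_mx_row mul_row_block !mulmx0 addr0 add0r => /eq_row_mx[]//.
Qed.

Lemma intertwines_daddl (n : nat) (W : reprG n) (U V : representation C G) f g :
  intertwines U W f -> intertwines V W g ->
  intertwines (dadd_grepr U V) W (col_mx f g).
Proof.
move=> hf hg x Gx /=; rewrite mul_block_col !mul0mx addr0 add0r.
by rewrite mul_col_mx hf // hg.
Qed.

Section DirectSums.

Variables (I : eqType) (U : I -> representation C G).
Notation dsum s := (\big[@dadd_grepr C _ G/grepr0]_(x <- s) U x).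

Lemma rdegree_dsum s : rdegree (dsum s) = (\sum_(x <- s) rdegree (U x))%N.
Proof. by elim/big_rec2: _ => // i n W _ <-. Qed.

Lemma intertwines_dsum0 n (W : reprG n) s f :
  (forall x f', x \in s -> intertwines W (U x) f' -> f' = 0) ->
  intertwines W (dsum s) f -> f = 0.
Proof.
elim: s f => [|x s IHs] f h0.
  by move: f; rewrite big_nil /= => f _; rewrite thinmx0.
move: f; rewrite big_cons => f /intertwines_daddr[hl hr].
rewrite -[f]hsubmxK (h0 x (lsubmx f)) ?mem_head // (IHs (rsubmx f)) ?row_mx0 //.
by move=> y f' ys; apply: h0; rewrite inE ys orbT.
Qed.

Lemma dsum_intertwines0 n (W : reprG n) s f :
  (forall x f', x \in s -> intertwines (U x) W f' -> f' = 0) ->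
  intertwines (dsum s) W f -> f = 0.
Proof.
elim: s f => [|x s IHs] f h0.
  by move: f; rewrite big_nil /= => f _; rewrite flatmx0.
move: f; rewrite big_cons => f hf.
have h2 := intertwines_mul (@dadd_inr (U x) (dsum s)) hf.
have h1 := intertwines_mul (@dadd_inl (U x) (dsum s)) hf.
rewrite -[f]mul1mx scalar_mx_block /block_mx mul_col_mx.
rewrite (h0 x _ _ h1) ?mem_head // (IHs _ _ h2) ?col_mx0 //.
by move=> y f' ys; apply: h0; rewrite inE ys orbT.
Qed.

Lemma embeds_dsum n (W : reprG n) s : uniq s ->
  (forall x y f, x \in s -> y \in s -> x != y -> intertwines (U x) (U y) f -> f = 0) ->
  {in s, forall x, embeds (U x) W} -> embeds (dsum s) W.
Proof.
elim: s => [_ _ _|x s IHs /=/andP[xs us] dis emb].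
  by rewrite big_nil; exists 0 => [|g _]; rewrite ?mul0mx ?mulmx0 // /row_free mxrank0.
rewrite big_cons.
have [f ff hf] : embeds (dsum s) W.
  apply: IHs => // [y y' h ys ys'|y ys]; [apply: dis|apply: emb];
  by rewrite inE ?ys ?ys' orbT.
have [fx ffx hfx] := emb x (mem_head _ _).
have [f' ff' hf'] := embeds_retract ff hf.
have [fx' ffx' hfx'] := embeds_retract ffx hfx.
exists (col_mx fx f); last exact: intertwines_daddl.
have fxf' : fx *m f' = 0.
  apply: (intertwines_dsum0 _ (intertwines_mul hfx hf')) => y h ys hh.
  apply: dis hh; rewrite ?mem_head ?inE ?ys ?orbT //.
  by apply: contraNneq xs => ->.
(* The retraction [fx'] is corrected along [f] so that it vanishes on the other summands. *)
apply/row_freeP; exists (row_mx (fx' - f' *m f *m fx') f').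
rewrite mul_col_row !mulmxBr !mulmxA fxf' ff' ffx' mul1mx !mul0mx.
by rewrite subr0 subrr -scalar_mx_block.
Qed.

Lemma embeds_dsum_irr n (W : reprG n) s : uniq s ->
  {in s, forall x, mx_irreducible (U x)} ->
  {in s &, forall x y, mx_rsim (U x) (U y) -> x = y} ->
  {in s, forall x, embeds (U x) W} -> embeds (dsum s) W.
Proof.
move=> us irr inj; apply: embeds_dsum => // x y f xs ys nxy hf.
apply: contraNeq nxy => f0; rewrite (inj x y) //.
by apply: irr_intertwines_rsim hf f0; apply: irr.
Qed.

Lemma embeds_dsum_leq n (W : reprG n) s : uniq s ->
  {in s, forall x, mx_irreducible (U x)} ->
  {in s &, forall x y, mx_rsim (U x) (U y) -> x = y} ->
  {in s, forall x, embeds (U x) W} -> (\sum_(x <- s) rdegree (U x) <= n)%N.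
Proof.
by move=> us irr inj /(embeds_dsum_irr us irr inj)/embeds_leq; rewrite rdegree_dsum.
Qed.

End DirectSums.

End Intertwiners.

(** With the inverse in the weight this is, for a subgroup [P] and a linear [chi], [#|P|] times the
    projection to the vectors on which [P] acts by [chi]. *)
HB.lock Definition wsum (C : numClosedFieldType) (gT : finGroupType) (P : {set gT})
    (chi : gT -> C) (G : {group gT}) n (W : mx_representation C G n) : 'M[C]_n :=
  \sum_(g in P) chi g^-1%g *: W g.

(** * Sums of group elements weighted by linear characters *)

Section WeightedSums.

Variables (C : numClosedFieldType) (gT : finGroupType).
Notation reprC G n := (mx_representation C G n).

Record linear_on (P : {set gT}) (chi : gT -> C) : Prop := LinearOn {
  linear_on1 : chi 1%g = 1;
  linear_onM : {in P &, {morph chi : x y / (x * y)%g >-> x * y}} }.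

Section OneSum.

Variables (P G : {group gT}) (chi : gT -> C).
Hypotheses (sPG : P \subset G) (lin : linear_on P chi).
Variables (n : nat) (W : reprC G n).

Lemma linear_onV g : g \in P -> chi g * chi g^-1%g = 1.
Proof. by move=> Pg; rewrite -(linear_onM lin) ?groupV // mulgV (linear_on1 lin). Qed.

Lemma linear_on_neq0 g : g \in P -> chi g != 0.
Proof.
move=> Pg; apply: contraTneq isT => c0; have := linear_onV Pg.
by rewrite c0 mul0r => /eqP; rewrite eq_sym oner_eq0.
Qed.

Lemma wsum_mull g : g \in P -> W g *m wsum P chi W = chi g *: wsum P chi W.
Proof.
move=> Pg; rewrite wsum.unlock mulmx_sumr scaler_sumr.
rewrite [RHS](reindex_inj (mulgI g)) /=; apply: eq_big => [h|h Ph].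
  by rewrite groupMl.
rewrite -scalemxAr -repr_mxM ?(subsetP sPG) // scalerA invMg.
rewrite (linear_onM lin) ?groupV // mulrCA mulrA.
by rewrite -[_ * _ * _]mulrA linear_onV // mulr1.
Qed.

Lemma wsum_mulr g : g \in P -> wsum P chi W *m W g = chi g *: wsum P chi W.
Proof.
move=> Pg; rewrite wsum.unlock mulmx_suml scaler_sumr.
rewrite [RHS](reindex_inj (mulIg g)) /=; apply: eq_big => [h|h Ph].
  by rewrite groupMr.
rewrite -scalemxAl -repr_mxM ?(subsetP sPG) // scalerA invMg.
by rewrite (linear_onM lin) ?groupV // mulrA linear_onV // mul1r.
Qed.

Lemma equivariant_wsum m (w : 'M_(m, n)) :
  (forall g, g \in P -> w *m W g = chi g *: w) -> w *m wsum P chi W = #|P|%:R *: w.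
Proof.
move=> wP; rewrite wsum.unlock mulmx_sumr (eq_bigr (fun=> w)).
  by rewrite sumr_const scaler_nat.
by move=> g Pg; rewrite -scalemxAr wP // scalerA mulrC linear_onV // scale1r.
Qed.

Lemma wsum_equivariant m (w : 'M_(n, m)) :
  (forall g, g \in P -> W g *m w = chi g *: w) -> wsum P chi W *m w = #|P|%:R *: w.
Proof.
move=> wP; rewrite wsum.unlock mulmx_suml (eq_bigr (fun=> w)).
  by rewrite sumr_const scaler_nat.
by move=> g Pg; rewrite -scalemxAl wP // scalerA mulrC linear_onV // scale1r.
Qed.

End OneSum.

Lemma intertwines_wsum (G : {group gT}) n1 n2 (U : reprC G n1) (W : reprC G n2) f
    (P : {set gT}) chi : P \subset G -> intertwines U W f ->
  wsum P chi U *m f = f *m wsum P chi W.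
Proof.
move=> sPG hf; rewrite wsum.unlock mulmx_suml mulmx_sumr; apply: eq_bigr => g Pg.
by rewrite -scalemxAl -scalemxAr hf // (subsetP sPG).
Qed.

(* For subgroups P, Q with linear characters chi, psi this is the condition   *)
(* that the induced modules of chi and psi have a one-dimensional Hom space,  *)
(* spanned by the double coset P Q (Mackey).                                  *)
Record young (G P Q : {group gT}) (chi psi : gT -> C) : Prop := Young {
  young_sub1 : P \subset G;
  young_sub2 : Q \subset G;
  young_lin1 : linear_on P chi;
  young_lin2 : linear_on Q psi;
  young_agree : {in P & Q, forall g h, g = h -> chi g = psi h};
  young_mackey : forall x, x \in G ->
    (exists g h, [/\ g \in P, h \in Q & x = (g * h)%g]) \/
    (exists g h, [/\ g \in P, h \in Q, (g * x = x * h)%g & chi g <> psi h]) }.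

(** * Young pairs and the irreducible module that they single out *)

Section Young.

Variables (G P Q : {group gT}) (chi psi : gT -> C).
Hypothesis yG : young G P Q chi psi.
Let sPG := young_sub1 yG.
Let sQG := young_sub2 yG.

Notation A W := (wsum P chi W).
Notation B W := (wsum Q psi W).

(** The scalar depends on x only, not on the module. If x = gh, the characters of g and h come out
    of the two sums; otherwise some g x = x h multiplies A x B by two different scalars, so A x B =
    0. *)
Lemma young_mackey_coef : exists c : gT -> C, forall n (W : reprC G n) x, x \in G ->
  A W *m W x *m B W = c x *: (A W *m B W).
Proof.
pose c x := if [pick u : gT * gT | [&& u.1 \in P, u.2 \in Q & x == (u.1 * u.2)%g]]
            is Some u then chi u.1 * psi u.2 else 0.
exists c => n W x Gx; rewrite /c; case: pickP => [[g h] /= /and3P[Pg Qh /eqP->]|no].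
  rewrite repr_mxM ?(subsetP sPG g) ?(subsetP sQG h) // mulmxA.
  rewrite (wsum_mulr sPG (young_lin1 yG)) // -!scalemxAl -mulmxA.
  by rewrite (wsum_mull sQG (young_lin2 yG)) // -scalemxAr scalerA.
rewrite scale0r; case: (young_mackey yG Gx) => [[g [h [Pg Qh e]]]|[g [h [Pg Qh e ne]]]].
  by have := no (g, h); rewrite /= Pg Qh e eqxx.
have [Gg Gh] := (subsetP sPG g Pg, subsetP sQG h Qh).
have e1 : A W *m W (g * x)%g *m B W = chi g *: (A W *m W x *m B W).
  by rewrite repr_mxM // mulmxA (wsum_mulr sPG (young_lin1 yG)) // -!scalemxAl.
have : A W *m W (g * x)%g *m B W = psi h *: (A W *m W x *m B W).
  rewrite e repr_mxM // mulmxA -(mulmxA _ (W h)).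
  by rewrite (wsum_mull sQG (young_lin2 yG)) // -scalemxAr.
rewrite e1.
move/eqP; rewrite -subr_eq0 -scalerBl scaler_eq0 subr_eq0 => /orP[/eqP//|/eqP//].
Qed.

(** Expanding the inner B x A into group elements leaves products A y B. *)
Lemma young_coef : exists lam : gT -> C, forall n (W : reprC G n) x, x \in G ->
  (A W *m B W) *m W x *m (A W *m B W) = lam x *: (A W *m B W).
Proof.
have [c cE] := young_mackey_coef.
exists (fun x => \sum_(g in Q) \sum_(h in P)
          psi g^-1%g * chi h^-1%g * c (g * x * h)%g) => n W x Gx.
have BxA : B W *m W x *m A W =
    \sum_(g in Q) \sum_(h in P) (psi g^-1%g * chi h^-1%g) *: W (g * x * h)%g.
  rewrite !wsum.unlock !mulmx_suml; apply: eq_bigr => g Qg; rewrite mulmx_sumr.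
  apply: eq_bigr => h Ph; have [Gg Gh] := (subsetP sQG g Qg, subsetP sPG h Ph).
  by rewrite -!scalemxAl -scalemxAr scalerA -!repr_mxM ?groupM.
have -> : A W *m B W *m W x *m (A W *m B W) = A W *m (B W *m W x *m A W) *m B W.
  by rewrite !mulmxA.
rewrite BxA mulmx_sumr mulmx_suml scaler_suml; apply: eq_bigr => g Qg.
rewrite mulmx_sumr mulmx_suml scaler_suml; apply: eq_bigr => h Ph.
have [Gg Gh] := (subsetP sQG g Qg, subsetP sPG h Ph).
by rewrite -scalemxAr -scalemxAl cE ?groupM // scalerA.
Qed.

(** Elements have finite order, so the values of [th] have modulus 1 and inversion is
    conjugation. *)
Lemma linear_on_unitary (K : {group gT}) (th : gT -> C) g :
  linear_on K th -> g \in K -> (th g^-1%g)^* = th g.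
Proof.
move=> lin Kg; have thX k : th (g ^+ k)%g = th g ^+ k.
  elim: k => [|k IHk]; first by rewrite (linear_on1 lin).
  by rewrite expgS exprS (linear_onM lin) ?groupX // IHk.
have n1 : `|th g| = 1.
  apply/eqP; rewrite -(@pexpr_eq1 _ _ #[g]%g) ?order_gt0 //.
  by rewrite -normrX -thX expg_order (linear_on1 lin) normr1 eqxx.
have := linear_onV lin Kg => /(congr1 (fun u => (th g)^* * u)).
by rewrite mulrA [_^* * _]mulrC -normCK n1 expr1n mul1r mulr1 => ->; rewrite conjCK.
Qed.

Notation "M ^h" := (map_mx Num.conj M)^T (at level 8, format "M ^h").

Lemma mulmx_adj_eq0 m n (M : 'M[C]_(m, n)) : M *m M^h = 0 -> M = 0.
Proof.
move=> M0; apply/matrixP => i j; rewrite mxE.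
have := congr1 (fun X : 'M_m => X i i) M0; rewrite !mxE.
under eq_bigr do rewrite !mxE -normCK.
move/eqP; rewrite psumr_eq0 => [|k _]; last by rewrite exprn_ge0.
by move/allP/(_ j); rewrite mem_index_enum expf_eq0 /= normr_eq0 => /(_ isT)/eqP.
Qed.

Lemma mulmx_adj m n q (M : 'M[C]_(m, n)) (N : 'M_(n, q)) : (M *m N)^h = N^h *m M^h.
Proof. by rewrite map_mxM trmx_mul. Qed.

Notation aG := (regular_repr C G).

Lemma regular_adj g : g \in G -> (aG g)^h = aG g^-1%g.
Proof.
move=> Gg; apply/matrixP => i j; rewrite !mxE /=.
have e (x : gT) (k l : 'I_#|G|) : x \in G -> (k == gring_index G (enum_val l * x)) =
    (enum_val k == (enum_val l * x)%g :> gT).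
  move=> Gx; apply/eqP/eqP => [->|<-]; last by rewrite gring_valK.
  by rewrite gring_indexK // groupM ?enum_valP.
rewrite !e ?groupV // rmorph_nat; congr (_%:R); congr nat_of_bool.
by apply/eqP/eqP => ->; rewrite ?mulgK ?mulgKV.
Qed.

Lemma wsum_adj (K : {group gT}) (th : gT -> C) :
  K \subset G -> linear_on K th -> (wsum K th aG)^h = wsum K th aG.
Proof.
move=> sKG lin; rewrite wsum.unlock.
rewrite raddf_sum [LHS]raddf_sum /= [RHS](reindex_inj invg_inj) /=.
apply: eq_big => [g|g Kg]; first by rewrite groupV.
rewrite map_mxZ linearZ /= (linear_on_unitary lin) // -regular_adj //.
  by rewrite invgK.
exact: subsetP Kg.
Qed.

Lemma wsum_sqr (K : {group gT}) (th : gT -> C) n (W : reprC G n) :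
  K \subset G -> linear_on K th ->
  wsum K th W *m wsum K th W = #|K|%:R *: wsum K th W.
Proof.
move=> sKG lin; apply: (equivariant_wsum lin) => g Kg.
exact: (wsum_mulr sKG lin).
Qed.

(** The coefficient of the identity in AB is the number of elements common to P and Q: each such
    element contributes 1 because the characters agree there. *)
Lemma young_regular_row_neq0 :
  delta_mx (0 : 'I_1) (gring_index G 1) *m (A aG *m B aG) != 0.
Proof.
apply/eqP => AB0; pose d x : 'rV[C]_#|G| := delta_mx 0 (gring_index G x).
have dM x y : x \in G -> y \in G -> d x *m aG y = d (x * y)%g.
  by move=> Gx Gy; rewrite /d -rowE rowK gring_indexK.
have /eqP : (d 1%g *m (A aG *m B aG)) 0 (gring_index G 1) = 0 by rewrite AB0 mxE.
rewrite mulmxA {1}wsum.unlock mulmx_sumr mulmx_suml summxE.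
rewrite (eq_bigr (fun g => ((g \in Q)%:R : C))) => [|g Pg].
  rewrite -natr_sum pnatr_eq0 sum_nat_eq0 => /forall_inP/(_ 1%g (group1 _)).
  by rewrite group1.
have Gg := subsetP sPG g Pg.
rewrite -scalemxAr -scalemxAl dM // mul1g wsum.unlock mulmx_sumr mxE summxE mulr_sumr.
rewrite (eq_bigr (fun h => (h == g^-1%g)%:R * (chi g^-1%g * psi h^-1%g))) => [|h Qh].
  have [Qg|nQg] := boolP (g \in Q).
    rewrite (bigD1 g^-1%g) ?groupV //= eqxx mul1r invgK big1 => [|h /andP[_ /negPf->]].
      rewrite addr0 -(young_agree yG Pg Qg (erefl _)) mulrC.
      exact: linear_onV (young_lin1 yG) _ Pg.
    by rewrite mul0r.
  rewrite big1 // => h Qh; case: eqP => [e|]; last by rewrite mul0r.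
  by case/negP: nQg; rewrite -groupV -e.
have Gh := subsetP sQG h Qh.
rewrite -scalemxAr dM // !mxE eqxx /= mulrCA mulrA mulrC; congr (_%:R * _); last by rewrite mulrC.
congr nat_of_bool; apply/eqP/eqP => [/(congr1 enum_val)|->]; last by rewrite mulgV.
rewrite !gring_indexK ?groupM // => e.
by apply: (mulgI g); rewrite mulgV.
Qed.

Lemma young_regular_neq0 : A aG *m B aG != 0.
Proof. by apply: contraNneq young_regular_row_neq0 => ->; rewrite mulmx0. Qed.

(** A positivity argument in the regular representation, where A and B are self-adjoint and
    idempotent up to a nonzero factor. If ABAB = 0, then ABA times its adjoint vanishes, so ABA = 0;
    this is AB times its adjoint up to a factor, so AB = 0, against [young_regular_neq0]. *)
Lemma young_scalar : exists lam : gT -> C, lam 1%g != 0 /\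
  forall n (W : reprC G n) x, x \in G ->
    (A W *m B W) *m W x *m (A W *m B W) = lam x *: (A W *m B W).
Proof.
have [lam lamE] := young_coef; exists lam; split=> //.
apply/eqP => lam0; have := lamE _ aG 1%g (group1 G).
rewrite lam0 scale0r repr_mx1 mulmx1 => ABAB.
case/eqP: young_regular_neq0; apply: mulmx_adj_eq0.
have [l1 l2] := (young_lin1 yG, young_lin2 yG).
rewrite mulmx_adj !wsum_adj // -mulmxA (mulmxA (B aG)) wsum_sqr //.
rewrite -scalemxAl -scalemxAr; apply/eqP; rewrite scaler_eq0 mulmxA.
apply/orP; right; apply/eqP; apply: mulmx_adj_eq0.
rewrite !mulmx_adj !wsum_adj // !mulmxA -(mulmxA _ (A aG) (A aG)) wsum_sqr //.
by rewrite -!scalemxAr -!scalemxAl -[A aG *m _ *m _ *m _]mulmxA ABAB mul0mx scaler0.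
Qed.

(** Write e and e' for AB on the two modules. Averaging e X e' gives an intertwiner, and multiplying
    it by e and e' returns N e X e' with N the sum of lam(g^-1) lam(g). Once N is nonzero, any X
    with e X e' nonzero gives a nonzero intertwiner out of an irreducible module. *)
Lemma young_embeds n n' (W : reprC G n) (W' : reprC G n') :
  mx_irreducible W -> A W *m B W != 0 -> A W' *m B W' != 0 -> embeds W W'.
Proof.
move=> irrW; have [lam [lam1 lamE]] := young_scalar => e0 e'0.
pose N := \sum_(g in G) lam g^-1%g * lam g.
have avgE k (V : reprC G k) (e := A W *m B W) (e' := A V *m B V) (X : 'M_(n, k)) :
    e *m average W V (e *m X *m e') *m e' = N *: (e *m X *m e').
  rewrite /average mulmx_sumr mulmx_suml scaler_suml; apply: eq_bigr => g Gg.
  have -> : e *m (W g^-1%g *m (e *m X *m e') *m V g) *m e' =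
      (e *m W g^-1%g *m e) *m X *m (e' *m V g *m e') by rewrite !mulmxA.
  by rewrite !lamE ?groupV // -scalemxAr -!scalemxAl scalerA mulrC.
have nzX k (a : 'M[C]_n) (b : 'M[C]_k) : a != 0 -> b != 0 -> exists X : 'M_(n, k), a *m X *m b != 0.
  move=> a0 b0.
  have [i [j aij]] : exists i j, a i j != 0.
    apply: contrapT => no; case/eqP: a0; apply/matrixP => i j; rewrite mxE.
    by apply: contrapT => aij; apply: no; exists i, j; apply/eqP.
  have [i' [j' bij]] : exists i j, b i j != 0.
    apply: contrapT => no; case/eqP: b0; apply/matrixP => i' j'; rewrite mxE.
    by apply: contrapT => bij; apply: no; exists i', j'; apply/eqP.
  exists (delta_mx j i'); apply: contraNneq (mulf_neq0 aij bij).
  move/(congr1 (fun M : 'M_(n, k) => M i j')).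
  rewrite -(mul_delta_mx (0 : 'I_1)) mulmxA -colE -mulmxA -rowE !mxE.
  by rewrite big_ord1 !mxE => ->.
have ee : (A W *m B W) *m (A W *m B W) = lam 1%g *: (A W *m B W).
  by rewrite -lamE // repr_mx1 mulmx1.
(* Take W' = W and X an elementary matrix between two factors e. By Schur the average is a scalar;
   if N = 0 the scalar is 0, and its trace is |G| lam(1) times an arbitrary entry of e, so e = 0. *)
have N0 : N != 0.
  apply: contraNneq e0 => N0; apply/eqP/matrixP => i j.
  pose X := A W *m B W *m delta_mx j i *m (A W *m B W).
  have [c cE] := irr_endo_scalar irrW (average_intertwines W W X).
  have := avgE _ W (delta_mx j i); rewrite -/X cE N0 scale0r mul_mx_scalar -scalemxAl ee.
  rewrite scalerA => /eqP; rewrite scaler_eq0 mulf_eq0 (negPf lam1) orbF.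
  case/orP=> [/eqP c0|/eqP->]; last by [].
  have : \tr (average W W X) = 0 by rewrite cE c0 mxtrace_scalar mul0rn.
  rewrite /average raddf_sum /= (eq_bigr (fun=> \tr X)) => [|g Gg]; last first.
    by rewrite mxtrace_mulC mulmxA -repr_mxM ?groupV // mulgV repr_mx1 mul1mx.
  rewrite sumr_const -mulr_natl => /eqP; rewrite mulf_eq0 (negPf (card_neq0 _ _)) /=.
  rewrite /X mxtrace_mulC mulmxA ee -scalemxAl linearZ mulf_eq0 (negPf lam1) /=.
  rewrite -(mul_delta_mx (0 : 'I_1)) mulmxA -colE mxtrace_mulC -rowE trace_mx11 !mxE.
  by move/eqP.
have [X X0] := nzX _ _ _ e0 e'0.
exists (average W W' (A W *m B W *m X *m (A W' *m B W'))); last first.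
  exact: average_intertwines.
apply: irr_intertwines_free irrW (average_intertwines _ _ _) _.
apply: contraNneq X0 => avg0; have := avgE _ W' X; rewrite avg0 mulmx0 mul0mx.
by move=> /esym/eqP; rewrite scaler_eq0 (negPf N0).
Qed.

(** The translates of [v] span, stated dually: no nonzero column is orthogonal to all of them. *)
Definition generates (K : {group gT}) n (W : reprC K n) (v : 'rV_n) :=
  forall N : 'cV_n, (forall g, g \in K -> v *m W g *m N = 0) -> N = 0.

Lemma generates_mx (K : {group gT}) n (W : reprC K n) v k (N : 'M_(n, k)) :
  generates W v -> (forall g, g \in K -> v *m W g *m N = 0) -> N = 0.
Proof.
move=> gen vN; apply/matrixP => i j; rewrite mxE.
have -> : N i j = (N *m delta_mx j (0 : 'I_1)) i 0 by rewrite -colE mxE.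
by rewrite (gen (N *m delta_mx j 0)) ?mxE // => g Kg; rewrite mulmxA vN ?mul0mx.
Qed.

(** The vector [w] plays the tabloid and its image under the signed column sum the polytabloid;
    [0 < n] excludes the zero module. *)
Definition young_generated (K : {group gT}) (P' Q' : {set gT}) (chi' psi' : gT -> C)
    n (W : reprC K n) :=
  exists w : 'rV_n, [/\ forall g, g \in P' -> w *m W g = chi' g *: w,
    (0 < n)%N & generates W (w *m wsum Q' psi' W)].

(** As in James's submodule theorem. Since v x e is a multiple of v for all x, the image of e is
    contained in the line of v. If p projects equivariantly onto a nonzero submodule U, then v p is
    nonzero and an eigenvector of e with eigenvalue lam(1), so it lies both in U and in that line;
    hence U contains v and is everything. *)
Lemma young_generated_irr n (W : reprC G n) : young_generated P Q chi psi W ->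
  mx_irreducible W /\ A W *m B W != 0.
Proof.
have [lam [lam1 lamE]] := young_scalar.
case=> w [wP n_gt0 gen]; set v := w *m B W in gen.
have v0 : v != 0.
  apply/eqP => v0; have N0 : const_mx 1 = 0 :> 'cV[C]_n.
    by apply: gen => g _; rewrite v0 !mul0mx.
  have /eqP := congr1 (fun N : 'cV_n => N (Ordinal n_gt0) 0) N0.
  by rewrite !mxE oner_eq0.
have wE : w *m A W = #|P|%:R *: w by exact: (equivariant_wsum (young_lin1 yG)).
have vE : #|P|%:R *: v = w *m (A W *m B W) by rewrite mulmxA wE -scalemxAl.
have e0 : A W *m B W != 0.
  apply: contraNneq v0 => e0; move: vE; rewrite e0 mulmx0 => /eqP.
  by rewrite scaler_eq0 (negPf (card_neq0 _ _)) => /eqP->.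
split=> //; have ve x : x \in G -> v *m W x *m (A W *m B W) = lam x *: v.
  move=> Gx; apply: (scalerI (card_neq0 C P)).
  by rewrite 2!scalemxAl vE -mulmxA -mulmxA (mulmxA _ (W x)) lamE // -scalemxAr -vE !scalerA mulrC.
have ev : (A W *m B W <= v)%MS.
  rewrite submxE; apply/eqP/(generates_mx gen) => g Gg.
  by rewrite mulmxA ve // -scalemxAl mulmx_coker scaler0.
apply/mx_irrP; split=> // U modU nzU.
pose rU := submod_repr modU.
have hf : intertwines rU W (row_base U).
  by move=> g Gg; have := val_submodJ modU 1%:M Gg; rewrite /val_submod /= !mul1mx.
have [f' ff' hf'] := embeds_retract (row_base_free U) hf.
have [p [hp pU rbp]] : exists p, [/\ intertwines W W p, (p <= U)%MS &
    row_base U *m p = row_base U].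
  exists (f' *m row_base U); split; first exact: intertwines_mul hf' hf.
    by rewrite mulmx_sub // eq_row_base.
  by rewrite mulmxA ff' mul1mx.
have nz_vp : v *m p != 0.
  apply: contraNneq nzU => vp; have p0 : p = 0.
    by apply: (generates_mx gen) => g Gg; rewrite -mulmxA hp // mulmxA vp mul0mx.
  move: rbp; rewrite p0 mulmx0 => rb0; by rewrite -submx0 -(eq_row_base U) -rb0 sub0mx.
have vpe : v *m p *m (A W *m B W) = lam 1%g *: (v *m p).
  rewrite -mulmxA [p *m _]mulmxA -(intertwines_wsum _ sPG hp) -(mulmxA _ p).
  rewrite -(intertwines_wsum _ sQG hp) !mulmxA scalemxAl -ve // repr_mx1 mulmx1.
  by rewrite mulmxA.
have vU : (v <= U)%MS.
  have : (v *m p *m (A W *m B W) <= v)%MS by rewrite mulmx_sub.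
  case/sub_rVP=> a ae; have : a != 0.
    apply: contraNneq nz_vp => a0; move: ae; rewrite vpe a0 scale0r => /eqP.
    by rewrite scaler_eq0 (negPf lam1).
  move=> a0; rewrite -(eqmx_scale _ a0) -ae vpe scalemx_sub // mulmx_sub //.
rewrite -sub1mx submxE mul1mx; apply/eqP/(generates_mx gen) => g Gg.
apply/eqP; rewrite -submxE; apply: submx_trans (submxMr _ vU) _.
exact: (mxmoduleP modU).
Qed.

End Young.

(** Spanning in terms of functionals, the form that lets tensor factors be treated one at a time. *)
Lemma generates_lin (K : {group gT}) n (W : reprC K n) v (phi : 'rV[C]_n -> C) :
    generates W v -> (forall a u u', phi (a *: u + u') = a * phi u + phi u') ->
  (forall g, g \in K -> phi (v *m W g) = 0) -> forall u, phi u = 0.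
Proof.
move=> gen lin phi0; pose N : 'cV[C]_n := \col_i phi (delta_mx 0 i).
have phi00 : phi 0 = 0.
  have := lin (-1) 0 0; rewrite scaler0 addr0 mulN1r addNr. by [].
have phiN u : phi u = (u *m N) 0 0.
  rewrite {1}[u]row_sum_delta mxE.
  elim/big_rec2: _ => // i a b _ <-; rewrite lin !mxE. done.
have N0 : N = 0.
  by apply: gen => g Kg; apply/matrixP => i j; rewrite !ord1 -phiN phi0 // mxE.
by move=> u; rewrite phiN N0 mulmx0 mxE.
Qed.

Lemma irr_generates (K : {group gT}) n (W : reprC K n) v :
  mx_irreducible W -> v != 0 -> generates W v.
Proof.
case/mx_irrP=> _ irrW v0 N vN.
have := irrW _ (cyclic_mx_module W v); rewrite cyclic_mx_eq0 -sub1mx => /(_ v0) full.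
rewrite -[N]mul1mx; apply/sub_kermxP/(submx_trans full).
apply/row_subP => i.
have /cyclic_mxP[A /envelop_mxP[a ->] ->] := row_sub i (cyclic_mx W v).
apply/sub_kermxP; rewrite mulmx_sumr mulmx_suml big1 // => g Kg.
by rewrite -scalemxAr -scalemxAl vN // scaler0.
Qed.

(** A nonzero row of [X] generates the module, so [Y] cannot kill all its translates. *)
Lemma irr_connect (K : {group gT}) n (W : reprC K n) (X Y : 'M_n) :
  mx_irreducible W -> X != 0 -> Y != 0 -> exists2 x, x \in K & X *m W x *m Y != 0.
Proof.
move=> irrW X0 Y0; apply: contrapT => no.
have [i Xi] : exists i, row i X != 0.
  apply: contrapT => no'; case/eqP: X0; apply/row_matrixP => i; rewrite row0.
  by apply: contrapT => Xi; apply: no'; exists i; apply/eqP.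
case/eqP: Y0; apply: (generates_mx (irr_generates irrW Xi)) => g Kg.
rewrite -row_mul -row_mul; have [->|nz] := eqVneq (X *m W g *m Y) 0; first exact: row0.
by case: no; exists g.
Qed.

End WeightedSums.

(** * Young generation under pullback, twist and induction *)

Section Transport.

Variable C : numClosedFieldType.

Lemma eq_young_generated (gT : finGroupType) (G : {group gT}) (P P' Q Q' : {set gT})
    (chi chi' psi psi' : gT -> C) n (W : mx_representation C G n) :
    P = P' -> Q = Q' -> {in P, chi =1 chi'} -> {in Q, psi =1 psi'} ->
    {in Q', forall g, g^-1%g \in Q'} ->
  young_generated P Q chi psi W -> young_generated P' Q' chi' psi' W.
Proof.
move=> <- <- echi epsi QV [w [wP n0 gen]]; exists w; split=> // [g Pg|].
  by rewrite wP // echi.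
suff <- : wsum Q psi W = wsum Q psi' W by [].
by rewrite !wsum.unlock; apply: eq_bigr => g Qg; rewrite epsi ?QV.
Qed.

Lemma generatesZ (gT : finGroupType) (G : {group gT}) n
    (W : mx_representation C G n) a v :
  a != 0 -> generates W v -> generates W (a *: v).
Proof.
move=> a0 gen N vN; apply: gen => g Gg; have := vN g Gg.
by rewrite -!scalemxAl => /eqP; rewrite scaler_eq0 (negPf a0) => /eqP.
Qed.

Lemma generatesZ' (gT : finGroupType) (G : {group gT}) n
    (W : mx_representation C G n) a v :
  generates W (a *: v) -> generates W v.
Proof.
by move=> gen N vN; apply: gen => g Gg; rewrite -!scalemxAl vN ?scaler0.
Qed.

(** Each fibre of [f] over Q is a coset of the kernel, so the column sum is only multiplied by the
    order of the kernel. *)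
Lemma young_generated_pull (aT rT : finGroupType) (D : {group aT}) (G : {group rT})
    (f : {morphism D >-> rT}) (W : representation C G) (sDG : (f @* D)%g \subset G)
    (P Q : {set rT}) chi psi :
    (f @* D)%g = G -> P \subset G -> Q \subset G ->
    young_generated P Q chi psi W ->
  young_generated (f @*^-1 P)%g (f @*^-1 Q)%g (chi \o f) (psi \o f) (pull_repr W sDG).
Proof.
move=> fDG sPG sQG [w [wP n0 gen]]; exists w.
have fQ : wsum (f @*^-1 Q)%g (psi \o f) (pull_repr W sDG) =
    #|('ker f)%g|%:R *: wsum Q psi W.
  rewrite !wsum.unlock (partition_big f (mem Q)) /= => [|x]; last by rewrite !inE => /andP[].
  rewrite scaler_sumr; apply: eq_bigr => g Qg.
  rewrite (eq_bigr (fun=> psi g^-1%g *: W g)) => [|x].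
    rewrite sumr_const scaler_nat; congr (_ *+ _).
    have /morphimP[y Dy _ gE] : g \in (f @* D)%g by rewrite fDG (subsetP sQG).
    rewrite -(card_rcoset _ y); apply: eq_card => x; rewrite -topredE /= !inE.
    apply/andP/idP => [[/andP[Dx _] /eqP e]|].
      by apply/rcoset_kerP => //; rewrite e.
    move=> xy; have Dx : x \in D.
      case/rcosetP: xy => k /setIP[Dk _] ->; exact: groupM.
    by move/(rcoset_kerP f Dx Dy): xy => e; rewrite Dx e -gE eqxx.
  by rewrite !inE => /andP[/andP[Dx _] /eqP <-]; rewrite morphV.
split=> // [x|].
  by rewrite !inE => /andP[Dx Px]; rewrite wP.
rewrite fQ -scalemxAr; apply: generatesZ; first by rewrite card_neq0.
move=> N vN; apply: gen => g Gg.
have /morphimP[x Dx _ ->] : g \in (f @* D)%g by rewrite fDG.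
exact: vN.
Qed.

(** In the weighted sum the new weight th(g^-1) cancels the twist th(g), so the same vector
    generates. *)
Lemma young_generated_twist (gT : finGroupType) (G : {group gT}) (th : gT -> C)
    (W : representation C G) (P Q : {set gT}) chi psi
    (th1 : th 1%g = 1) (thM : {in G &, {morph th : x y / (x * y)%g >-> x * y}}) :
    P \subset G -> Q \subset G ->
    young_generated P Q chi psi W ->
  young_generated P Q (fun g => th g * chi g) (fun g => th g * psi g)
    (twist_repr W th1 thM).
Proof.
move=> sPG sQG [w [wP n0 gen]]; exists w.
have lin : linear_on G th by [].
have -> : wsum Q (fun g => th g * psi g) (twist_repr W th1 thM) = wsum Q psi W.
  rewrite !wsum.unlock; apply: eq_bigr => g Qg /=.
  have Gg := subsetP sQG g Qg.
  by rewrite scalerA mulrAC [th _ * _]mulrC (linear_onV lin) // mul1r.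
split=> // [g Pg|N vN] /=; first by rewrite -scalemxAr wP // scalerA.
apply: gen => g Gg; have := vN g Gg; rewrite /= -scalemxAr -scalemxAl => /eqP.
by rewrite scaler_eq0 (negPf (linear_on_neq0 lin Gg)) => /eqP.
Qed.

Section InducedUnit.

Variables (gT : finGroupType) (G H : {group gT}) (sHG : H \subset G).
Variable W : representation C H.

(* The image in the induced module of the copy of W translated by g. *)
Definition ind_unit (g : gT) : 'M[C]_(rdegree W, rdegree (ind_repr sHG W)) :=
  \mxrow_j (let h := (g * (coset_rep j)^-1)%g in if h \in H then W h else 0).

Lemma coset_rep_of g : g \in G -> exists j : 'I_#|rcosets H G|,
  forall k, ((g * (coset_rep k)^-1)%g \in H) = (k == j).
Proof.
move=> Gg; have Hc : (H :* 1)%g \in rcosets H G by apply/rcosetsP; exists 1%g.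
pose i0 := enum_rank_in Hc (H :* 1)%g.
have Gi : ((coset_rep i0)^-1 * g)%g \in G by rewrite groupM ?groupV ?coset_repG.
have [j jE] := coset_rep_in sHG i0 Gi.
by exists j => k; rewrite -jE mulKVg.
Qed.

Lemma ind_unitM g x : g \in G -> x \in G ->
  ind_unit g *m ind_repr sHG W x = ind_unit (g * x)%g.
Proof.
move=> Gg Gx; have [j jE] := coset_rep_of Gg.
rewrite /ind_unit /= /ind_mx mul_mxrow_mxblock; apply: eq_mxrow => k.
rewrite (bigD1 j) //= jE eqxx big1 => [|l nl]; last by rewrite jE (negPf nl) mul0mx.
have Hj : (g * (coset_rep j)^-1)%g \in H by rewrite jE.
rewrite /= addr0 /ind_block -(groupMl _ Hj) !mulgA mulgKV.
case: ifP => Hk; last by rewrite mulmx0.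
rewrite -repr_mxM ?mulgA ?mulgKV //.
by rewrite -(groupMl _ Hj) !mulgA mulgKV.
Qed.

Lemma ind_unitH h g : h \in H -> W h *m ind_unit g = ind_unit (h * g)%g.
Proof.
move=> Hh; rewrite /ind_unit mul_mxrow; apply: eq_mxrow => k.
rewrite /= -mulgA (groupMl _ Hh); case: ifP => Hk; last exact: mulmx0.
by rewrite -repr_mxM.
Qed.

(** At a coset representative the matrix has the identity in one block and zeros elsewhere, which
    isolates one block of [N]. *)
Lemma ind_unit_total m (N : 'M_(rdegree (ind_repr sHG W), m)) :
  (forall g, g \in G -> ind_unit g *m N = 0) -> N = 0.
Proof.
move=> N0; rewrite -[N]submxcolK -[RHS](mxcol0 _); apply: eq_mxcol => j.
have Gj := coset_repG sHG j; have := N0 _ Gj.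
rewrite -{1}[N]submxcolK /ind_unit mul_mxrow_mxcol.
have [k kE] := coset_rep_of Gj.
have ejk : k = j by apply/eqP; rewrite eq_sym -kE mulgV group1.
rewrite (bigD1 j) //= mulgV group1 repr_mx1 mul1mx big1 ?addr0 // => l nl.
by rewrite kE ejk (negPf nl) mul0mx.
Qed.

Lemma rdegree_ind : rdegree (ind_repr sHG W) = (#|rcosets H G| * rdegree W)%N.
Proof. by rewrite /= sum_nat_const card_ord. Qed.

(** Frobenius reciprocity: [h] extends to the induced module by h followed by g_i on the coset of
    g_i. *)
Lemma ind_intertwines (V : representation C G) h :
    intertwines W (res_repr sHG V) h ->
  intertwines (ind_repr sHG W) V
    (\mxcol_(i < #|rcosets H G|) (h *m V (coset_rep i)) : 'M_(rdegree (ind_repr sHG W), _)).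
Proof.
move=> hh g Gg; rewrite /= /ind_mx mul_mxblock_mxrow mxcol_mul; apply: eq_mxcol => i.
have Gi := coset_repG sHG i; have [j jE] := coset_rep_in sHG i Gg.
have Gj := coset_repG sHG j.
rewrite (bigD1 j) //= big1 ?addr0 => [|l nl]; last first.
  by rewrite /ind_block jE (negPf nl) mul0mx.
have Hij : (coset_rep i * g * (coset_rep j)^-1)%g \in H by rewrite jE.
rewrite /ind_block Hij mulmxA hh //= -!mulmxA -!repr_mxM ?groupM ?groupV //.
by rewrite mulgKV.
Qed.

End InducedUnit.

(** The extension of [h] is onto because V is irreducible, and a surjection splits. *)
Lemma frobenius_embeds (gT : finGroupType) (G H : {group gT}) (sHG : H \subset G)
    (U : representation C H) (V : representation C G) h :
    mx_irreducible V -> intertwines U (res_repr sHG V) h -> h != 0 ->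
  embeds V (ind_repr sHG U).
Proof.
move=> irrV hh h0; have hF := ind_intertwines hh.
apply: (intertwines_full_embeds _ hF); apply: (irr_intertwines_full irrV hF).
apply: contraNneq h0 => F0; have Hc : (H :* 1)%g \in rcosets H G by apply/rcosetsP; exists 1%g.
pose i := enum_rank_in Hc (H :* 1)%g.
have := congr1 (fun M => submxcol M i) F0; rewrite mxcolK submxcol0 => e.
by rewrite -[h](repr_mxK V (coset_repG sHG i)) e mul0mx.
Qed.

(** The copy of U at the trivial coset has translates spanning the induced module, so a nonzero [F]
    does not vanish on it. *)
Lemma frobenius_unit (gT : finGroupType) (G H : {group gT}) (sHG : H \subset G)
    (U : representation C H) (V : representation C G) F :
    intertwines (ind_repr sHG U) V F -> F != 0 ->
  exists2 h, h != 0 & intertwines U (res_repr sHG V) h.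
Proof.
move=> hF F0; exists (ind_unit sHG U 1%g *m F).
  apply: contraNneq F0 => h0; apply/eqP/ind_unit_total => g Gg.
  by rewrite -[g]mul1g -ind_unitM // -mulmxA hF // mulmxA h0 mul0mx.
move=> g Hg; have Gg := subsetP sHG g Hg.
by rewrite mulmxA ind_unitH // mulg1 -[in LHS](mul1g g) -ind_unitM // -mulmxA hF // mulmxA.
Qed.

(** As P and Q lie in H, both weighted sums act inside the copy of W at the trivial coset, and the
    translates of that copy span. *)
Lemma young_generated_ind (gT : finGroupType) (G H : {group gT}) (sHG : H \subset G)
    (W : representation C H) (P Q : {set gT}) chi psi :
    P \subset H -> Q \subset H ->
    young_generated P Q chi psi W -> young_generated P Q chi psi (ind_repr sHG W).
Proof.
move=> sPH sQH [w [wP n0 gen]]; set io := ind_unit sHG W.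
exists (w *m io 1%g); split.
- move=> g Pg; have Hg := subsetP sPH g Pg; have Gg := subsetP sHG g Hg.
  by rewrite -mulmxA ind_unitM // mul1g -[g]mulg1 -ind_unitH // mulg1 mulmxA wP // scalemxAl.
- rewrite rdegree_ind muln_gt0 n0 andbT.
  by apply/card_gt0P; exists (H :* 1)%g; apply/rcosetsP; exists 1%g.
have ioQ : io 1%g *m wsum Q psi (ind_repr sHG W) = wsum Q psi W *m io 1%g.
  rewrite !wsum.unlock mulmx_sumr mulmx_suml; apply: eq_bigr => h Qh.
  have Hh := subsetP sQH h Qh; have Gh := subsetP sHG h Hh.
  by rewrite -scalemxAr -scalemxAl ind_unitM // ind_unitH // mul1g mulg1.
move=> N vN; apply: ind_unit_total => g Gg; apply: (generates_mx gen) => h Hh.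
have Gh := subsetP sHG h Hh.
have := vN (h * g)%g; rewrite groupM // => /(_ isT) <-.
rewrite -(mulmxA w (io 1%g)) ioQ -!mulmxA (mulmxA (io 1%g)) ind_unitM ?groupM // mul1g.
by rewrite -ind_unitH // !mulmxA.
Qed.

End Transport.

Section CyclicYoung.

Variables (C : numClosedFieldType) (gT : finGroupType) (G P Q : {group gT}).
Variables chi psi : gT -> C.
Hypothesis yG : young G P Q chi psi.

(** With e = AB and v = ue, the vector vA serves as the tabloid, since vAB = uee = lam(1) v. *)
Lemma young_generated_cyclic n (W : mx_representation C G n) (u : 'rV_n) :
    u *m (wsum P chi W *m wsum Q psi W) != 0 ->
  young_generated P Q chi psi
    (submod_repr (cyclic_mx_module W (u *m (wsum P chi W *m wsum Q psi W)))).
Proof.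
have [lam [lam1 lamE]] := young_scalar yG.
have [[[sPG sQG] l1] l2] := (young_sub1 yG, young_sub2 yG, young_lin1 yG, young_lin2 yG).
set e := wsum P chi W *m wsum Q psi W => v0; set v := u *m e in v0 *.
set U := cyclic_mx W v; pose modU : mxmodule W U := cyclic_mx_module W v.
have vU : (v <= U)%MS := cyclic_mx_id W v.
have vAU : (v *m wsum P chi W <= U)%MS.
  rewrite wsum.unlock mulmx_sumr summx_sub // => g Pg.
  rewrite -scalemxAr scalemx_sub //; apply: submx_trans (submxMr _ vU) _.
  exact: (mxmoduleP modU) (subsetP sPG g Pg).
have hv : intertwines (submod_repr modU) W (row_base U).
  by move=> g Gg; have := val_submodJ modU 1%:M Gg; rewrite /val_submod /= !mul1mx.
exists (in_submod U (v *m wsum P chi W)); split.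
- move=> g Pg; have Gg := subsetP sPG g Pg.
  rewrite -in_submodJ // -mulmxA (wsum_mulr sPG l1) // -scalemxAr.
  exact: linearZ.
- by rewrite /= lt0n mxrank_eq0 cyclic_mx_eq0.
have -> : in_submod U (v *m wsum P chi W) *m wsum Q psi (submod_repr modU) =
    lam 1%g *: in_submod U v.
  apply: (row_free_inj (row_base_free U)); rewrite -mulmxA (intertwines_wsum _ sQG hv).
  rewrite mulmxA -[in_submod _ _ *m _]/(val_submod (in_submod U _)) in_submodK //.
  rewrite -scalemxAl -[in_submod _ _ *m _]/(val_submod (in_submod U _)) in_submodK //.
  rewrite -mulmxA -/e /v -mulmxA; have := lamE _ W 1%g (group1 G).
  by rewrite repr_mx1 mulmx1 -/e => ->; rewrite -scalemxAr.
apply: generatesZ => // N vN.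
pose N' := in_submod U 1%:M *m N.
have : (U <= kermx N')%MS.
  apply/row_subP => i.
  have /cyclic_mxP[A /envelop_mxP[a ->] ->] := row_sub i U.
  apply/sub_kermxP; rewrite mulmx_sumr mulmx_suml big1 // => g Gg.
  rewrite -scalemxAr -scalemxAl mulmxA -in_submodE in_submodJ //.
  by rewrite vN // scaler0.
rewrite -eq_row_base => /sub_kermxP; rewrite mulmxA -in_submodE.
have -> : in_submod U (row_base U) = 1%:M.
  by rewrite -[row_base U]mul1mx -[_ *m _]/(val_submod 1%:M) val_submodK.
by rewrite mul1mx.
Qed.

End CyclicYoung.

(** * Tensor products of row vectors and external products of Young-generated modules *)

Section RowTensor.

Variable F : fieldType.

Lemma tprod_linl m1 n1 m2 n2 (B : 'M[F]_(m2, n2)) :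
  linear (fun A : 'M_(m1, n1) => tprod A B).
Proof.
elim: m1 => [|m1 IHm] a A A' /=; first by rewrite scaler0 addr0.
rewrite !linearP /= -!trowbE linearP /= IHm.
by rewrite scale_col_mx add_col_mx.
Qed.

Lemma tprod_linr m1 n1 m2 n2 (A : 'M[F]_(m1, n1)) :
  linear (fun B : 'M_(m2, n2) => tprod A B).
Proof.
elim: m1 A => [|m1 IHm] A a B B' /=; first by rewrite scaler0 addr0.
by rewrite linearP /= IHm scale_col_mx add_col_mx.
Qed.

(** [tprod] on single rows, under a name that carries the linearity structures declared next. *)
Definition tens n1 n2 (u1 : 'rV[F]_n1) (u2 : 'rV[F]_n2) : 'rV[F]_(n1 * n2) := tprod u1 u2.

HB.instance Definition _ n1 n2 (u1 : 'rV_n1) :=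
  GRing.isSemilinear.Build _ _ _ _ (@tens n1 n2 u1)
    (GRing.semilinear_linear (@tprod_linr 1 n1 1 n2 u1)).

Definition tensl n1 n2 (u2 : 'rV_n2) (u1 : 'rV_n1) := tens u1 u2.
HB.instance Definition _ n1 n2 (u2 : 'rV_n2) :=
  GRing.isSemilinear.Build _ _ _ _ (@tensl n1 n2 u2)
    (GRing.semilinear_linear (@tprod_linl 1 n1 1 n2 u2)).

Lemma tensZl n1 n2 a (u1 : 'rV_n1) (u2 : 'rV_n2) : tens (a *: u1) u2 = a *: tens u1 u2.
Proof. by rewrite -[LHS]/(tensl u2 _) linearZ. Qed.

Lemma tensZr n1 n2 a (u1 : 'rV_n1) (u2 : 'rV_n2) : tens u1 (a *: u2) = a *: tens u1 u2.
Proof. exact: linearZ. Qed.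

Lemma tens_sumr n1 n2 (I : finType) (S : {pred I}) (u1 : 'rV_n1) (f : I -> 'rV_n2) :
  tens u1 (\sum_(i in S) f i) = \sum_(i in S) tens u1 (f i).
Proof. exact: linear_sum. Qed.

Lemma tens_suml n1 n2 (I : finType) (S : {pred I}) (f : I -> 'rV_n1) (u2 : 'rV_n2) :
  tens (\sum_(i in S) f i) u2 = \sum_(i in S) tens (f i) u2.
Proof. exact: (linear_sum (tensl u2)). Qed.

Lemma tens_mul n1 n2 u1 u2 (A : 'M_n1) (B : 'M_n2) :
  tens u1 u2 *m tprod A B = tens (u1 *m A) (u2 *m B).
Proof. by rewrite /tens tprodE. Qed.

Lemma trowE n1 n2 (u1 : 'rV_n1) (u2 : 'rV_n2) : trow u1 u2 = tens u1 u2.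
Proof.
rewrite /tens /=; apply/matrixP => i j; rewrite mxE; case: splitP => [k _|[]//].
rewrite !ord1; congr (trow _ _ _ _); apply/matrixP => a b; rewrite !ord1 mxE.
by congr (u1 _ _); apply: val_inj.
Qed.

Lemma row_trow n1 m2 n2 (u : 'rV[F]_n1) (B : 'M[F]_(m2, n2)) i :
  row i (trow u B) = trow u (row i B).
Proof.
elim: n1 u => [|n1 IHn] u /=; first by rewrite raddf0.
by rewrite row_row_mx IHn linearZ.
Qed.

Lemma tens_total n1 n2 m (N : 'M_(n1 * n2, m)) :
  (forall u1 u2, tens u1 u2 *m N = 0) -> N = 0.
Proof.
move=> N0; rewrite -[N]mul1mx -tprod1.
suff all0 k (A : 'M_(k, n1)) : tprod A (1%:M : 'M[F]_n2) *m N = 0 by exact: all0.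
elim: k A => [|k IHk] A /=; first by rewrite mul0mx.
rewrite mul_col_mx IHk; set u := usubmx _.
suff -> : trow u 1%:M *m N = 0 by rewrite col_mx0.
by apply/row_matrixP => i; rewrite row0 row_mul row_trow trowE N0.
Qed.

End RowTensor.

Section External.

Variables (C : numClosedFieldType) (q : nat) (gT : 'I_q -> finGroupType).
Variables (P Q : forall k, {group gT k}) (chi psi : forall k, gT k -> C).
Variable W : forall k, representation C [set: gT k].
Hypothesis genW : forall k, young_generated (P k) (Q k) (@chi k) (@psi k) (W k).

Notation blocks := {dffun forall k, gT k}.
Notation ext s := (\big[@tensor_repr C _ _/one_repr C [set: blocks]]_(k <- s)
  @pull_repr C _ _ _ _ (@dffun_morphism _ gT k) (W k) (subsetT _)).

(** Induction on the list of factors. The first conjunct, that the module sees only the coordinates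
    in [s], lets a new coordinate vary without disturbing the factors already present. *)
Lemma young_generated_ext (s : seq 'I_q) (T := ext s) : uniq s ->
  (forall g h : blocks, (forall k, k \in s -> g k = h k) -> T g = T h) /\
  young_generated (setXn P) (setXn Q) (fun g => \prod_(k <- s) @chi k (g k))
    (fun g => \prod_(k <- s) @psi k (g k)) T.
Proof.
rewrite {}/T; elim: s => [_|k s IHs /= /andP[ks us]].
  rewrite big_nil; split=> //; exists 1%:M; split=> // [g _|].
    by rewrite big_nil scale1r mulmx1.
  move=> N /(_ 1%g); rewrite inE => /(_ isT); rewrite mulmx1 mul1mx.
  rewrite wsum.unlock (eq_bigr (fun=> 1%:M)) => [|g _]; last by rewrite big_nil scale1r.
  rewrite sumr_const -scaler_nat -scalemxAl mul1mx => /eqP; rewrite scaler_eq0.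
  by rewrite (negPf (card_neq0 C (setXn_group Q))) => /eqP.
have [Teq [w [wP n0 gen]]] := IHs us.
rewrite big_cons; set T := ext s in Teq w wP n0 gen *.
have [wk [wkP nk0 genk]] := genW k.
set Tk := pull_repr _ _; have Tk1 g : Tk g = W k (g k) by [].
have TE g : tensor_repr Tk T g = tprod (W k (g k)) (T g) by [].
split=> [g h gh|].
  by rewrite !TE gh ?mem_head // (Teq g h) // => j js; apply: gh; rewrite inE js orbT.
exists (tens wk w); split.
- move=> g Pg; rewrite TE tens_mul wP // wkP; last by move/setXnP: Pg.
  by rewrite tensZl tensZr scalerA big_cons.
- by rewrite /= muln_gt0 nk0.
have QE : #|Q k|%:R *: (tens wk w *m wsum (setXn Q)
     (fun g => \prod_(j <- k :: s) @psi j (g j)) (tensor_repr Tk T)) =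
   tens (wk *m wsum (Q k) (@psi k) (W k))
        (w *m wsum (setXn Q) (fun g => \prod_(j <- s) @psi j (g j)) T).
  pose term (g : blocks) := tens (@psi k (g k)^-1%g *: (wk *m W k (g k)))
    ((\prod_(j <- s) @psi j (g j)^-1%g) *: (w *m T g)).
  transitivity (\sum_(x in Q k) \sum_(g in setXn Q) term (dfung1 x * g)%g).
    rewrite -sumr_const scaler_suml; apply: eq_bigr => x Qx; rewrite scale1r.
    have Qx1 : dfung1 x \in setXn Q.
      apply/setXnP => j; rewrite ffunE; case: dfwithP => [|l _] //.
    transitivity (\sum_(g in setXn Q) term g).
      rewrite wsum.unlock mulmx_sumr; apply: eq_bigr => g _.
      rewrite /term tensZl tensZr scalerA -scalemxAr TE tens_mul big_cons.
      by congr (_ *: _); congr (_ * _); [|apply: eq_bigr => j _]; rewrite ffunE.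
    rewrite (reindex_inj (mulgI (dfung1 x))) /=; apply: eq_bigl => g.
    exact: (@groupMl _ (setXn_group Q)).
  rewrite exchange_big /= !wsum.unlock !mulmx_sumr tens_sumr.
  apply: eq_bigr => g Qg; have /setXnP/(_ k) Qgk := Qg.
  rewrite tens_suml [RHS](reindex_inj (mulIg (g k))) /=.
  apply: eq_big => [x|x Qx]; first by rewrite groupMr.
  rewrite /term; have -> : T (dfung1 x * g)%g = T g.
    apply: Teq => j js; rewrite ffunE dfung1_dflt ?mul1g //.
    by apply: contraNneq ks => ->.
  have -> : (dfung1 x * g)%g k = (x * g k)%g by rewrite ffunE dfung1_id.
  rewrite -!scalemxAr; congr (tens _ (_ *: _)).
  rewrite big_seq [RHS]big_seq; apply: eq_bigr => j js.
  have -> : (dfung1 x * g)%g j = g j.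
    rewrite ffunE dfung1_dflt ?mul1g //.
    by apply: contraNneq ks => ->.
  by rewrite [in RHS]ffunE.
apply: (@generatesZ' _ _ _ _ _ #|Q k|%:R); rewrite QE => N vN.
apply: tens_total => u1 u2.
have phi0 : forall g u1', (tens u1' (w *m wsum (setXn Q) (fun g => \prod_(j <- s) @psi j (g j)) T *m T g) *m N) 0 0 = 0.
  move=> g; apply: (generates_lin genk (phi := fun u1' => (tens u1' _ *m N) 0 0)) => [a v v'|y _].
    by rewrite -[tens (_ + _) _]/(tensl _ _) linearP mulmxDl -scalemxAl !mxE.
  (* [g'] equals y in coordinate k and agrees with g elsewhere, so the two tensor factors move
     independently. *)
  pose g' : blocks := (dfung1 (y * (g k)^-1) * g)%g.
  have Tg' : T g' = T g.
    apply: Teq => j js; rewrite /g' ffunE dfung1_dflt ?mul1g //.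
    by apply: contraNneq ks => ->.
  have g'k : g' k = y by rewrite /g' ffunE dfung1_id mulgKV.
  have := vN g' (in_setT _); rewrite TE tens_mul Tg' g'k => ->.
  by rewrite mxE.
apply/matrixP => i j; rewrite !ord1 [RHS]mxE.
apply: (generates_lin gen (phi := fun u2' => (tens u1 u2' *m N) 0 0)) => [a v v'|g _].
  by rewrite linearP mulmxDl -scalemxAl !mxE.
exact: phi0.
Qed.

End External.

(* A filling, by the points of 'I_N, of a family of left-justified diagrams   *)
(* indexed by labels.                                                         *)
Record tableau N := Tableau {
  tab_lab : 'I_N -> nat;
  tab_row : 'I_N -> nat;
  tab_col : 'I_N -> nat;
  tab_inj : forall x y, tab_lab x = tab_lab y -> tab_row x = tab_row y -> tab_col x = tab_col y -> x = y;
  tab_left : forall x j, (j < tab_col x)%N ->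
    exists y, [/\ tab_lab y = tab_lab x, tab_row y = tab_row x & tab_col y = j] }.

(** * Row and column groups of a tableau as a Young pair *)

Section Counting.

Local Open Scope nat_scope.

Variables (N : nat) (t : tableau N).

Definition row_inj (c : 'I_N -> nat) :=
  forall x y, tab_lab t x = tab_lab t y -> tab_row t x = tab_row t y -> c x = c y -> x = y.

(** The columns of a row fill an initial segment, so [tab_col] takes as many values below j as any
    injective function can: the smaller of j and the row length. *)
Lemma count_row c k i j :
  (forall x y, tab_lab t x = k -> tab_lab t y = k -> tab_row t x = tab_row t y ->
    c x = c y -> x = y) ->
  #|[set x | [&& tab_lab t x == k, tab_row t x == i & c x < j]]| <=
  #|[set x | [&& tab_lab t x == k, tab_row t x == i & tab_col t x < j]]|.
Proof.
move=> injc.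
have [all_lt|] := boolP [forall x, [&& tab_lab t x == k & tab_row t x == i] ==> (tab_col t x < j)].
  apply: subset_leq_card; apply/subsetP => x; rewrite !inE => /and3P[kx ix _].
  by rewrite kx ix; have /forallP/(_ x) := all_lt; rewrite kx ix.
case/forallPn => x; rewrite negb_imply -leqNgt => /andP[/andP[/eqP kx /eqP ix] jx].
apply: (@leq_trans j).
  rewrite cardE -(size_map c) -[X in _ <= X](size_iota 0); apply: uniq_leq_size.
    rewrite map_inj_in_uniq ?enum_uniq // => y y'; rewrite !mem_enum !inE.
    move=> /and3P[/eqP ky /eqP iy _] /and3P[/eqP ky' /eqP iy' _].
    by apply: injc; congruence.
  by move=> _ /mapP[y + ->]; rewrite mem_enum inE mem_iota => /and3P[].
rewrite cardE -(size_map (tab_col t)) -[X in X <= _](size_iota 0); apply: uniq_leq_size.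
  exact: iota_uniq.
move=> j'; rewrite mem_iota /= => lt_j.
have [y [ky iy jy]] := tab_left (leq_trans lt_j jx).
by apply/mapP; exists y => //; rewrite mem_enum inE ky iy jy kx ix !eqxx.
Qed.

Definition row_bound := (\max_(x : 'I_N) tab_row t x).+1.

Lemma card_rows k j c :
  #|[set x | (tab_lab t x == k) && (c x < j)]| =
  \sum_(i < row_bound) #|[set x | [&& tab_lab t x == k, tab_row t x == i & c x < j]]|.
Proof.
rewrite -sum1_card.
have lt_row x : tab_row t x < row_bound by rewrite ltnS leq_bigmax.
rewrite (partition_big (fun x => Ordinal (lt_row x)) xpredT) //=.
apply: eq_bigr => i _; rewrite -sum1_card; apply: eq_bigl => x.
by rewrite !inE -val_eqE /= andbAC -andbA.
Qed.

Lemma count_label c k j :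
  (forall x y, tab_lab t x = k -> tab_lab t y = k -> tab_row t x = tab_row t y ->
    c x = c y -> x = y) ->
  #|[set x | (tab_lab t x == k) && (c x < j)]| <=
  #|[set x | (tab_lab t x == k) && (tab_col t x < j)]|.
Proof.
move=> injc; rewrite !card_rows //; apply: leq_sum => i _; exact: count_row.
Qed.

(** Over all rows of one label, as many points have [tab_col] of their image below j as have their
    own [tab_col] below j, since s permutes the label. [count_row] bounds the first number by the
    second row by row, so they agree in every row. With j the length of the row of x, all its points
    land in columns that occur in this row. *)
Lemma row_inj_perm (s : 'S_N) : (forall x, tab_lab t (s x) = tab_lab t x) ->
  row_inj (fun x => tab_col t (s x)) ->
  forall x, exists y, [/\ tab_lab t y = tab_lab t x, tab_row t y = tab_row t x & tab_col t y = tab_col t (s x)].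
Proof.
move=> labs injs x; set k := tab_lab t x; set i := tab_row t x.
pose R := [set y | (tab_lab t y == k) && (tab_row t y == i)].
have Rx : x \in R by rewrite inE !eqxx.
case: (@arg_maxnP _ x (fun y => y \in R) (tab_col t) Rx) => y Ry maxy; set j := (tab_col t y).+1.
have /andP[/eqP ky /eqP iy] : (tab_lab t y == k) && (tab_row t y == i) by rewrite inE in Ry.
have e : #|[set x | (tab_lab t x == k) && (tab_col t (s x) < j)]| =
         #|[set x | (tab_lab t x == k) && (tab_col t x < j)]|.
  rewrite -[RHS](card_preimset _ (@perm_inj _ s)); apply: eq_card => u.
  by rewrite !inE labs.
have := e; rewrite !card_rows //.
have le_i i' : _ := @count_row _ k i' j (fun x y lx ly => injs x y (etrans lx (esym ly))).
have lt_i : i < row_bound by rewrite ltnS leq_bigmax.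
have lsum := leqif_sum (fun (i' : 'I_row_bound) (_ : true) => leqif_eq (le_i i')).
move=> e'; have := lsum.2; rewrite e' eqxx => /esym/forall_inP/(_ (Ordinal lt_i) isT).
move=> /eqP /= e2.
have sub : [set x | [&& tab_lab t x == k, tab_row t x == i & tab_col t (s x) < j]] = R.
  apply/eqP; rewrite eqEcard; apply/andP; split.
    by apply/subsetP => u; rewrite !inE => /and3P[-> ->].
  rewrite e2; apply: subset_leq_card; apply/subsetP => u Ru; have := Ru.
  by rewrite !inE => /andP[-> ->]; rewrite ltnS; apply: maxy.
have := Rx; rewrite -sub inE => /and3P[_ _]; rewrite ltnS leq_eqVlt => /orP[/eqP e3|lt3].
  by exists y; rewrite e3.
by have [u [ku iu ju]] := tab_left lt3; exists u; rewrite ku iu ju.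
Qed.

End Counting.

Section TableauGroups.

Variables (C : numClosedFieldType) (r : nat) (z : C) (z_prim : r.-primitive_root z).
Variables (N : nat) (t : tableau N) (ch : 'I_N -> nat).

Definition row_pres (s : 'S_N) :=
  [forall x, (tab_lab t (s x) == tab_lab t x) && (tab_row t (s x) == tab_row t x)].
Definition col_pres (s : 'S_N) :=
  [forall x, (tab_lab t (s x) == tab_lab t x) && (tab_col t (s x) == tab_col t x)].

Lemma row_presP (s : 'S_N) :
  reflect (forall x, tab_lab t (s x) = tab_lab t x /\ tab_row t (s x) = tab_row t x) (row_pres s).
Proof.
apply: (iffP forallP) => h x; first by have /andP[/eqP -> /eqP ->] := h x.
by have [-> ->] := h x; rewrite !eqxx.
Qed.

Lemma col_presP (s : 'S_N) :
  reflect (forall x, tab_lab t (s x) = tab_lab t x /\ tab_col t (s x) = tab_col t x) (col_pres s).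
Proof.
apply: (iffP forallP) => h x; first by have /andP[/eqP -> /eqP ->] := h x.
by have [-> ->] := h x; rewrite !eqxx.
Qed.

Section Subgroup.

Variable K : {group gpm r N}.

(** Only the underlying permutation is constrained, so the row and column sets both contain every
    diagonal matrix of [K]. *)
Definition row_set := [set g in K | row_pres (gpm_perm g)].
Definition col_set := [set g in K | col_pres (gpm_perm g)].

Lemma row_group_set : group_set row_set.
Proof.
apply/group_setP; split=> [|g h]; rewrite !inE.
  by rewrite group1; apply/row_presP => x; rewrite /= perm1.
case/andP=> Kg /row_presP rg /andP[Kh /row_presP rh]; rewrite groupM //=.
apply/row_presP => x; rewrite permM; have [-> ->] := rh (gpm_perm g x).
exact: rg.
Qed.
Definition row_group := Group row_group_set.

Lemma col_group_set : group_set col_set.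
Proof.
apply/group_setP; split=> [|g h]; rewrite !inE.
  by rewrite group1; apply/col_presP => x; rewrite /= perm1.
case/andP=> Kg /col_presP rg /andP[Kh /col_presP rh]; rewrite groupM //=.
apply/col_presP => x; rewrite permM; have [-> ->] := rh (gpm_perm g x).
exact: rg.
Qed.
Definition col_group := Group col_group_set.

End Subgroup.

(** The charge [ch x] names the character, sigma_(ch x + 1), through which the entry at the point x
    contributes. *)
Definition row_char (g : gpm r N) : C := \prod_x z ^+ (gpm_exp g x * ch x).
Definition col_char (g : gpm r N) : C := (-1) ^+ gpm_perm g * row_char g.

Definition perm_gpm (s : 'S_N) : gpm r N := Gpm s [ffun=> 0].

Lemma perm_gpmM : {morph perm_gpm : s u / (s * u)%g}.
Proof. by move=> s u; apply: gpm_eq => //= i; rewrite !ffunE addr0. Qed.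

Lemma perm_gpmV s : (perm_gpm s^-1 = (perm_gpm s)^-1)%g.
Proof. by apply: gpm_eq => //= i; rewrite !ffunE oppr0. Qed.

Lemma row_char_perm s : row_char (perm_gpm s) = 1.
Proof. by rewrite /row_char big1 // => i _; rewrite ffunE mul0n. Qed.

Definition charge_pres (s : 'S_N) := forall x, ch (s x) = ch x.

Lemma row_charM g h : charge_pres (gpm_perm g) ->
  row_char (g * h)%g = row_char g * row_char h.
Proof.
move=> pg; rewrite /row_char [X in _ = _ * X](reindex_inj (@perm_inj _ (gpm_perm g))) /=.
rewrite -big_split /=; apply: eq_bigr => x _.
by rewrite gpm_expM pg !exprM (z_expD z_prim) exprMn.
Qed.

Lemma row_char1 : row_char 1%g = 1.
Proof. exact: (row_char_perm 1). Qed.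

(** What makes the two groups in [K] a Young pair. The last field says that an element moving a
    point to another label is detected by a diagonal matrix of [K] whose character changes under
    conjugation. *)
Record adapted (K : {group gpm r N}) : Prop := Adapted {
  adapted_perm : forall s, row_pres s || col_pres s -> perm_gpm s \in K;
  adapted_proj : forall x, x \in K -> perm_gpm (gpm_perm x) \in K;
  adapted_charge : forall x y, tab_lab t x = tab_lab t y -> ch x = ch y;
  adapted_sep : forall x y, x \in K -> tab_lab t (gpm_perm x y) <> tab_lab t y ->
    exists u, [/\ u \in K, gpm_perm u = 1%g &
      row_char u <> \prod_i z ^+ (gpm_exp u i * ch (gpm_perm x i))] }.

Variable K : {group gpm r N}.
Hypothesis adK : adapted K.

Lemma row_charge g : g \in row_group K -> charge_pres (gpm_perm g).
Proof.
by rewrite inE => /andP[_ /row_presP h] x; apply: (adapted_charge adK); have [] := h x.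
Qed.

Lemma col_charge g : g \in col_group K -> charge_pres (gpm_perm g).
Proof.
by rewrite inE => /andP[_ /col_presP h] x; apply: (adapted_charge adK); have [] := h x.
Qed.

Lemma row_char_linear : linear_on (row_group K) row_char.
Proof.
split; first exact: row_char1.
by move=> g h Pg _; rewrite row_charM //; apply: row_charge.
Qed.

Lemma col_char_linear : linear_on (col_group K) col_char.
Proof.
split; first by rewrite /col_char row_char1 /= odd_perm1 mulr1.
move=> g h Pg _; rewrite /col_char row_charM ?gpm_permM ?odd_permM ?signr_addb; last exact: col_charge.
by rewrite mulrACA.
Qed.

Lemma diag_row_group u : u \in K -> gpm_perm u = 1%g -> u \in row_group K.
Proof. by move=> Ku u1; rewrite inE Ku; apply/row_presP => x; rewrite u1 perm1. Qed.

Lemma diag_col_group u : u \in K -> gpm_perm u = 1%g -> u \in col_group K.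
Proof. by move=> Ku u1; rewrite inE Ku; apply/col_presP => x; rewrite u1 perm1. Qed.

Lemma diag_conj (x u : gpm r N) : gpm_perm u = 1%g ->
  gpm_perm (x^-1 * u * x)%g = 1%g /\
  forall i, gpm_exp (x^-1 * u * x)%g (gpm_perm x i) = gpm_exp u i.
Proof.
move=> u1; split=> [|i]; first by rewrite !gpm_permM u1 mulg1 /= mulVg.
rewrite !gpm_expM gpm_permM u1 mulg1 /= ffunE permK.
by rewrite addrAC addNr add0r.
Qed.

(** Let s be the permutation of x. If s changes a label, a diagonal matrix and its conjugate by x
    have different characters. If s keeps labels and sends the points of each row to distinct
    columns, x factors. Otherwise two points of a row land in one column, and their transposition
    has character 1 on the row side and -1 on the column side. *)
Lemma young_tableau : young K (row_group K) (col_group K) row_char col_char.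
Proof.
split.
- by apply/subsetP => g; rewrite inE => /andP[].
- by apply/subsetP => g; rewrite inE => /andP[].
- exact: row_char_linear.
- exact: col_char_linear.
- move=> g h; rewrite !inE => /andP[_ /row_presP rg] /andP[_ /col_presP ch'] e.
  rewrite e in rg *; rewrite /col_char.
  have -> : gpm_perm h = 1%g.
    apply/permP => x; rewrite perm1; have [[l ro] [_ co]] := (rg x, ch' x).
    exact: tab_inj l ro co.
  by rewrite odd_perm1 mul1r.
move=> x Kx; set s := gpm_perm x.
have [labs|/existsNP[y lab_y]] := pselect (forall y, tab_lab t (s y) = tab_lab t y); last first.
  right; have [u [Ku u1 ne]] := adapted_sep adK Kx lab_y.
  have [v1 vE] := diag_conj x u1.
  exists u, (x^-1 * u * x)%g; split; first exact: diag_row_group.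
  - by apply: diag_col_group => //; rewrite !groupM ?groupV.
  - by rewrite !mulgA mulgV mul1g.
  move=> e; apply: ne; rewrite e /col_char v1 odd_perm1 mul1r /row_char.
  rewrite (reindex_inj (@perm_inj _ s)) /=; apply: eq_bigr => i _.
  by rewrite vE.
have [d [Kd d1 xE]] : exists d, [/\ d \in K, gpm_perm d = 1%g & x = (d * perm_gpm s)%g].
  exists (x * (perm_gpm s)^-1)%g; rewrite mulgKV gpm_permM /= mulgV.
  by rewrite groupM ?groupV ?(adapted_proj adK).
have [inj|ninj] := pselect (row_inj t (fun y => tab_col t (s y))).
  (* [rho] permutes each row so that y moves to the column of s y; what remains of s then preserves
     columns. *)
  left; have /choice[rho rhoE] := row_inj_perm labs inj.
  have rho_inj : injective rho.
    move=> y y' e; have [l1 r1 c1] := rhoE y; have [l2 r2 c2] := rhoE y'.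
    by apply: inj; congruence.
  pose p := perm rho_inj.
  exists (d * perm_gpm p)%g, (perm_gpm (p^-1 * s)%g).
  have rp : row_pres p by apply/row_presP => y; rewrite permE; have [] := rhoE y.
  have cp : col_pres (p^-1 * s)%g.
    apply/col_presP => y; rewrite permM; have [l1 r1 c1] := rhoE (p^-1 y)%g.
    by rewrite labs -l1 -c1 -(permE rho_inj) permKV.
  split; last by rewrite -mulgA -perm_gpmM mulKVg.
    by rewrite inE groupM ?(adapted_perm adK) ?rp // gpm_permM d1 mul1g.
  by rewrite inE (adapted_perm adK) ?cp ?orbT.
right; have [y [y' [l ro co ne]]] : exists y y', [/\ tab_lab t y = tab_lab t y',
    tab_row t y = tab_row t y', tab_col t (s y) = tab_col t (s y') & y <> y'].
  apply: contrapT => no; apply: ninj => y y' l ro co; apply: contrapT => ne.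
  by apply: no; exists y, y'.
have rp : row_pres (tperm y y').
  by apply/row_presP => u; case: tpermP => [->|->|].
have cp : col_pres (tperm (s y) (s y')).
  by apply/col_presP => u; case: tpermP => [->|->|]; rewrite ?labs.
have Kg : perm_gpm (tperm y y') \in K by rewrite (adapted_perm adK) ?rp.
exists (d * perm_gpm (tperm y y') * d^-1)%g, (perm_gpm (tperm (s y) (s y'))); split.
- have Kc : (d * perm_gpm (tperm y y') * d^-1)%g \in K.
    by apply: groupM; [apply: groupM | rewrite groupV].
  rewrite inE Kc !gpm_permM d1 mul1g.
  have -> : gpm_perm d^-1%g = 1%g by rewrite -[LHS]/((gpm_perm d)^-1)%g d1 invg1.
  by rewrite mulg1.
- by rewrite inE (adapted_perm adK) ?cp ?orbT.
- rewrite xE -!mulgA mulKg -!perm_gpmM; congr (_ * perm_gpm _)%g.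
  rewrite -tpermJ conjgE !mulgA mulgV mul1g. done.
have Pd : d \in row_group K by apply: diag_row_group.
have Pg : perm_gpm (tperm y y') \in row_group K by rewrite inE Kg.
rewrite !(linear_onM row_char_linear) ?groupM ?groupV // mulrAC.
rewrite (linear_onV row_char_linear) // mul1r /col_char !row_char_perm mulr1 /=.
rewrite odd_tperm (inj_eq perm_inj); move/eqP: ne => -> /=.
move/eqP; rewrite eq_sym -subr_eq0 -opprD oppr_eq0 -(natrD _ 1 1) pnatr_eq0. done.
Qed.

End TableauGroups.

(** One half of a dominance comparison of shapes; used in both directions it forces equal column
    lengths. *)
Lemma count_label_le N (t1 t2 : tableau N) (s : 'S_N) k k' :
    (forall x, (tab_lab t2 (s x) == k') = (tab_lab t1 x == k)) ->
    (forall x y, tab_lab t1 x = tab_lab t1 y -> tab_row t1 x = tab_row t1 y ->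
      tab_lab t1 x = k -> tab_col t2 (s x) = tab_col t2 (s y) -> x = y) ->
  forall j,
  (#|[set x | (tab_lab t2 x == k') && (tab_col t2 x < j)]| <=
   #|[set x | (tab_lab t1 x == k) && (tab_col t1 x < j)]|)%N.
Proof.
move=> labs sep j.
have -> : #|[set x | (tab_lab t2 x == k') && (tab_col t2 x < j)%N]| =
    #|[set x | (tab_lab t1 x == k) && (tab_col t2 (s x) < j)%N]|.
  rewrite -(card_preimset _ (@perm_inj _ s)); apply: eq_card => x.
  by rewrite !inE labs.
apply: count_label => x y lx ly ro co.
by apply: (sep x y) => //; rewrite lx ly.
Qed.

(** * Two tableaux acting nontrivially on one irreducible module *)

Section Comparison.

Variables (C : numClosedFieldType) (r : nat) (z : C) (z_prim : r.-primitive_root z).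
Variables (N : nat) (K : {group gpm r N}).
Variables (t1 t2 : tableau N) (ch1 ch2 : 'I_N -> nat).
Hypotheses (ad1 : adapted z t1 ch1 K) (ad2 : adapted z t2 ch2 K).
Variables (n : nat) (W : mx_representation C K n).

(** Irreducibility gives x with A x B nonzero, and then any g x = x h forces g and h to have equal
    characters. Diagonal g compare the charges; transpositions, with characters 1 and -1, cannot
    satisfy this, so points of a row are separated. *)
Lemma young_types_compare : mx_irreducible W ->
    wsum (row_group t1 K) (row_char z ch1) W != 0 ->
    wsum (col_group t2 K) (col_char z ch2) W != 0 ->
  exists s : 'S_N, [/\ perm_gpm r s \in K,
    forall u, u \in K -> gpm_perm u = 1%g ->
      row_char z ch1 u = \prod_i z ^+ (gpm_exp u i * ch2 (s i)) &
    forall x y, tab_lab t1 x = tab_lab t1 y -> tab_row t1 x = tab_row t1 y ->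
      tab_lab t2 (s x) = tab_lab t2 (s y) -> tab_col t2 (s x) = tab_col t2 (s y) -> x = y].
Proof.
move=> irrW A0 B0; have [x Kx] := irr_connect irrW A0 B0.
set A := wsum _ _ _; set B := wsum _ _ _; set s := gpm_perm x => AxB.
have y1 := young_tableau z_prim ad1; have y2 := young_tableau z_prim ad2.
have [l1 l2] := (young_lin1 y1, young_lin2 y2).
have [s1 s2] := (young_sub1 y1, young_sub2 y2).
have Ks : perm_gpm r s \in K := adapted_proj ad1 Kx.
have eqchar x' g h : x' \in K -> A *m W x' *m B != 0 -> g \in row_group t1 K ->
    h \in col_group t2 K -> (g * x' = x' * h)%g -> row_char z ch1 g = col_char z ch2 h.
  move=> Kx' nz Pg Qh e; have [Kg Kh] := (subsetP s1 g Pg, subsetP s2 h Qh).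
  have e1 : A *m W (g * x')%g *m B = row_char z ch1 g *: (A *m W x' *m B).
    by rewrite repr_mxM // mulmxA (wsum_mulr s1 l1) // -!scalemxAl.
  have : A *m W (g * x')%g *m B = col_char z ch2 h *: (A *m W x' *m B).
    by rewrite e repr_mxM // mulmxA -(mulmxA _ (W h)) (wsum_mull s2 l2) // -scalemxAr.
  rewrite e1 => /eqP; rewrite -subr_eq0 -scalerBl scaler_eq0 subr_eq0 (negPf nz) orbF.
  by move/eqP.
exists s; split=> // [u Ku u1|y y' l ro l' co].
  have [v1 vE] := diag_conj x u1.
  rewrite (eqchar x u (x^-1 * u * x)%g) //; first 1 last.
  - exact: diag_row_group.
  - by apply: diag_col_group => //; rewrite !groupM ?groupV.
  - by rewrite !mulgA mulgV mul1g.
  rewrite /col_char v1 odd_perm1 mul1r /row_char.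
  by rewrite (reindex_inj (@perm_inj _ s)); apply: eq_bigr => i _; rewrite vE.
apply: contrapT => ne.
(* The diagonal part of x is absorbed by A up to a scalar, so x may be replaced by its permutation
   matrix. *)
pose d := (x * (perm_gpm r s)^-1)%g.
have Kd : d \in K by rewrite groupM ?groupV.
have Pd : d \in row_group t1 K by apply: diag_row_group => //; rewrite gpm_permM /= mulgV.
have AsB : A *m W (perm_gpm r s) *m B != 0.
  apply: contraNneq AxB => e; rewrite -[x](mulgKV (perm_gpm r s)) -/d repr_mxM //.
  by rewrite mulmxA (wsum_mulr s1 l1) // -!scalemxAl e scaler0.
have rp : row_pres t1 (tperm y y').
  by apply/row_presP => u; case: tpermP => [->|->|].
have cp : col_pres t2 (tperm (s y) (s y')).
  by apply/col_presP => u; case: tpermP => [->|->|].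
have := eqchar _ (perm_gpm r (tperm y y')) (perm_gpm r (tperm (s y) (s y'))) Ks AsB.
rewrite !inE (adapted_perm ad1) ?rp // (adapted_perm ad2) ?cp ?orbT // => /(_ isT isT).
have -> : (perm_gpm r (tperm y y') * perm_gpm r s =
           perm_gpm r s * perm_gpm r (tperm (s y) (s y')))%g.
  by rewrite -!perm_gpmM -tpermJ conjgE !mulgA mulgV mul1g.
move=> /(_ erefl).
rewrite /col_char !row_char_perm mulr1 /= odd_tperm (inj_eq perm_inj).
move/eqP: ne => -> /=.
by move/eqP; rewrite -subr_eq0 opprK -(natrD _ 1 1) pnatr_eq0.
Qed.

End Comparison.

(** * Tableaux adapted to G(r,1,n), G(r,1,n) x Z/r and L(r,p,n+1) *)

Section Adapted.

Variables (C : numClosedFieldType) (r : nat) (z : C) (z_prim : r.-primitive_root z).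

Lemma z_inZp e c : z ^+ ((inZp e : Zmod r) * c) = z ^+ (e * c).
Proof.
rewrite /= exprM (prednK (prim_order_gt0 z_prim)) (prim_expr_mod z_prim).
by rewrite -exprM.
Qed.

Definition diag_gpm N (f : 'I_N -> Zmod r) : gpm r N := Gpm 1%g [ffun i => f i].

Lemma row_char_diag1 N (ch : 'I_N -> nat) y e :
  \prod_i z ^+ ((if i == y then inZp e : Zmod r else 0) * ch i) = z ^+ (e * ch y).
Proof.
rewrite (bigD1 y) //= eqxx z_inZp big1 ?mulr1 // => i /negPf->.
by rewrite mul0n.
Qed.

Lemma prod_single N (ch : 'I_N -> nat) y e :
  \prod_i z ^+ (gpm_exp (diag_gpm (fun i => if i == y then inZp e else 0)) i * ch i) =
  z ^+ (e * ch y).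
Proof.
rewrite -(row_char_diag1 ch y e); apply: eq_bigr => i _.
by rewrite ffunE.
Qed.

(** Labels serve as charges; being below r, they are told apart by a diagonal matrix with a single
    entry zeta. *)
Lemma adapted_full N (t : tableau N) : (forall x, tab_lab t x < r)%N ->
  adapted z t (tab_lab t) [set: gpm r N].
Proof.
move=> lt_r; split=> [s|x|x y|x y _ ne]; rewrite ?inE //.
exists (diag_gpm (fun i => if i == y then inZp 1 else 0)); split; rewrite ?inE //.
rewrite /row_char !prod_single !mul1n => /eqP; rewrite (eq_prim_root_expr z_prim).
rewrite !modn_small // => /eqP e; exact: ne.
Qed.

Section Extension.

Variables (n : nat) (t : tableau n) (k : nat).
Hypothesis lt_r : forall x, (tab_lab t x < r)%N.

Definition ext_fun (f : 'I_n -> nat) a (x : 'I_n.+1) := oapp f a (unlift ord_max x).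

Lemma ext_fun_max f a : ext_fun f a ord_max = a.
Proof. by rewrite /ext_fun unlift_none. Qed.
Lemma ext_fun_lift f a i : ext_fun f a (lift ord_max i) = f i.
Proof. by rewrite /ext_fun liftK. Qed.

Lemma ext_inj x y : ext_fun (tab_lab t) r x = ext_fun (tab_lab t) r y ->
  ext_fun (tab_row t) 0 x = ext_fun (tab_row t) 0 y ->
  ext_fun (tab_col t) 0 x = ext_fun (tab_col t) 0 y -> x = y.
Proof.
case: (unliftP ord_max x) => [i|] ->; case: (unliftP ord_max y) => [j|] ->;
  rewrite ?ext_fun_max ?ext_fun_lift //.
- by move=> l ro co; rewrite (tab_inj l ro co).
- by move=> e; have := lt_r i; rewrite e ltnn.
- by move=> e; have := lt_r j; rewrite -e ltnn.
Qed.

Lemma ext_left x j : (j < ext_fun (tab_col t) 0 x)%N ->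
  exists y, [/\ ext_fun (tab_lab t) r y = ext_fun (tab_lab t) r x,
    ext_fun (tab_row t) 0 y = ext_fun (tab_row t) 0 x & ext_fun (tab_col t) 0 y = j].
Proof.
case: (unliftP ord_max x) => [i|] ->; rewrite ?ext_fun_max ?ext_fun_lift //.
by move/tab_left => [y [l ro co]]; exists (lift ord_max y); rewrite !ext_fun_lift.
Qed.

(** The new last point gets the label r, which no other point has, so both groups fix it; its charge
    k is recorded separately. *)
Definition ext_tab := Tableau ext_inj ext_left.
Definition ext_charge := ext_fun (tab_lab t) k.

Lemma in_last g : (g \in (last_emb_morphism r n @* setT)%g) = (gpm_perm g ord_max == ord_max).
Proof.
apply/idP/idP => [/morphimP[x _ _ ->]|fg]; first by rewrite /= lift_perm_id.
(* For p = 1 the condition on the degree is a multiple of r and always holds. *)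
apply: (subsetP (Lrp_sub_last r n 1)); rewrite in_Lrp fg andbT inE.
rewrite divn1 Zp_mulrn; apply/eqP/val_inj => /=; move: (nat_of_ord _) => d.
by rewrite (prednK (prim_order_gt0 z_prim)) modnMl.
Qed.

Lemma ext_pres_max (s : 'S_n.+1) : (forall x, tab_lab ext_tab (s x) = tab_lab ext_tab x) -> s ord_max = ord_max.
Proof.
move/(_ ord_max); rewrite /= ext_fun_max; case: (unliftP ord_max (s ord_max)) => [i|] ->//.
by rewrite ext_fun_lift => e; have := lt_r i; rewrite e ltnn.
Qed.

Lemma ext_sep_lift (s : 'S_n.+1) y : s ord_max = ord_max ->
  tab_lab ext_tab (s y) <> tab_lab ext_tab y ->
  exists i j, y = lift ord_max i /\ s y = lift ord_max j.
Proof.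
move=> fs ne; case: (unliftP ord_max y) ne => [i|] -> ne; last by rewrite fs in ne.
exists i; case: (unliftP ord_max (s (lift ord_max i))) => [j ->|]; first by exists j.
move=> e; have /perm_inj e' : s (lift ord_max i) = s ord_max by rewrite e fs.
by have := neq_lift ord_max i; rewrite e' eqxx.
Qed.

Lemma adapted_last : adapted z ext_tab ext_charge (last_emb_morphism r n @* setT)%G.
Proof.
split=> [s|x|x y|x y]; rewrite ?in_last //=.
- move=> h; apply/eqP/ext_pres_max => x.
  by case/orP: h => [/row_presP/(_ x)[]|/col_presP/(_ x)[]].
- rewrite /ext_charge; case: (unliftP ord_max x) => [i|] ->; case: (unliftP ord_max y) => [j|] ->;
  rewrite ?ext_fun_max ?ext_fun_lift // => e.
    by have := lt_r i; rewrite e ltnn.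
  by have := lt_r j; rewrite -e ltnn.
move=> /eqP fx ne; have [i [j [yE sE]]] := ext_sep_lift fx ne.
exists (diag_gpm (fun i => if i == y then inZp 1 else 0)); split; rewrite ?in_last ?perm1 //.
rewrite /row_char !prod_single !mul1n => /eqP; rewrite (eq_prim_root_expr z_prim) => /eqP.
by rewrite /ext_charge sE yE !ext_fun_lift !modn_small // => e; apply: ne; rewrite sE yE /= !ext_fun_lift.
Qed.

Lemma row_char_diag2 (ch : 'I_n.+1 -> nat) y e a : y != ord_max ->
  \prod_i z ^+ ((if i == y then inZp e : Zmod r else if i == ord_max then inZp a else 0) * ch i)
  = z ^+ (e * ch y) * z ^+ (a * ch ord_max).
Proof.
move=> ny; have ny' : (ord_max == y) = false by rewrite eq_sym (negPf ny).
rewrite (bigD1 y) //= eqxx z_inZp; congr (_ * _).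
rewrite (bigD1 ord_max) /= ?ny' // eqxx z_inZp big1 ?mulr1 //.
by move=> i /andP[/negPf-> /negPf->]; rewrite mul0n.
Qed.

(** The entry zeta at y and its inverse in the last coordinate: the product is 1, so the matrix lies
    in L(r,p,n+1) for every p. *)
Definition balanced_gpm (y : 'I_n.+1) : gpm r n.+1 :=
  diag_gpm (fun i => if i == y then inZp 1 else if i == ord_max then inZp r.-1 else 0).

Lemma balanced_Lrp p y : y != ord_max -> balanced_gpm y \in Lrp r n p.
Proof.
move=> ny; have ny' : (ord_max == y) = false by rewrite eq_sym (negPf ny).
rewrite in_Lrp perm1 eqxx andbT inE /gpm_deg.
under eq_bigr do rewrite ffunE.
rewrite (bigD1 y) //= eqxx (bigD1 ord_max) /= ?ny' // eqxx big1.
  rewrite addr0; suff -> : (inZp 1 + inZp r.-1 : Zmod r) = 0 by rewrite mul0rn.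
  apply: val_inj => /=; rewrite modnDm add1n (prednK (prim_order_gt0 z_prim)).
  exact: modnn.
by move=> l /andP[/negPf-> /negPf->].
Qed.

Lemma prod_balanced (ch : 'I_n.+1 -> nat) y : y != ord_max ->
  \prod_i z ^+ (gpm_exp (balanced_gpm y) i * ch i) = z ^+ (ch y + r.-1 * ch ord_max).
Proof.
move=> ny; under eq_bigr do rewrite ffunE.
by rewrite row_char_diag2 // mul1n exprD.
Qed.

(** The balanced matrices separate labels: x fixes the last point, so the contributions of the last
    entry cancel in the comparison. *)
Lemma adapted_Lrp p : adapted z ext_tab ext_charge (Lrp r n p).
Proof.
have adL := adapted_last; split=> [s h|x|x y|x y Lx ne].
- have := adapted_perm adL h; rewrite in_last in_Lrp => ->; rewrite andbT inE.
  by rewrite /gpm_deg big1 ?mul0rn // => i _; rewrite ffunE.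
- rewrite !in_Lrp => /andP[_ ->]; rewrite andbT inE.
  by rewrite /gpm_deg big1 ?mul0rn // => i _; rewrite ffunE.
- exact: (adapted_charge adL).
have fx : gpm_perm x ord_max = ord_max by move: Lx; rewrite in_Lrp => /andP[_ /eqP].
have [i [j [yE sE]]] := ext_sep_lift fx ne.
have ny : y != ord_max by rewrite yE eq_sym neq_lift.
exists (balanced_gpm y); split=> //; first exact: balanced_Lrp.
rewrite /row_char !prod_balanced // !exprD fx => /(mulIf (z_neq0 z_prim _))/eqP.
rewrite (eq_prim_root_expr z_prim) => /eqP.
by rewrite /ext_charge sE yE !ext_fun_lift !modn_small // => e; apply: ne; rewrite sE yE /= !ext_fun_lift.
Qed.

End Extension.

End Adapted.

(** * Specht modules and the modules V^lambda *)

Section SymmetricTableau.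

Variables (C : numClosedFieldType) (N : nat) (t : tableau N).

Definition sym_row := [set s : 'S_N | row_pres t s].
Definition sym_col := [set s : 'S_N | col_pres t s].

Lemma sym_row_group_set : group_set sym_row.
Proof.
have := row_group_set t [set: gpm 1 N] => /group_setP[h1 hM].
apply/group_setP; split=> [|s u]; rewrite !inE; first by move: h1; rewrite !inE.
by have := hM (perm_gpm 1 s) (perm_gpm 1 u); rewrite !inE.
Qed.
Canonical sym_row_group := Group sym_row_group_set.

Lemma sym_col_group_set : group_set sym_col.
Proof.
have := col_group_set t [set: gpm 1 N] => /group_setP[h1 hM].
apply/group_setP; split=> [|s u]; rewrite !inE; first by move: h1; rewrite !inE.
by have := hM (perm_gpm 1 s) (perm_gpm 1 u); rewrite !inE.
Qed.
Canonical sym_col_group := Group sym_col_group_set.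

(** The symmetric group is G(1,1,N), where the diagonal characters are trivial. *)
Lemma young_sym : (forall x, tab_lab t x = 0)%N ->
  young [set: 'S_N] sym_row_group sym_col_group (fun=> 1 : C)
    (fun s => (-1) ^+ odd_perm s).
Proof.
move=> lab0; have z1 : 1.-primitive_root (1 : C) 
    by apply/andP; split=> //; apply/forallP => i; rewrite ord1 unity_rootE expr1n eqxx.
have ad : adapted (1 : C) t (tab_lab t) [set: gpm 1 N].
  by apply: (adapted_full z1) => x; rewrite lab0.
have char1 g : row_char 1 (tab_lab t) g = 1 :> C.
  by rewrite /row_char big1 // => i _; rewrite expr1n.
have yt := young_tableau z1 ad.
split.
- exact: subsetT.
- exact: subsetT.
- by split=> // g h _ _; rewrite mulr1.
- by split=> [|g h _ _]; rewrite ?odd_perm1 // odd_permM signr_addb.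
- move=> g h Pg Qh e; have := young_agree yt (x := perm_gpm 1 g) (y := perm_gpm 1 h).
  have [Rg Ch] : row_pres t g /\ col_pres t h by move: Pg Qh; rewrite !inE.
  rewrite !inE /= Rg Ch => /(_ isT isT); rewrite /col_char !char1 mulr1; apply.
  by rewrite e.
move=> s _; case: (young_mackey yt (in_setT (perm_gpm 1 s))).
  case=> g [h []]; rewrite !inE /= => Pg Qh e; left; exists (gpm_perm g), (gpm_perm h).
  by rewrite !inE; split=> //; rewrite -gpm_permM -e.
case=> g [h []]; rewrite !inE /= => Pg Qh e ne; right; exists (gpm_perm g), (gpm_perm h).
rewrite !inE; split=> //; first by have := congr1 (@gpm_perm 1 N) e; rewrite !gpm_permM.
by move=> e'; apply: ne; rewrite /col_char !char1 mulr1.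
Qed.

End SymmetricTableau.

Section ShapeTableau.

Variable s : seq nat.

Lemma shape_inj (x y : 'I_(sumn s)) : reshape_index s x = reshape_index s y ->
  reshape_offset s x = reshape_offset s y -> x = y.
Proof.
by move=> er eo; apply: val_inj; rewrite /= -(reshape_indexK s x) er eo reshape_indexK.
Qed.

Lemma shape_box i j : (j < nth 0 s i)%N ->
  exists x : 'I_(sumn s), reshape_index s x = i /\ reshape_offset s x = j.
Proof.
move=> lt_j; exists (Ordinal (flatten_indexP lt_j)) => /=.
by rewrite flatten_indexKl // flatten_indexKr.
Qed.

Lemma shape_left (x : 'I_(sumn s)) j : (j < reshape_offset s x)%N ->
  exists y : 'I_(sumn s), reshape_index s y = reshape_index s x /\ reshape_offset s y = j.
Proof.
move=> lt_j; apply: shape_box; apply: ltn_trans lt_j _.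
by apply: reshape_offsetP.
Qed.

Definition shape_tab : tableau (sumn s).
Proof.
refine (@Tableau _ (fun=> 0%N) (fun x => reshape_index s x)
  (fun x => reshape_offset s x) (fun x y _ => @shape_inj x y) _).
by move=> x j /shape_left[y [? ?]]; exists y.
Defined.

Lemma row_stabE : row_stab s = sym_row shape_tab.
Proof. by apply/setP => g; rewrite !inE; exact: eq_forallb. Qed.
Lemma col_stabE : col_stab s = sym_col shape_tab.
Proof. by apply/setP => g; rewrite !inE; exact: eq_forallb. Qed.

Variable C : numClosedFieldType.

(** The polytabloid is the basis vector of the identity times AB, so the Specht module is an
    instance of [young_generated_cyclic]. *)
Lemma young_generated_specht : young_generated (row_stab s) (col_stab s) (fun=> 1)
  (fun g => (-1) ^+ odd_perm g) (specht C s).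
Proof.
have yS := @young_sym C _ shape_tab (fun=> erefl).
set aG := regular_repr C [set: 'S_(sumn s)].
pose d : 'rV[C]_#|[set: 'S_(sumn s)]| := delta_mx 0 (gring_index [set: 'S_(sumn s)] 1%g).
have polyE : polytabloid C s = d *m (wsum (sym_row shape_tab) (fun=> 1) aG *m
    wsum (sym_col shape_tab) (fun g => (-1) ^+ odd_perm g) aG).
  rewrite mulmxA /polytabloid !wsum.unlock [d *m _]mulmx_sumr mulmx_suml row_stabE col_stabE.
  apply: eq_bigr => g _; rewrite mulmx_sumr; apply: eq_bigr => h _.
  rewrite scale1r odd_permV -scalemxAr -mulmxA -repr_mxM ?inE //; congr (_ *: _).
  by rewrite /d -rowE rowK gring_indexK ?inE // mul1g.
rewrite /specht row_stabE col_stabE polyE.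
apply: (young_generated_cyclic yS).
exact: (young_regular_row_neq0 yS).
Qed.

End ShapeTableau.

Section BlockTableau.

Variables (r q n : nat) (al : 'I_q -> nat) (al_n : (\sum_k al k)%N = n).

Notation T := (fun k : 'I_q => 'I_(al k)).
Notation blocks := {dffun forall k : 'I_q, gpm r (al k)}.
Notation sig := (block_sig al_n).
Notation rank := (block_rank al_n).
Notation emb := (block_emb al_n).

Lemma Tagged_tagged_as k (i : T k) (u : {k & T k}) : tag u = k ->
  Tagged T (tagged_as (Tagged T i) u) = u.
Proof. by case: u => k' j /= e; case: k / e i => i; rewrite tagged_asE. Qed.

Lemma Tagged_tagged (u : {k & T k}) : Tagged T (tagged u) = u.
Proof. by case: u. Qed.

Lemma sig_block_emb (b : blocks) x :
  sig (gpm_perm (emb b) x) = Tagged T (gpm_perm (b (tag (sig x))) (tagged (sig x))).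
Proof. by rewrite /= permE /block_fun block_rankK. Qed.

Lemma block_emb_surj (g : gpm r n) :
  (forall x, tag (sig (gpm_perm g x)) = tag (sig x)) -> exists b, emb b = g.
Proof.
move=> tg; pose f k (i : T k) : T k :=
  tagged_as (Tagged T i) (sig (gpm_perm g (rank (Tagged T i)))).
have fE k (i : T k) : Tagged T (f k i) = sig (gpm_perm g (rank (Tagged T i))).
  by rewrite Tagged_tagged_as // tg block_rankK.
have f_inj k : injective (f k).
  move=> i j e; have := fE k i; rewrite e fE => /(can_inj (block_sigK al_n)).
  move/perm_inj/(can_inj (block_rankK al_n))/eqP.
  by rewrite -tag_eqE /tag_eq /= eqxx /= tagged_asE => /eqP.
pose b : blocks := [ffun k => Gpm (perm (@f_inj k)) [ffun i => gpm_exp g (rank (Tagged T i))]].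
exists b; apply: gpm_eq => [|x].
  apply/permP => x; apply: (can_inj (block_sigK al_n)).
  rewrite sig_block_emb ffunE /= permE fE.
  by rewrite Tagged_tagged block_sigK.
by rewrite ffunE /= ffunE /= ffunE Tagged_tagged block_sigK.
Qed.

Lemma prod_blocks (R : Type) (idx : R) (op : Monoid.com_law idx) (F : forall k, T k -> R) :
  \big[op/idx]_(x < n) F (tag (sig x)) (tagged (sig x)) =
  \big[op/idx]_(k < q) \big[op/idx]_(i < al k) F k i.
Proof.
rewrite sig_big_dep /= (reindex sig) //=.
by exists rank => x _; rewrite ?block_sigK ?block_rankK.
Qed.

Section Sign.

Variable C : numClosedFieldType.

Let sgn m (g : gpm r m) : C := (-1) ^+ odd_perm (gpm_perm g).

Let sgnM m (g h : gpm r m) : sgn (g * h)%g = sgn g * sgn h.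
Proof. by rewrite /sgn gpm_permM odd_permM signr_addb. Qed.

Lemma perm_emb_dfung1 k (g : gpm r (al k)) :
  gpm_perm (emb (dfung1 g)) = gpm_perm (emb (dfung1 (perm_gpm r (gpm_perm g)))).
Proof.
apply/permP => x; apply: (can_inj (block_sigK al_n)); rewrite !sig_block_emb.
suff -> : gpm_perm ((dfung1 g : blocks) (tag (sig x))) =
    gpm_perm ((dfung1 (perm_gpm r (gpm_perm g)) : blocks) (tag (sig x))) by [].
have [<-|nk] := eqVneq k (tag (sig x)); first by rewrite !dfung1_id.
by rewrite !dfung1_dflt.
Qed.

Lemma perm_emb_tperm k (i j : T k) :
  gpm_perm (emb (dfung1 (perm_gpm r (tperm i j)))) =
  tperm (rank (Tagged T i)) (rank (Tagged T j)).
Proof.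
apply/permP => x; apply: (can_inj (block_sigK al_n)); rewrite sig_block_emb.
have rk u : (x == rank u) = (sig x == u).
  by apply/eqP/eqP => [->|<-]; rewrite ?block_rankK ?block_sigK.
rewrite permE /= 2!rk (fun_if sig) (fun_if sig) !block_rankK.
case: (sig x) => k' a /=; have [ek|nk] := eqVneq k k'.
  case: k' / ek a => a; rewrite dfung1_id /= permE /=.
  rewrite -!tag_eqE /tag_eq /= eqxx /= !tagged_asE.
  by case: (a == i); case: (a == j).
rewrite dfung1_dflt //= perm1.
by rewrite -!tag_eqE /tag_eq /= eq_sym (negPf nk).
Qed.

(** A permutation is a product of transpositions, and the block embedding sends transpositions to
    transpositions. *)
Lemma sign_emb_dfung1 k (g : gpm r (al k)) : sgn (emb (dfung1 g)) = sgn g.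
Proof.
rewrite {1}/sgn perm_emb_dfung1 /sgn; set s := gpm_perm g.
have [ts -> _] := prod_tpermP s.
elim: ts => [|[i j] ts IHts].
  rewrite !big_nil (_ : perm_gpm r 1%g = 1%g) //.
  by rewrite (morph1 (dfung1_morphism _ k)) (morph1 (block_emb_morphism r al_n)) !odd_perm1.
rewrite !big_cons perm_gpmM dfung1_morphM block_embM gpm_permM !odd_permM 2!signr_addb IHts.
rewrite perm_emb_tperm !odd_tperm (inj_eq (can_inj (block_rankK al_n))).
by rewrite -tag_eqE /tag_eq /= eqxx /= tagged_asE.
Qed.

Lemma sign_block_emb (b : blocks) :
  (-1) ^+ odd_perm (gpm_perm (emb b)) = \prod_(k < q) (-1) ^+ odd_perm (gpm_perm (b k)) :> C.
Proof.
have bE : b = (\prod_k dfung1 (b k))%g.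
  apply/ffunP => k; rewrite prodg_ffun (big_only1 k) ?dfung1_id //.
  by move=> j jk _; rewrite dfung1_dflt.
rewrite {1}bE (big_morph emb (@block_embM r q n al al_n) (_ : _ = 1%g)); last first.
  exact: (morph1 (block_emb_morphism r al_n)).
rewrite -/(sgn _) (big_morph (@sgn n) (@sgnM n) (_ : _ = 1)); last by rewrite /sgn odd_perm1.
by apply: eq_bigr => k _; rewrite sign_emb_dfung1.
Qed.

End Sign.

End BlockTableau.

Section VlamYoung.

Variables (C : numClosedFieldType) (r : nat) (z : C) (z_prim : r.-primitive_root z).

Lemma delta0_prod n (g : gpm r n) k : delta0 z g ^+ k = row_char z (fun=> k) g.
Proof.
rewrite /row_char /delta0 /gpm_deg.
have -> : z ^+ (\sum_i gpm_exp g i)%R = \prod_i z ^+ gpm_exp g i.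
  by apply: (big_rec2 (fun (a : Zmod r) b => z ^+ a = b)) => // i a b _ <-; rewrite (z_expD z_prim).
by rewrite -prodrXl; apply: eq_bigr => i _; rewrite exprM.
Qed.

Variables (n : nat) (l : mpart r n).

Notation al := (fun k => sumn (tnth l k)).
Notation sig := (block_sig (mpart_sum l)).
Notation st k := (shape_tab (tnth l k)).

Lemma mpart_inj x y : tag (sig x) = tag (sig y) :> nat ->
  reshape_index (tnth l (tag (sig x))) (tagged (sig x)) =
    reshape_index (tnth l (tag (sig y))) (tagged (sig y)) ->
  reshape_offset (tnth l (tag (sig x))) (tagged (sig x)) =
    reshape_offset (tnth l (tag (sig y))) (tagged (sig y)) -> x = y.
Proof.
move=> /val_inj e er eo; apply: (can_inj (block_sigK (mpart_sum l))).
case: (sig x) (sig y) e er eo => k i [k' j] /= e; case: k' / e j => j er eo.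
by rewrite (shape_inj er eo).
Qed.

Lemma mpart_box (k : 'I_r) i j : (j < nth 0%N (tnth l k) i)%N ->
  exists x, [/\ tag (sig x) = k,
    reshape_index (tnth l (tag (sig x))) (tagged (sig x)) = i &
    reshape_offset (tnth l (tag (sig x))) (tagged (sig x)) = j].
Proof.
move=> /shape_box[x [xi xj]].
by exists (block_rank (mpart_sum l) (Tagged (fun k => 'I_(al k)) x)); rewrite block_rankK.
Qed.

Lemma mpart_left x j : (j < reshape_offset (tnth l (tag (sig x))) (tagged (sig x)))%N ->
  exists y, [/\ tag (sig y) = tag (sig x) :> nat,
    reshape_index (tnth l (tag (sig y))) (tagged (sig y)) =
      reshape_index (tnth l (tag (sig x))) (tagged (sig x)) &
    reshape_offset (tnth l (tag (sig y))) (tagged (sig y)) = j].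
Proof.
move=> lt_j; have lt_j' := ltn_trans lt_j (reshape_offsetP (ltn_ord (tagged (sig x)))).
by have [y [yl yr yc]] := mpart_box lt_j'; exists y; rewrite yr yc yl.
Qed.

Definition mpart_tab : tableau n := Tableau mpart_inj mpart_left.

Lemma mpart_tab_lt x : (tab_lab mpart_tab x < r)%N.
Proof. exact: ltn_ord. Qed.

Notation P := (fun k => row_group (st k) [set: gpm r (al k)]).
Notation Q := (fun k => col_group (st k) [set: gpm r (al k)]).
Notation chi := (fun (k : 'I_r) => @row_char C r z (al k) (fun=> nat_of_ord k)).
Notation psi := (fun (k : 'I_r) => @col_char C r z (al k) (fun=> nat_of_ord k)).

Lemma young_generated_colored k :
  young_generated (P k) (Q k) (chi k) (psi k) (colored_specht z_prim l k).
Proof.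
have yS := young_generated_specht (tnth l k) C.
have imT : (gpm_perm_morphism r (al k) @* [set: gpm r (al k)])%g = [set: 'S_(al k)].
  apply/eqP; rewrite eqEsubset subsetT; apply/subsetP => s _.
  by apply/morphimP; exists (perm_gpm r s); rewrite ?inE.
apply: (eq_young_generated _ _ _ _ _ (young_generated_twist _ _ _ _
  (young_generated_pull _ imT (subsetT _) (subsetT _) yS))); try exact: subsetT.
- by rewrite row_stabE; apply/setP => g; rewrite !inE.
- by rewrite col_stabE; apply/setP => g; rewrite !inE.
- by move=> g _ /=; rewrite mulr1 delta0_prod.
- by move=> g _ /=; rewrite mulrC delta0_prod.
exact: (@groupVr _ (col_group (st k) [set: gpm r (al k)])).
Qed.

Lemma young_generated_external :
  young_generated (setXn P) (setXn Q) (fun g => \prod_(k < r) chi k (g k))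
    (fun g => \prod_(k < r) psi k (g k)) (external_product z_prim l).
Proof.
by have [] := young_generated_ext young_generated_colored (index_enum_uniq 'I_r).
Qed.

Notation emb := (block_emb (mpart_sum l)).
Notation blocks := {dffun forall k : 'I_r, gpm r (al k)}.

Lemma row_pres_emb (b : blocks) : row_pres mpart_tab (gpm_perm (emb b)) =
  [forall k, row_pres (st k) (gpm_perm (b k))].
Proof.
apply/row_presP/forallP => [h k|h x].
  apply/row_presP => x; split=> //=.
  have [_] := h (block_rank (mpart_sum l) (Tagged (fun k => 'I_(al k)) x)).
  by rewrite /= -[perm _ _]/(gpm_perm (emb b) _) sig_block_emb block_rankK.
rewrite [tab_lab _ _]/= [tab_row _ (_ _)]/= sig_block_emb /=; split=> //.
have /row_presP/(_ (tagged (sig x)))[_ e] := h (tag (sig x)); exact: e.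
Qed.

Lemma col_pres_emb (b : blocks) : col_pres mpart_tab (gpm_perm (emb b)) =
  [forall k, col_pres (st k) (gpm_perm (b k))].
Proof.
apply/col_presP/forallP => [h k|h x].
  apply/col_presP => x; split=> //=.
  have [_] := h (block_rank (mpart_sum l) (Tagged (fun k => 'I_(al k)) x)).
  by rewrite /= -[perm _ _]/(gpm_perm (emb b) _) sig_block_emb block_rankK.
rewrite [tab_lab _ _]/= [tab_col _ (_ _)]/= sig_block_emb /=; split=> //.
have /col_presP/(_ (tagged (sig x)))[_ e] := h (tag (sig x)); exact: e.
Qed.

Lemma row_char_emb (b : blocks) : row_char z (tab_lab mpart_tab) (emb b) = \prod_(k < r) chi k (b k).
Proof.
transitivity (\prod_(x < n) z ^+ (gpm_exp (b (tag (sig x))) (tagged (sig x)) * tag (sig x))).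
  by apply: eq_bigr => x _; rewrite ffunE.
exact: (prod_blocks (mpart_sum l) _ (fun (k : 'I_r) i => z ^+ (gpm_exp (b k) i * k))).
Qed.

Lemma col_char_emb (b : blocks) : col_char z (tab_lab mpart_tab) (emb b) = \prod_(k < r) psi k (b k).
Proof. by rewrite /col_char row_char_emb sign_block_emb -big_split. Qed.

(** Row and column permutations preserve labels, so both groups lie in the block subgroup and are
    there the products of the groups of the components. Generation then passes through the external
    product and induction. *)
Lemma young_generated_Vlam :
  young_generated (row_set mpart_tab [set: gpm r n]) (col_set mpart_tab [set: gpm r n])
    (row_char z (tab_lab mpart_tab)) (col_char z (tab_lab mpart_tab)) (Vlam z_prim l).
Proof.
have Dpres g (p : pred 'S_n) : (forall s, p s -> forall x, tab_lab mpart_tab (s x) = tab_lab mpart_tab x) ->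
    p (gpm_perm g) -> exists b, emb b = g.
  move=> pl pg; apply: block_emb_surj => x; apply: val_inj.
  exact: pl _ pg x.
have rowD g : row_pres mpart_tab (gpm_perm g) -> exists b, emb b = g.
  by apply: Dpres => s /row_presP h x; have [] := h x.
have colD g : col_pres mpart_tab (gpm_perm g) -> exists b, emb b = g.
  by apply: Dpres => s /col_presP h x; have [] := h x.
set D := (block_emb_morphism r (mpart_sum l) @* setT)%G.
have embD b : emb b \in D by apply: mem_morphim; rewrite inE.
have sub_row : row_set mpart_tab [set: gpm r n] \subset D.
  by apply/subsetP => g; rewrite !inE => /rowD[b <-].
have sub_col : col_set mpart_tab [set: gpm r n] \subset D.
  by apply/subsetP => g; rewrite !inE => /colD[b <-].
apply: young_generated_ind => //.
pose injE := block_emb_inj r (mpart_sum l).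
have imT : (invm_morphism injE @* D)%g = [set: blocks] by rewrite im_invm.
have invE b : invm injE (emb b) = b by rewrite invmE ?inE.
apply: (eq_young_generated _ _ _ _ _
  (young_generated_pull _ imT (subsetT _) (subsetT _) young_generated_external)).
- apply/setP => g; rewrite !inE; apply/andP/idP.
    case=> /morphimP[b _ _ ->]; rewrite /= invE => /forallP h.
    rewrite row_pres_emb; apply/forallP => k; have := h k; by rewrite !inE.
  move=> /= pg; have [b e] := rowD _ g pg; rewrite -e in pg *; split=> //.
  rewrite /= invE; apply/forallP => k; rewrite !inE /=.
  by move: pg; rewrite row_pres_emb => /forallP.
- apply/setP => g; rewrite !inE; apply/andP/idP.
    case=> /morphimP[b _ _ ->]; rewrite /= invE => /forallP h.
    rewrite col_pres_emb; apply/forallP => k; have := h k; by rewrite !inE.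
  move=> /= pg; have [b e] := colD _ g pg; rewrite -e in pg *; split=> //.
  rewrite /= invE; apply/forallP => k; rewrite !inE /=.
  by move: pg; rewrite col_pres_emb => /forallP.
- move=> g; rewrite !inE => /andP[/morphimP[b _ _ ->] _] /=.
  by rewrite invE row_char_emb.
- move=> g; rewrite !inE => /andP[/morphimP[b _ _ ->] _] /=.
  by rewrite invE col_char_emb.
exact: (@groupVr _ (col_group mpart_tab [set: gpm r n])).
Qed.

Lemma adapted_mpart : adapted z mpart_tab (tab_lab mpart_tab) [set: gpm r n].
Proof. exact: (adapted_full z_prim mpart_tab_lt). Qed.

Lemma Vlam_irr : mx_irreducible (Vlam z_prim l).
Proof.
exact: (young_generated_irr (young_tableau z_prim adapted_mpart) young_generated_Vlam).1.
Qed.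

Lemma Vlam_type :
  wsum (row_set mpart_tab [set: gpm r n]) (row_char z (tab_lab mpart_tab)) (Vlam z_prim l) *m
  wsum (col_set mpart_tab [set: gpm r n]) (col_char z (tab_lab mpart_tab)) (Vlam z_prim l) != 0.
Proof.
exact: (young_generated_irr (young_tableau z_prim adapted_mpart) young_generated_Vlam).2.
Qed.

End VlamYoung.

(** * Restriction to subgroups and the modules V^mu (x) sigma *)

Section Restriction.

Variables (C : numClosedFieldType) (r : nat) (z : C) (z_prim : r.-primitive_root z).
Variables (N : nat) (t : tableau N) (ch : 'I_N -> nat).

(** Grouping the column sum by underlying permutations, the diagonal parts act on [w] by the
    character that cancels their weight. What remains is a polytabloid that depends on K only
    through a factor. *)
Lemma wsum_col_perm (K : {group gpm r N}) n (W : mx_representation C K n) (w : 'rV_n) :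
    adapted z t ch K ->
    (forall u, u \in K -> gpm_perm u = 1%g -> w *m W u = row_char z ch u *: w) ->
  w *m wsum (col_set t K) (col_char z ch) W =
    #|[set u in K | gpm_perm u == 1%g]|%:R *:
      \sum_(s | col_pres t s) (-1) ^+ odd_perm s *: (w *m W (perm_gpm r s)).
Proof.
move=> ad wT; rewrite wsum.unlock mulmx_sumr.
rewrite (partition_big (@gpm_perm r N) (col_pres t)) /=; last by move=> g; rewrite inE => /andP[].
rewrite scaler_sumr; apply: eq_bigr => s cs.
have Ks : perm_gpm r s \in K by rewrite (adapted_perm ad) ?cs ?orbT.
have lin := col_char_linear z_prim ad.
rewrite (eq_bigr (fun=> (-1) ^+ odd_perm s *: (w *m W (perm_gpm r s)))) => [|g]; last first.
  case/andP=> Cg /eqP gs; have Kg : g \in K by move: Cg; rewrite inE => /andP[].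
  have [u [Ku u1 gE]] : exists u, [/\ u \in K, gpm_perm u = 1%g & g = (u * perm_gpm r s)%g].
    exists (g * (perm_gpm r s)^-1)%g; rewrite mulgKV gpm_permM gs /= mulgV.
    by rewrite groupM ?groupV.
  have Cu : u \in col_group t K by apply: diag_col_group.
  have Cs : perm_gpm r s \in col_group t K by rewrite inE Ks.
  rewrite -scalemxAr gE repr_mxM // mulmxA (wT u) //.
  rewrite -scalemxAl scalerA; congr (_ *: _).
  rewrite invMg (linear_onM lin) ?groupV //.
  have -> : row_char z ch u = col_char z ch u by rewrite /col_char u1 odd_perm1 mul1r.
  rewrite -mulrA [_ * col_char z ch u]mulrC (linear_onV lin) // mulr1 -perm_gpmV.
  by rewrite /col_char row_char_perm mulr1 /= odd_permV.
rewrite sumr_const scaler_nat; congr (_ *+ _).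
rewrite -[RHS](card_imset _ (mulIg (perm_gpm r s))); apply: eq_card => g.
rewrite -topredE /= inE; apply/andP/imsetP => [[/andP[Kg cg] /eqP gs]|[u]].
  exists (g * (perm_gpm r s)^-1)%g; last by rewrite mulgKV.
  by rewrite inE groupM ?groupV // gpm_permM gs /= mulgV.
rewrite inE => /andP[Ku /eqP u1] ->; rewrite groupM // gpm_permM u1 mul1g /=.
by rewrite cs.
Qed.

(** The polytabloids of K and K' are proportional by [wsum_col_perm]. An element of K is a diagonal
    matrix, acting on the polytabloid by a scalar, times a permutation matrix in K'; so the
    translates by K' already span. *)
Lemma young_generated_res (K K' : {group gpm r N}) (sKK : K' \subset K)
    (W : representation C K) :
    adapted z t ch K -> adapted z t ch K' ->
    (forall x, x \in K -> perm_gpm r (gpm_perm x) \in K') ->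
    young_generated (row_set t K) (col_set t K) (row_char z ch) (col_char z ch) W ->
  young_generated (row_set t K') (col_set t K') (row_char z ch) (col_char z ch)
    (res_repr sKK W).
Proof.
move=> ad ad' KK' [w [wP n0 gen]]; exists w; split=> //.
  by move=> g; rewrite inE => /andP[K'g rg]; rewrite wP // inE (subsetP sKK).
have wT u : u \in K -> gpm_perm u = 1%g -> w *m W u = row_char z ch u *: w.
  by move=> Ku u1; apply: wP; apply: diag_row_group.
have wT' u : u \in K' -> gpm_perm u = 1%g ->
    w *m res_repr sKK W u = row_char z ch u *: w.
  by move=> Ku; apply: wT; apply: (subsetP sKK).
rewrite (wsum_col_perm ad' wT'); apply: generatesZ.
  rewrite pnatr_eq0 -lt0n; apply/card_gt0P; exists 1%g.
  by rewrite inE group1 /=.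
set v := \sum_(s | _) _; move=> M vM; apply: gen => x Kx.
have [d [Kd d1 xE]] : exists d, [/\ d \in K, gpm_perm d = 1%g &
    x = (d * perm_gpm r (gpm_perm x))%g].
  exists (x * (perm_gpm r (gpm_perm x))^-1)%g; rewrite mulgKV gpm_permM /= mulgV.
  by rewrite groupM ?groupV ?(adapted_proj ad).
have Cd : d \in col_group t K by apply: diag_col_group.
have yt := young_tableau z_prim ad.
rewrite xE repr_mxM ?(adapted_proj ad) // mulmxA -(mulmxA w) (wsum_mulr (young_sub2 yt) (young_lin2 yt)) //.
rewrite -scalemxAr (wsum_col_perm ad wT) -/v -!scalemxAl vM ?scaler0 //.
exact: KK'.
Qed.

End Restriction.

Section LastRepr.

Variables (C : numClosedFieldType) (r : nat) (z : C) (z_prim : r.-primitive_root z).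
Variables (n : nat) (l : mpart r n) (k : nat).

Notation t := (mpart_tab l).
Notation et := (ext_tab (@mpart_tab_lt r n l)).
Notation ec := (ext_charge t k).
Notation L1 := (last_emb_morphism r n @* setT)%G.

Lemma row_pres_last (x : gpm r n * Zmod r) :
  row_pres et (gpm_perm (last_emb x)) = row_pres t (gpm_perm x.1).
Proof.
apply/row_presP/row_presP => h y.
  have := h (lift ord_max y); rewrite /= lift_perm_lift !ext_fun_lift. done.
case: (unliftP ord_max y) => [i|] ->; rewrite /= ?lift_perm_lift ?lift_perm_id //.
by rewrite !ext_fun_lift; apply: h.
Qed.

Lemma col_pres_last (x : gpm r n * Zmod r) :
  col_pres et (gpm_perm (last_emb x)) = col_pres t (gpm_perm x.1).
Proof.
apply/col_presP/col_presP => h y.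
  have := h (lift ord_max y); rewrite /= lift_perm_lift !ext_fun_lift. done.
case: (unliftP ord_max y) => [i|] ->; rewrite /= ?lift_perm_lift ?lift_perm_id //.
by rewrite !ext_fun_lift; apply: h.
Qed.

Lemma row_char_last (x : gpm r n * Zmod r) :
  row_char z ec (last_emb x) = z ^+ (x.2 * k) * row_char z (tab_lab t) x.1.
Proof.
rewrite /row_char (bigD1_ord ord_max) //=; congr (_ * _).
  by rewrite ffunE unlift_none /= /ext_charge ext_fun_max.
by apply: eq_bigr => i _; rewrite ffunE liftK /ext_charge ext_fun_lift.
Qed.

Lemma col_char_last (x : gpm r n * Zmod r) :
  col_char z ec (last_emb x) = z ^+ (x.2 * k) * col_char z (tab_lab t) x.1.
Proof.
rewrite /col_char row_char_last mulrCA; congr (_ * (_ * _)).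
by rewrite /= odd_lift_perm addbb.
Qed.

Lemma young_generated_last :
  young_generated (row_set et L1) (col_set et L1) (row_char z ec) (col_char z ec)
    (last_repr z_prim l k).
Proof.
have yV := young_generated_Vlam z_prim l.
pose injE := last_emb_inj r n.
have imT : (invm_morphism injE @* L1)%g = [set: gpm r n * Zmod r] by rewrite im_invm.
have invE b : invm injE (last_emb b) = b by rewrite invmE ?inE.
have fstT : (fst_morphism (gpm r n) (Zmod r) @* [set: gpm r n * Zmod r])%g = [set: gpm r n].
  apply/eqP; rewrite eqEsubset subsetT; apply/subsetP => s _.
  by apply/morphimP; exists (s, 0); rewrite ?inE.
apply: (eq_young_generated _ _ _ _ _
  (young_generated_pull _ imT (subsetT _) (subsetT _)
   (young_generated_twist _ _ (subsetT _) (subsetT _)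
   (young_generated_pull _ fstT (subsetT _) (subsetT _) yV)))).
- apply/setP => g; rewrite !inE; apply/andP/andP => [][/morphimP[b _ _ ->]];
    rewrite /= invE row_pres_last; split=> //; exact: mem_morphim.
- apply/setP => g; rewrite !inE; apply/andP/andP => [][/morphimP[b _ _ ->]];
    rewrite /= invE col_pres_last; split=> //; exact: mem_morphim.
- move=> g; rewrite !inE => /andP[/morphimP[b _ _ ->] _] /=.
  by rewrite invE row_char_last.
- move=> g; rewrite !inE => /andP[/morphimP[b _ _ ->] _] /=.
  by rewrite invE col_char_last.
exact: (@groupVr _ (col_group et L1)).
Qed.

Lemma adapted_ext : adapted z et ec L1.
Proof. exact: (adapted_last z_prim k (@mpart_tab_lt r n l)). Qed.

Lemma adapted_extL p : adapted z et ec (Lrp r n p).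
Proof. exact: (adapted_Lrp z_prim k (@mpart_tab_lt r n l)). Qed.

Lemma last_irr : mx_irreducible (last_repr z_prim l k).
Proof. exact: (young_generated_irr (young_tableau z_prim adapted_ext) young_generated_last).1. Qed.

Lemma last_type :
  wsum (row_set et L1) (row_char z ec) (last_repr z_prim l k) *m
  wsum (col_set et L1) (col_char z ec) (last_repr z_prim l k) != 0.
Proof. exact: (young_generated_irr (young_tableau z_prim adapted_ext) young_generated_last).2. Qed.

(** L(r,p,n+1) contains all permutation matrices that fix the last coordinate, so
    [young_generated_res] applies; irreducibility over L(r,p,n+1) follows. *)
Lemma lastL_young p : young_generated (row_set et (Lrp r n p)) (col_set et (Lrp r n p))
  (row_char z ec) (col_char z ec) (res_repr (Lrp_sub_last r n p) (last_repr z_prim l k)).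
Proof.
apply: (young_generated_res z_prim _ adapted_ext (adapted_extL p) _ young_generated_last).
move=> x; rewrite (in_last z_prim) in_Lrp => ->; rewrite andbT inE.
by rewrite /gpm_deg big1 ?mul0rn // => i _; rewrite ffunE.
Qed.

Lemma lastL_irr p :
  mx_irreducible (res_repr (Lrp_sub_last r n p) (last_repr z_prim l k)).
Proof.
exact: (young_generated_irr (young_tableau z_prim (adapted_extL p)) (lastL_young p)).1.
Qed.

Lemma lastL_type p (W := res_repr (Lrp_sub_last r n p) (last_repr z_prim l k)) :
  wsum (row_set et (Lrp r n p)) (row_char z ec) W *m
  wsum (col_set et (Lrp r n p)) (col_char z ec) W != 0.
Proof.
exact: (young_generated_irr (young_tableau z_prim (adapted_extL p)) (lastL_young p)).2.
Qed.

End LastRepr.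

(** * Isomorphisms of modules with given tableaux *)

Section Types.

Variables (C : numClosedFieldType) (r : nat) (z : C) (z_prim : r.-primitive_root z).

(** For adapted data at most one irreducible module, up to isomorphism, has a given type, by
    [has_type_embeds]. *)
Definition has_type N (K : {group gpm r N}) (t : tableau N) (ch : 'I_N -> nat)
    n (W : mx_representation C K n) :=
  wsum (row_set t K) (row_char z ch) W *m wsum (col_set t K) (col_char z ch) W != 0.

Lemma embeds_has_type N (K : {group gpm r N}) t ch n1 n2
    (U : mx_representation C K n1) (W : mx_representation C K n2) :
  adapted z t ch K -> embeds U W -> has_type t ch U -> has_type t ch W.
Proof.
move=> ad [f ff hf]; have yt := young_tableau z_prim ad.
apply: contraNN => /eqP W0; apply/eqP; apply: (row_free_inj ff).
rewrite mul0mx -mulmxA (intertwines_wsum _ (young_sub2 yt) hf) mulmxA.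
by rewrite (intertwines_wsum _ (young_sub1 yt) hf) -mulmxA W0 mulmx0.
Qed.

Lemma has_type_embeds N (K : {group gpm r N}) t ch n1 n2
    (U : mx_representation C K n1) (W : mx_representation C K n2) :
  adapted z t ch K -> mx_irreducible U -> has_type t ch U -> has_type t ch W ->
  embeds U W.
Proof. by move=> ad; apply: (young_embeds (young_tableau z_prim ad)). Qed.

Lemma eq_has_type N (K : {group gpm r N}) t t' ch ch' n (W : mx_representation C K n) :
    row_set t K = row_set t' K -> col_set t K = col_set t' K ->
    {in K, row_char z ch =1 row_char z ch'} ->
  has_type t ch W = has_type t' ch' W.
Proof.
move=> er ec e; rewrite /has_type er ec; congr (_ *m _ != 0).
  rewrite !wsum.unlock; apply: eq_bigr => g; rewrite inE => /andP[Kg _].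
  by rewrite e ?groupV.
rewrite !wsum.unlock; apply: eq_bigr => g; rewrite inE => /andP[Kg _].
by rewrite /col_char e ?groupV.
Qed.

(** Conjugation by the permutation matrix of s carries the groups of t to those of t'; [th] renames
    the labels. *)
Lemma has_type_relabel N (K : {group gpm r N}) t t' (th : nat -> nat) ch
    (s : 'S_N) n (W : mx_representation C K n) :
    perm_gpm r s \in K ->
    (forall x, [/\ tab_lab t' (s x) = th (tab_lab t x), tab_row t' (s x) = tab_row t x &
      tab_col t' (s x) = tab_col t x]) ->
    (forall x y, th (tab_lab t x) = th (tab_lab t y) -> tab_lab t x = tab_lab t y) ->
  has_type t' ch W = has_type t (fun x => ch (s x)) W.
Proof.
move=> Ks sE th_inj; set y := perm_gpm r s.
have rowJ g : row_pres t' (gpm_perm (g ^ y)%g) = row_pres t (gpm_perm g).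
  have yE x : gpm_perm (g ^ y)%g (s x) = s (gpm_perm g x).
    by rewrite conjgE !gpm_permM !permM /= permK.
  apply/row_presP/row_presP => h x.
    have := h (s x); rewrite yE; have [-> -> _] := sE (gpm_perm g x).
    by have [-> -> _] := sE x; case=> /th_inj.
  rewrite -[x](permKV s); set u := (s^-1%g x); rewrite yE.
  have [-> -> _] := sE (gpm_perm g u); have [-> -> _] := sE u.
  by have [-> ->] := h u.
have colJ g : col_pres t' (gpm_perm (g ^ y)%g) = col_pres t (gpm_perm g).
  have yE x : gpm_perm (g ^ y)%g (s x) = s (gpm_perm g x).
    by rewrite conjgE !gpm_permM !permM /= permK.
  apply/col_presP/col_presP => h x.
    have := h (s x); rewrite yE; have [-> _ ->] := sE (gpm_perm g x).
    by have [-> _ ->] := sE x; case=> /th_inj.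
  rewrite -[x](permKV s); set u := (s^-1%g x); rewrite yE.
  have [-> _ ->] := sE (gpm_perm g u); have [-> _ ->] := sE u.
  by have [-> ->] := h u.
have charJ g : row_char z ch (g ^ y)%g = row_char z (fun x => ch (s x)) g.
  rewrite /row_char (reindex_inj (@perm_inj _ s)); apply: eq_bigr => x _.
  have y0 i : gpm_exp y i = 0 by rewrite ffunE.
  have yV0 i : gpm_exp y^-1%g i = 0 by rewrite /y -perm_gpmV ffunE.
  by rewrite conjgE !gpm_expM y0 yV0 addr0 add0r /= permK.
have signJ g : (-1) ^+ odd_perm (gpm_perm (g ^ y)%g) = (-1) ^+ odd_perm (gpm_perm g) :> C.
  by rewrite conjgE !gpm_permM /= !odd_permM odd_permV addbCA addbb addbF.
have wsumJ (S S' : {set gpm r N}) (f f' : gpm r N -> C) : S \subset K ->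
    (forall g, ((g ^ y)%g \in S') = (g \in S)) -> (forall g, f' (g ^ y)%g = f g) ->
    wsum S' f' W = W y^-1%g *m wsum S f W *m W y.
  move=> SK SE fE; rewrite !wsum.unlock (reindex_inj (conjg_inj y)) /=.
  rewrite mulmx_sumr mulmx_suml; apply: eq_big => [g|g Sg]; first exact: SE.
  have Kg : g \in K by apply: (subsetP SK); rewrite -SE.
  have Kyg : (y^-1 * g)%g \in K by rewrite groupM ?groupV.
  by rewrite -conjVg fE -scalemxAr -scalemxAl -!repr_mxM ?groupV // conjgE mulgA.
have KJ g : ((g ^ y)%g \in K) = (g \in K) by rewrite memJ_norm // (subsetP (normG K)).
have rE : wsum (row_set t' K) (row_char z ch) W = W y^-1%g *m
    wsum (row_set t K) (row_char z (fun x => ch (s x))) W *m W y.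
  apply: wsumJ => // [|g]; last by rewrite !inE KJ rowJ.
  by apply/subsetP => g; rewrite inE => /andP[].
have cE : wsum (col_set t' K) (col_char z ch) W = W y^-1%g *m
    wsum (col_set t K) (col_char z (fun x => ch (s x))) W *m W y.
  apply: wsumJ => // [|g|g]; last by rewrite /col_char signJ charJ.
    by apply/subsetP => g; rewrite inE => /andP[].
  by rewrite !inE KJ colJ.
rewrite /has_type rE cE.
set A := wsum _ _ _; set B := wsum _ _ _.
have -> : W y^-1%g *m A *m W y *m (W y^-1%g *m B *m W y) =
    W y^-1%g *m (A *m B) *m W y by rewrite !mulmxA repr_mxK.
congr (~~ _); apply/eqP/eqP => [|->]; last by rewrite mulmx0 mul0mx.
move/(congr1 (fun M => W y *m M *m W y^-1%g)); rewrite !mulmxA repr_mxK // mulmx0 mul0mx.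
by rewrite -repr_mxM ?groupV // mulgV repr_mx1 mul1mx.
Qed.

Lemma relabel_perm N (t t' : tableau N) (th : nat -> nat) :
    (forall x y, th (tab_lab t x) = th (tab_lab t y) -> tab_lab t x = tab_lab t y) ->
    (forall x, exists y, [/\ tab_lab t' y = th (tab_lab t x), tab_row t' y = tab_row t x &
      tab_col t' y = tab_col t x]) ->
  exists s : 'S_N, forall x, [/\ tab_lab t' (s x) = th (tab_lab t x),
    tab_row t' (s x) = tab_row t x & tab_col t' (s x) = tab_col t x].
Proof.
move=> th_inj /choice[f fE]; have f_inj : injective f.
  move=> x y e; have [lx rx cx] := fE x; have [ly ry cy] := fE y.
  apply: (@tab_inj _ t); [apply: th_inj|..]; congruence.
by exists (perm f_inj) => x; rewrite permE.
Qed.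

End Types.

(** * Column lengths, and nonisomorphic modules over L(r,p,n+1) *)

Section Columns.

Local Open Scope nat_scope.

(** The number of parts equal to v+1 is the difference of two consecutive column lengths. *)
Lemma part_eq s s' : is_part s -> is_part s' ->
  (forall j, count (fun v => j < v) s = count (fun v => j < v) s') -> s = s'.
Proof.
case/andP=> so nz /andP[so' nz'] e.
have split v (u : seq nat) : count (fun w => v < w) u = count_mem v.+1 u + count (fun w => v.+1 < w) u.
  rewrite -count_predUI [X in _ + X](@eq_count _ _ pred0) ?count_pred0 ?addn0.
    by apply: eq_count => w /=; rewrite leq_eqVlt eq_sym.
  by move=> w /=; case: eqP => // ->; rewrite ltnn.
apply: (@sorted_eq _ geq) => //.
- by move=> a b c /= ba cb; apply: leq_trans cb ba.
- by move=> a b /andP[/= h1 h2]; apply/eqP; rewrite eqn_leq h1 h2.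
apply/allP => -[|v] _ /=; first by rewrite (count_memPn nz) (count_memPn nz').
by apply/eqP; have := e v; rewrite (split v s) (split v s') e => /addIn.
Qed.

Variable r n : nat.

Lemma mpart_column (l : mpart r n) (k : 'I_r) j :
  #|[set x | (tab_lab (mpart_tab l) x == k) && (tab_col (mpart_tab l) x == j)]| =
  count (fun v => j < v) (tnth l k).
Proof.
set t := mpart_tab l; set s := tnth l k; set A := [set x | _].
have inA x : x \in A -> tab_lab t x = k /\ tab_col t x = j.
  by rewrite inE => /andP[/eqP-> /eqP->].
rewrite cardE -(size_map (tab_row t)).
have -> : count (fun v => j < v) s = size [seq i <- iota 0 (size s) | j < nth 0 s i].
  rewrite size_filter -[in LHS](mkseq_nth 0 s) /mkseq count_map. by [].
apply: perm_size; apply: uniq_perm.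
- rewrite map_inj_in_uniq ?enum_uniq // => x y; rewrite !mem_enum => /inA[lx cx] /inA[ly cy].
  by move=> e; apply: (@tab_inj _ t); congruence.
- by rewrite filter_uniq ?iota_uniq.
move=> i; rewrite mem_filter mem_iota /=; apply/mapP/andP => [[x]|[lt_j lt_i]].
  rewrite mem_enum => /inA[lx cx] ->.
  have kx : tag (block_sig (mpart_sum l) x) = k by apply: val_inj.
  have h1 : tab_row t x < size (tnth l (tag (block_sig (mpart_sum l) x))) :=
    reshape_indexP (ltn_ord (tagged (block_sig (mpart_sum l) x))).
  have h2 : tab_col t x < nth 0 (tnth l (tag (block_sig (mpart_sum l) x))) (tab_row t x) :=
    reshape_offsetP (ltn_ord (tagged (block_sig (mpart_sum l) x))).
  by rewrite kx in h1 h2; rewrite cx in h2; split.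
have [x [lx rx cx]] := mpart_box lt_j.
exists x; last by [].
rewrite mem_enum inE -[tab_col _ _]/(reshape_offset _ _) cx eqxx andbT.
by rewrite /t /= lx.
Qed.

Lemma count_lt_eq N (t t' : tableau N) k k' :
  (forall j, #|[set x | (tab_lab t x == k) && (tab_col t x < j)]| =
    #|[set x | (tab_lab t' x == k') && (tab_col t' x < j)]|) ->
  forall j, #|[set x | (tab_lab t x == k) && (tab_col t x == j)]| =
    #|[set x | (tab_lab t' x == k') && (tab_col t' x == j)]|.
Proof.
have split (u : tableau N) a j : #|[set x | (tab_lab u x == a) && (tab_col u x < j.+1)]| =
    #|[set x | (tab_lab u x == a) && (tab_col u x < j)]| +
    #|[set x | (tab_lab u x == a) && (tab_col u x == j)]|.
  rewrite -(cardsID [set x | tab_col u x < j]); congr (_ + _); apply: eq_card => x.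
    by rewrite !inE -andbA; congr (_ && _); apply: andb_idl => /ltnW.
  by rewrite !inE -leqNgt andbCA; congr (_ && _); rewrite ltnS andbC -eqn_leq.
by move=> e j; have := e j.+1; rewrite !split e => /addnI.
Qed.

End Columns.

Section Distinct.

Variables (C : numClosedFieldType) (r : nat) (z : C) (z_prim : r.-primitive_root z).
Let r_gt0 := prim_order_gt0 z_prim.

Lemma ext_column n (l : mpart r n) k j : (k < r)%N ->
  #|[set x | (tab_lab (ext_tab (@mpart_tab_lt r n l)) x == k) &&
     (tab_col (ext_tab (@mpart_tab_lt r n l)) x == j)]| =
  count (fun v => (j < v)%N) (nth [::] l k).
Proof.
move=> lt_k; have -> : nth [::] l k = tnth l (Ordinal lt_k) by rewrite (tnth_nth [::]).
rewrite -mpart_column -[RHS](card_imset _ (@lift_inj _ ord_max)); apply: eq_card => x.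
rewrite inE; case: (unliftP ord_max x) => [i|] ->.
  by rewrite /= !ext_fun_lift mem_imset ?inE //; apply: lift_inj.
rewrite /= !ext_fun_max (gtn_eqF lt_k) /=; apply/esym/imsetP => -[i _ e].
by have := neq_lift ord_max i; rewrite -e eqxx.
Qed.

(** On the diagonal matrices of L(r,p,n+1) one sees k modulo r/p and the other charges relative to
    k. *)
Lemma last_compare n p (l l' : mpart r n) k k' (p_dvd_r : (p %| r)%N)
    (W := res_repr (Lrp_sub_last r n p) (last_repr z_prim l k))
    (W' := res_repr (Lrp_sub_last r n p) (last_repr z_prim l' k')) :
    mx_rsim W W' -> exists s : 'S_n.+1,
  [/\ s ord_max = ord_max,
    (p * k = p * k' %[mod r])%N,
    forall i j, s (lift ord_max i) = lift ord_max j ->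
      (tab_lab (mpart_tab l') j + k = tab_lab (mpart_tab l) i + k' %[mod r])%N &
    forall x y, tab_lab (ext_tab (@mpart_tab_lt r n l)) x = tab_lab (ext_tab (@mpart_tab_lt r n l)) y ->
      tab_row (ext_tab (@mpart_tab_lt r n l)) x = tab_row (ext_tab (@mpart_tab_lt r n l)) y ->
      tab_lab (ext_tab (@mpart_tab_lt r n l')) (s x) = tab_lab (ext_tab (@mpart_tab_lt r n l')) (s y) ->
      tab_col (ext_tab (@mpart_tab_lt r n l')) (s x) = tab_col (ext_tab (@mpart_tab_lt r n l')) (s y) ->
      x = y].
Proof.
move=> sim; have ad := adapted_extL z_prim l k p; have ad' := adapted_extL z_prim l' k' p.
have irr := lastL_irr z_prim l k p.
have ty := lastL_type z_prim l k p.
have ty' : has_type z (ext_tab (@mpart_tab_lt r n l')) (ext_charge (mpart_tab l') k') W.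
  apply: (embeds_has_type z_prim ad' (rsim_embeds (mx_rsim_sym sim))).
  exact: lastL_type.
have A0 : wsum (row_group (ext_tab (@mpart_tab_lt r n l)) (Lrp r n p))
    (row_char z (ext_charge (mpart_tab l) k)) W != 0.
  by apply: contraNneq ty => /= ->; rewrite mul0mx.
have B0 : wsum (col_group (ext_tab (@mpart_tab_lt r n l')) (Lrp r n p))
    (col_char z (ext_charge (mpart_tab l') k')) W != 0.
  by apply: contraNneq ty' => /= ->; rewrite mulmx0.
have [s [Ks sT sep]] := young_types_compare z_prim ad ad' irr A0 B0.
have fs : s ord_max = ord_max by move: Ks; rewrite in_Lrp => /andP[_ /eqP].
exists s; split=> //.
(* diag(1,...,1,zeta^p) lies in L(r,p,n+1) and sees only the charge of the last point. *)
- pose u : gpm r n.+1 := diag_gpm (fun i => if i == ord_max then inZp p else 0).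
  have uL : u \in Lrp r n p.
    rewrite in_Lrp perm1 eqxx andbT inE /gpm_deg.
    under eq_bigr do rewrite ffunE.
    rewrite (bigD1 ord_max) //= eqxx big1 => [|i /negPf->//].
    rewrite addr0 Zp_mulrn; apply/eqP/val_inj => /=.
    by rewrite (prednK r_gt0) modnMml mulnC divnK // modnn.
  have := sT u uL erefl.
  rewrite /row_char !(prod_single z_prim) /ext_charge fs !ext_fun_max => /eqP.
  by rewrite (eq_prim_root_expr z_prim) => /eqP.
move=> i j sij; pose y := lift ord_max i : 'I_n.+1.
have ny : y != ord_max by rewrite eq_sym neq_lift.
(* A balanced matrix sees the difference between the charge of y and that of the last point. *)
have := sT _ (balanced_Lrp z_prim p ny) erefl.
rewrite /row_char !(prod_balanced z_prim) // fs sij /ext_charge !ext_fun_max !ext_fun_lift => /eqP.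
rewrite (eq_prim_root_expr z_prim) -(eqn_modDr (k + k')) => e.
have e1 a b c : (a + r.-1 * b + (b + c) = b * r + (a + c))%N.
  by rewrite -{2}(prednK r_gt0) mulnS mulnC; lia.
by move: e; rewrite e1 [(k + k')%N]addnC e1 !modnMDl => /eqP.
Qed.

(** All labels shift by k' - k. Comparing the modules in both directions gives opposite inequalities
    between the column lengths of corresponding components. *)
Lemma last_shift n p (l l' : mpart r n) k k' (p_dvd_r : (p %| r)%N) (p_gt0 : (0 < p)%N) :
    (k < r)%N -> (k' < r)%N ->
    mx_rsim (res_repr (Lrp_sub_last r n p) (last_repr z_prim l k))
      (res_repr (Lrp_sub_last r n p) (last_repr z_prim l' k')) ->
  exists c, [/\ (r %/ p %| c)%N, k' = ((k + c) %% r)%N &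
    forall j, (j < r)%N -> nth [::] l' ((j + c) %% r) = nth [::] l j].
Proof.
move=> lt_k lt_k' sim.
have [s [fs pk labs sep]] := last_compare p_dvd_r sim.
have [s' [fs' _ labs' sep']] := last_compare p_dvd_r (mx_rsim_sym sim).
set t := ext_tab (@mpart_tab_lt r n l) in sep sep'.
set t' := ext_tab (@mpart_tab_lt r n l') in sep sep'.
have lift_img (u : 'S_n.+1) i : u ord_max = ord_max -> exists j, u (lift ord_max i) = lift ord_max j.
  move=> fu; case: (unliftP ord_max (u (lift ord_max i))) => [j ->|e]; first by exists j.
  have /perm_inj e' : u (lift ord_max i) = u ord_max by rewrite e fu.
  by have := neq_lift ord_max i; rewrite e' eqxx.
(* This is k' - k modulo r, without truncated subtraction. *)
pose c := (k' + (r - k))%N; exists c.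
have rE : ((r %/ p) * p)%N = r by rewrite divnK.
split.
- move: pk; rewrite -{1 2}rE [(r %/ p * p)%N]mulnC -!muln_modr => /eqP.
  rewrite eqn_pmul2l // => /eqP pk.
  rewrite /dvdn -[X in _ == X](mod0n (r %/ p)) -(eqn_modDr k) add0n.
  have -> : (c + k = p * (r %/ p) + k')%N by rewrite /c mulnC rE; lia.
  by rewrite modnMDl pk.
- by rewrite /c; have -> : (k + (k' + (r - k)) = k' + r)%N by [lia]; rewrite modnDr modn_small.
move=> j lt_j; set j' := ((j + c) %% r)%N.
have lt_j' : (j' < r)%N by rewrite ltn_mod.
have shift a b : (a < r)%N -> (b < r)%N -> (b + k = a + k' %[mod r])%N -> (b == j') = (a == j).
  move=> lt_a lt_b e; rewrite /j' -{1}(modn_small lt_b) -(eqn_modDr k) e.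
  have -> : (j + c + k = j + k' + r)%N by rewrite /c; lia.
  by rewrite modnDr eqn_modDr !modn_small.
have labE x : (tab_lab t' (s x) == j') = (tab_lab t x == j).
  case: (unliftP ord_max x) => [i|] ->; last first.
    by rewrite fs /= !ext_fun_max !gtn_eqF.
  have [i' si] := lift_img s i fs; rewrite si /= !ext_fun_lift.
  by apply: shift; rewrite ?ltn_ord //; apply: labs.
have labE' x : (tab_lab t (s' x) == j) = (tab_lab t' x == j').
  case: (unliftP ord_max x) => [i|] ->; last first.
    by rewrite fs' /= !ext_fun_max !gtn_eqF.
  have [i' si] := lift_img s' i fs'; rewrite si /= !ext_fun_lift.
  by apply/esym/shift; rewrite ?ltn_ord //; apply/esym/labs'.
apply: part_eq.
- by have := mpart_part l' (Ordinal lt_j'); rewrite (tnth_nth [::]).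
- by have := mpart_part l (Ordinal lt_j); rewrite (tnth_nth [::]).
move=> a; rewrite -!ext_column //; apply: count_lt_eq => {}a.
apply/eqP; rewrite eqn_leq; apply/andP; split.
  apply: (count_label_le labE) => x y lxy rxy lx; apply: sep => //.
  by apply/eqP; have := labE x; rewrite lx eqxx => /eqP ->; rewrite eq_sym labE -lxy lx.
apply: (count_label_le labE') => x y lxy rxy lx; apply: sep' => //.
by apply/eqP; have := labE' x; rewrite lx eqxx => /eqP ->; rewrite eq_sym labE' -lxy lx.
Qed.

End Distinct.

Lemma embeds_irr_rsim (C : numClosedFieldType) (gT : finGroupType) (G : {group gT}) n1 n2
    (U : mx_representation C G n1) (W : mx_representation C G n2) :
  mx_irreducible U -> mx_irreducible W -> embeds U W -> mx_rsim U W.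
Proof.
move=> iU iW [f ff hf]; apply: irr_intertwines_rsim hf _ => //.
have [n_gt0 _] := (mx_irrP _).1 iU; rewrite -mxrank_eq0.
by move: ff; rewrite /row_free => /eqP->; rewrite -lt0n.
Qed.

(** * Rotations of tuples of diagrams and the isomorphisms that they give *)

Section Boxes.

Variables (r n : nat).
Hypothesis r_gt0 : (0 < r)%N.

Lemma mpart_eqP (l l' : mpart r n) :
  (forall j, (j < r)%N -> nth [::] l j = nth [::] l' j) -> l = l'.
Proof.
move=> e; apply/val_inj/eq_from_tnth => k.
by rewrite !(tnth_nth [::]) e.
Qed.

Lemma tab_col_lt (l : mpart r n) x :
  (tab_col (mpart_tab l) x <
   nth 0%N (nth [::] l (tab_lab (mpart_tab l) x)) (tab_row (mpart_tab l) x))%N.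
Proof.
rewrite -(tnth_nth [::]).
exact: reshape_offsetP (ltn_ord (tagged (block_sig (mpart_sum l) x))).
Qed.

Lemma tab_box (l : mpart r n) k i j : (k < r)%N -> (j < nth 0%N (nth [::] l k) i)%N ->
  exists x, [/\ tab_lab (mpart_tab l) x = k, tab_row (mpart_tab l) x = i &
    tab_col (mpart_tab l) x = j].
Proof.
move=> lt_k; have -> : nth [::] l k = tnth l (Ordinal lt_k) by rewrite (tnth_nth [::]).
move=> /mpart_box[x [lx rx cx]]; exists x; split=> //.
by rewrite /= lx.
Qed.

Definition rotated c (l l' : mpart r n) :=
  forall j, (j < r)%N -> nth [::] l' ((j + c) %% r) = nth [::] l j.

Lemma rotated_box c l l' : rotated c l l' ->
  forall x, exists y, [/\ tab_lab (mpart_tab l') y = ((tab_lab (mpart_tab l) x + c) %% r)%N,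
    tab_row (mpart_tab l') y = tab_row (mpart_tab l) x &
    tab_col (mpart_tab l') y = tab_col (mpart_tab l) x].
Proof.
move=> rot x; apply: tab_box; first by rewrite ltn_mod.
by rewrite rot ?tab_col_lt // mpart_tab_lt.
Qed.

Lemma rotatedX c l i : rotated c l l -> rotated (c * i) l l.
Proof.
move=> rot; elim: i => [|i IHi] j lt_j; first by rewrite muln0 addn0 modn_small.
by rewrite mulnS addnCA addnC -modnDml rot ?ltn_mod // IHi.
Qed.

Lemma mod_add_inj c a b : (a < r)%N -> (b < r)%N -> ((a + c) %% r = (b + c) %% r)%N -> a = b.
Proof. by move=> ha hb /eqP; rewrite eqn_modDr !modn_small // => /eqP. Qed.

Definition covers k a (m : mpart r n) (l : mpart r n.+1) :=
  forall k' a', (k' < r)%N -> nth 0%N (nth [::] l k') a' =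
    (nth 0%N (nth [::] m k') a' + ((k' == k) && (a' == a)))%N.

End Boxes.

Section Isomorphisms.

Variables (C : numClosedFieldType) (r : nat) (z : C) (z_prim : r.-primitive_root z).
Let r_gt0 := prim_order_gt0 z_prim.

Lemma row_char_shift N (ch ch' : 'I_N -> nat) c (g : gpm r N) :
    (forall x, ch' x = ch x + c %[mod r])%N ->
  row_char z ch' g = row_char z ch g * delta0 z g ^+ c.
Proof.
move=> e; rewrite (delta0_prod z_prim) /row_char -big_split; apply: eq_bigr => x _ /=.
rewrite -exprD -mulnDr; apply/eqP; rewrite (eq_prim_root_expr z_prim).
by rewrite -modnMmr e modnMmr.
Qed.

(** The factor [r.-1] stands for -1 modulo r. *)
Lemma delta0VX n (g : gpm r n) c : delta0 z g^-1%g ^+ (c * r.-1) = delta0 z g ^+ c.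
Proof.
have dV : delta0 z g^-1%g * delta0 z g = 1 by rewrite -(delta0M z_prim) mulVg delta01.
rewrite -[LHS]mulr1 -[X in _ * X](expr1n _ c) -dV exprMn mulrA -exprD.
have -> : (c * r.-1 + c = r * c)%N by rewrite -{2}(prednK r_gt0) mulSn mulnC addnC.
by rewrite exprM /delta0 [_ ^+ _ ^+ r]exprAC (prim_expr_order z_prim) !expr1n mul1r.
Qed.

(** For p = 1 the shift in [last_shift] is a multiple of r, hence trivial. *)
Lemma last_rsim_eq n (l l' : mpart r n) k k' : (k < r)%N -> (k' < r)%N ->
  mx_rsim (last_repr z_prim l k) (last_repr z_prim l' k') -> k = k' /\ l = l'.
Proof.
move=> lt_k lt_k' [f ef ff hf].
have sim : mx_rsim (res_repr (Lrp_sub_last r n 1) (last_repr z_prim l k))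
    (res_repr (Lrp_sub_last r n 1) (last_repr z_prim l' k')).
  by exists f => // g Lg; apply: hf; apply: (subsetP (Lrp_sub_last r n 1)).
have [c [/dvdnP[q qE] kE e]] := last_shift (dvd1n r) isT lt_k lt_k' sim.
rewrite divn1 in qE; rewrite qE in kE e.
split; first by rewrite kE addnC modnMDl modn_small.
by apply: mpart_eqP => j lt_j; rewrite -e // addnC modnMDl modn_small.
Qed.

Lemma Vlam_rsim_eq n (l l' : mpart r n) : mx_rsim (Vlam z_prim l) (Vlam z_prim l') -> l = l'.
Proof.
move=> [f ef ff hf].
suff sim : mx_rsim (last_repr z_prim l 0) (last_repr z_prim l' 0).
  exact: (last_rsim_eq r_gt0 r_gt0 sim).2.
exists f => // g L1g /=.
by rewrite -scalemxAl -scalemxAr hf // inE.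
Qed.

(** The rotation relabels the tableau and adds c to every charge. This multiplies the characters by
    delta0^c, which is trivial on G(r,p,n+1) because r/p divides c. *)
Lemma lastL_rotated n p (l l' : mpart r n) k k' c (p_dvd_r : (p %| r)%N) :
    (k < r)%N -> (r %/ p %| c)%N -> rotated c l l' -> k' = ((k + c) %% r)%N ->
  mx_rsim (res_repr (Lrp_sub_last r n p) (last_repr z_prim l k))
      (res_repr (Lrp_sub_last r n p) (last_repr z_prim l' k')).
Proof.
move=> lt_k /dvdnP[q qE] rot kE; apply: embeds_irr_rsim; [exact: lastL_irr..|].
set t := mpart_tab l; set t' := mpart_tab l'.
set et := ext_tab (@mpart_tab_lt r n l); set et' := ext_tab (@mpart_tab_lt r n l').
apply: (has_type_embeds z_prim (adapted_extL z_prim l k p)); [exact: lastL_irr|exact: lastL_type|].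
have ty' : has_type z et' (ext_charge t' k') (res_repr (Lrp_sub_last r n p) (last_repr z_prim l' k')).
  exact: lastL_type.
have [s0 s0E] : exists s0 : 'S_n, forall x, [/\ tab_lab t' (s0 x) = ((tab_lab t x + c) %% r)%N,
    tab_row t' (s0 x) = tab_row t x & tab_col t' (s0 x) = tab_col t x].
  apply: (relabel_perm (th := fun x => ((x + c) %% r)%N)); last exact: rotated_box.
  by move=> x y; apply: mod_add_inj; apply: mpart_tab_lt.
(* The label r of the last point is kept out of the rotation. *)
pose th x := if (x < r)%N then ((x + c) %% r)%N else r.
pose s := lift_perm ord_max ord_max s0.
have sE x : [/\ tab_lab et' (s x) = th (tab_lab et x), tab_row et' (s x) = tab_row et x &
      tab_col et' (s x) = tab_col et x].
  rewrite /s; case: (unliftP ord_max x) => [i|] ->.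
    rewrite lift_perm_lift /= !ext_fun_lift /th ltn_ord.
    exact: s0E.
  by rewrite lift_perm_id /= !ext_fun_max /th ltnn.
have Ls : perm_gpm r s \in Lrp r n p.
  rewrite in_Lrp /= lift_perm_id eqxx andbT inE.
  by rewrite /gpm_deg big1 ?mul0rn // => i _; rewrite ffunE.
have th_inj x y : th (tab_lab et x) = th (tab_lab et y) -> tab_lab et x = tab_lab et y.
  rewrite /th; case: (unliftP ord_max x) => [i|] ->; case: (unliftP ord_max y) => [j|] ->;
    rewrite /= ?ext_fun_lift ?ext_fun_max ?ltn_ord ?ltnn //.
  - by apply: mod_add_inj; apply: ltn_ord.
  - by move=> e; have := ltn_pmod (tab_lab t i + c) r_gt0; rewrite /= e ltnn.
  - by move=> e; have := ltn_pmod (tab_lab t j + c) r_gt0; rewrite /= -e ltnn.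
move: ty'; rewrite (has_type_relabel z _ _ Ls sE th_inj).
rewrite (eq_has_type _ (erefl _) (erefl _) (ch' := ext_charge t k)) //.
move=> g Lg; rewrite (@row_char_shift _ (ext_charge t k) _ c) => [|x].
  move: Lg; rewrite in_Lrp => /andP[]; rewrite (in_Grp z_prim) => /eqP dg _.
  by rewrite qE mulnC exprM dg expr1n mulr1.
rewrite /s /ext_charge; case: (unliftP ord_max x) => [i|] ->.
  rewrite lift_perm_lift !ext_fun_lift; have [-> _ _] := s0E i.
  by rewrite modn_mod.
by rewrite lift_perm_id !ext_fun_max kE modn_mod.
Qed.

(** Relabelling by the rotation -c, written [c * r.-1], shows that V^lambda also has the type with
    charges lowered by c. The twist by delta0^c raises them back, so the twisted module has the type
    of V^lambda. *)
Lemma Vlam_rotated n (l : mpart r n) c : rotated c l l ->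
  mx_rsim (delta0_twist z_prim c (Vlam z_prim l)) (Vlam z_prim l).
Proof.
move=> rot; set t := mpart_tab l; set V := Vlam z_prim l.
have [s sE] : exists s : 'S_n, forall x, [/\ tab_lab t (s x) = ((tab_lab t x + c * r.-1) %% r)%N,
    tab_row t (s x) = tab_row t x & tab_col t (s x) = tab_col t x].
  apply: (relabel_perm (th := fun x => ((x + c * r.-1) %% r)%N)).
    by move=> x y; apply: mod_add_inj; apply: mpart_tab_lt.
  by apply: rotated_box => //; apply: rotatedX.
have ty : has_type z t (fun x => tab_lab t x + c * r.-1)%N V.
  have := Vlam_type z_prim l; rewrite -/(has_type z _ _ _) -/t -/V.
  rewrite (has_type_relabel (th := fun x => ((x + c * r.-1) %% r)%N) z _ _ (in_setT _) sE) => [|x y]; last first.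
    by apply: mod_add_inj; apply: mpart_tab_lt.
  rewrite (eq_has_type _ (erefl _) (erefl _) (ch' := fun x => (tab_lab t x + c * r.-1)%N)) // => g _.
  apply: eq_bigr => x _; have [-> _ _] := sE x.
  by apply/eqP; rewrite (eq_prim_root_expr z_prim) -modnMmr modn_mod modnMmr.
have tw : has_type z t (tab_lab t) (delta0_twist z_prim c V).
  move: ty; rewrite /has_type; congr (~~ (_ *m _ == 0)).
    rewrite !wsum.unlock; apply: eq_bigr => g _ /=; rewrite scalerA; congr (_ *: _).
    by rewrite (@row_char_shift _ (tab_lab t) _ (c * r.-1)) // delta0VX.
  rewrite !wsum.unlock; apply: eq_bigr => g _ /=; rewrite scalerA; congr (_ *: _).
  by rewrite /col_char (@row_char_shift _ (tab_lab t) _ (c * r.-1)) // delta0VX mulrA.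
apply: mx_rsim_sym; apply: embeds_rsim; last by [].
apply: (has_type_embeds z_prim (adapted_mpart z_prim l)) tw; [exact: Vlam_irr|exact: Vlam_type].
Qed.

End Isomorphisms.

(** * Branching from G(r,1,n+1) to G(r,1,n) x Z/r *)

Section Branching.

Variables (C : numClosedFieldType) (r : nat) (z : C) (z_prim : r.-primitive_root z).
Let r_gt0 := prim_order_gt0 z_prim.

Section Cover.

Variables (n : nat) (m : mpart r n) (l : mpart r n.+1) (k a : nat).
Hypotheses (lt_k : (k < r)%N) (cov : covers k a m l).

Notation t := (mpart_tab m).
Notation L1 := (last_emb_morphism r n @* setT)%G.
Let b := nth 0%N (nth [::] m k) a.

Lemma cover_inj x y : ext_fun (tab_lab t) k x = ext_fun (tab_lab t) k y ->
  ext_fun (tab_row t) a x = ext_fun (tab_row t) a y ->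
  ext_fun (tab_col t) b x = ext_fun (tab_col t) b y -> x = y.
Proof.
case: (unliftP ord_max x) => [i|] ->; case: (unliftP ord_max y) => [j|] ->;
  rewrite ?ext_fun_max ?ext_fun_lift //.
- by move=> l' ro co; rewrite (tab_inj l' ro co).
- by move=> e1 e2 e3; have := tab_col_lt m i; rewrite e1 e2 e3 ltnn.
- by move=> e1 e2 e3; have := tab_col_lt m j; rewrite -e1 -e2 -e3 ltnn.
Qed.

Lemma cover_left x j : (j < ext_fun (tab_col t) b x)%N ->
  exists y, [/\ ext_fun (tab_lab t) k y = ext_fun (tab_lab t) k x,
    ext_fun (tab_row t) a y = ext_fun (tab_row t) a x & ext_fun (tab_col t) b y = j].
Proof.
case: (unliftP ord_max x) => [i|] ->; rewrite ?ext_fun_max ?ext_fun_lift => lt_j.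
  by have [y [ly ry cy]] := tab_left lt_j; exists (lift ord_max y); rewrite !ext_fun_lift.
have [y [ly ry cy]] := tab_box lt_k lt_j.
by exists (lift ord_max y); rewrite !ext_fun_lift.
Qed.

(** Unlike in [ext_tab], the last point is here the added box, at the end of row a of component k,
    so the shape is that of [l]. *)
Definition cover_tab := Tableau cover_inj cover_left.

Lemma cover_box x : exists y, [/\ tab_lab (mpart_tab l) y = tab_lab cover_tab x,
  tab_row (mpart_tab l) y = tab_row cover_tab x &
  tab_col (mpart_tab l) y = tab_col cover_tab x].
Proof.
apply: tab_box => /=; case: (unliftP ord_max x) => [i|] ->; rewrite ?ext_fun_max ?ext_fun_lift //.
- have := tab_col_lt m i; rewrite /= => h; apply: leq_trans h _.
  by rewrite cov ?leq_addr.
by rewrite cov // !eqxx addn1.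
Qed.

Lemma cover_type : has_type z cover_tab (tab_lab cover_tab) (Vlam z_prim l).
Proof.
have [s sE] := @relabel_perm _ cover_tab (mpart_tab l) id (fun x y e => e) cover_box.
have := Vlam_type z_prim l; rewrite -/(has_type z _ _ _).
rewrite (has_type_relabel (th := id) z _ _ (in_setT _) sE) //.
rewrite (eq_has_type _ (erefl _) (erefl _) (ch' := tab_lab cover_tab)) // => g _.
by apply: eq_bigr => x _; have [-> _ _] := sE x.
Qed.

(** The row and column groups of [ext_tab] are subgroups of those of [cover_tab], with the same
    charges. The larger sums A, B therefore absorb the smaller A', B': A A' B' B is a nonzero
    multiple of AB, so A'B' does not vanish on V^lambda. *)
Lemma cover_embeds : embeds (last_repr z_prim m k) (res_repr (subsetT L1) (Vlam z_prim l)).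
Proof.
set V := Vlam z_prim l; set et := ext_tab (@mpart_tab_lt r n m); set ec := ext_charge t k.
have ad := adapted_ext z_prim m k.
apply: (has_type_embeds z_prim ad); [exact: last_irr|exact: last_type|].
have lab_lt x : (tab_lab cover_tab x < r)%N.
  by rewrite /=; case: (unliftP ord_max x) => [i|] ->; rewrite ?ext_fun_max ?ext_fun_lift //.
have adD := adapted_full z_prim lab_lt.
have yD := young_tableau z_prim adD; have y1 := young_tableau z_prim ad.
have subR : row_set et L1 \subset row_set cover_tab [set: gpm r n.+1].
  apply/subsetP => g; rewrite !inE => /andP[L1g /row_presP rg].
  have fg : gpm_perm g ord_max = ord_max by apply/eqP; rewrite -(in_last z_prim).
  apply/row_presP => x; have := rg x; case: (unliftP ord_max x) => [i|] -> //=; last by rewrite fg.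
  case: (unliftP ord_max (gpm_perm g (lift ord_max i))) => [j|] -> /=.
    by rewrite !ext_fun_lift.
  by rewrite !ext_fun_lift ext_fun_max => -[e _]; have := ltn_ord (tag (block_sig (mpart_sum m) i)); rewrite -[X in (X < _)%N]e ltnn.
have subC : col_set et L1 \subset col_set cover_tab [set: gpm r n.+1].
  apply/subsetP => g; rewrite !inE => /andP[L1g /col_presP rg].
  have fg : gpm_perm g ord_max = ord_max by apply/eqP; rewrite -(in_last z_prim).
  apply/col_presP => x; have := rg x; case: (unliftP ord_max x) => [i|] -> //=; last by rewrite fg.
  case: (unliftP ord_max (gpm_perm g (lift ord_max i))) => [j|] -> /=.
    by rewrite !ext_fun_lift.
  by rewrite !ext_fun_lift ext_fun_max => -[e _]; have := ltn_ord (tag (block_sig (mpart_sum m) i)); rewrite -[X in (X < _)%N]e ltnn.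
apply: contraNN cover_type; rewrite /has_type => /eqP AB'.
set A := wsum (row_set cover_tab _) _ V; set B := wsum (col_set cover_tab _) _ V.
set A' := wsum (row_set et L1) _ _ in AB'; set B' := wsum (col_set et L1) _ _ in AB'.
have AA' : A *m A' = #|row_group et L1|%:R *: A.
  apply: (equivariant_wsum (young_lin1 y1)) => g Pg.
  exact: (wsum_mulr (young_sub1 yD) (young_lin1 yD)) (subsetP subR g Pg).
have BB' : B' *m B = #|col_group et L1|%:R *: B.
  apply: (wsum_equivariant (young_lin2 y1)) => g Pg.
  exact: (wsum_mull (young_sub2 yD) (young_lin2 yD)) (subsetP subC g Pg).
have := congr1 (fun M => A *m M *m B) AB'; rewrite mulmx0 mul0mx mulmxA AA' -mulmxA BB'.
rewrite -scalemxAl -scalemxAr => /eqP; rewrite !scaler_eq0.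
by rewrite (negPf (card_neq0 _ (row_group et L1))) (negPf (card_neq0 _ (col_group et L1))).
Qed.

End Cover.

End Branching.

Local Open Scope nat_scope.

(** * Adding and removing boxes *)

Section Rows.

Variable r : nat.

Definition mrow n (l : mpart r n) k a := nth 0 (nth [::] l k) a.

Lemma mrow_noninc n (l : mpart r n) k a b : k < r -> a <= b -> mrow l k b <= mrow l k a.
Proof.
move=> lt_k ab; have := mpart_part l (Ordinal lt_k); rewrite (tnth_nth [::]) /=.
case/andP=> so _; have [lt_b|le_b] := ltnP b (size (nth [::] l k)); last first.
  by rewrite /mrow nth_default.
have geq_tr : transitive geq by move=> u v w /= h1 h2; apply: leq_trans h2 h1.
apply: (sorted_leq_nth geq_tr (fun u => leqnn u) 0 so a b _ _ ab).
  by rewrite inE (leq_ltn_trans ab).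
by rewrite inE.
Qed.

Lemma sumn_ge_size (s : seq nat) : 0 \notin s -> size s <= sumn s.
Proof.
elim: s => //= a s IHs; rewrite inE negb_or => /andP[a0 /IHs h].
by rewrite -add1n leq_add // lt0n eq_sym.
Qed.

Lemma mrow_bound n (l : mpart r n) k a : k < r -> n <= a -> mrow l k a = 0.
Proof.
move=> lt_k le_a; rewrite /mrow nth_default //.
have := mpart_part l (Ordinal lt_k); rewrite (tnth_nth [::]) /= => /andP[_ nz].
apply: leq_trans (sumn_ge_size nz) _; apply: leq_trans _ le_a.
by rewrite -{2}(mpart_sum l) (bigD1 (Ordinal lt_k)) //= (tnth_nth [::]) leq_addr.
Qed.

Lemma part_nth_eq s s' : is_part s -> is_part s' -> nth 0 s =1 nth 0 s' -> s = s'.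
Proof.
case/andP=> _ nz /andP[_ nz'] e.
have szP (u v : seq nat) : 0 \notin u -> nth 0 u =1 nth 0 v -> size u <= size v.
  move=> nzu euv; rewrite leqNgt; apply: contra nzu => lt_uv.
  by have := mem_nth 0 lt_uv; rewrite euv nth_default.
apply: (@eq_from_nth _ 0) => [|i _]; last exact: e.
by apply/eqP; rewrite eqn_leq !szP // => i; rewrite e.
Qed.

Lemma mrow_eq n (l l' : mpart r n) : (forall k a, k < r -> mrow l k a = mrow l' k a) -> l = l'.
Proof.
move=> e; apply: mpart_eqP => k lt_k; apply: part_nth_eq => [||a]; last exact: e.
  by have := mpart_part l (Ordinal lt_k); rewrite (tnth_nth [::]).
by have := mpart_part l' (Ordinal lt_k); rewrite (tnth_nth [::]).
Qed.

Lemma part_of_fun (f : nat -> nat) B : (forall a b, a <= b -> f b <= f a) ->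
    (forall a, B <= a -> f a = 0) ->
  exists s, [/\ is_part s, nth 0 s =1 f & sumn s = \sum_(a < B) f a].
Proof.
move=> ni f0; elim: B f0 => [|B IHB] f0.
  by exists [::]; split=> [|a|] //; rewrite ?nth_nil ?f0 ?big_ord0.
have [fB|fB] := posnP (f B).
  have [s [ps ns ss]] : exists s, [/\ is_part s, nth 0 s =1 f & sumn s = \sum_(a < B) f a].
    by apply: IHB => a; rewrite leq_eqVlt => /orP[/eqP <-|/f0].
  by exists s; rewrite big_ord_recr /= fB addn0.
exists (mkseq f B.+1); split.
- apply/andP; split; last first.
    apply/mapP => -[a]; rewrite mem_iota add0n => /andP[_ lt_a] e.
    by have := ni a B lt_a; rewrite -e leqNgt fB.
  by rewrite sorted_map; apply: sub_sorted (iota_sorted 0 B.+1) => a b; apply: ni.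
- move=> a; have [lt_a|le_a] := ltnP a B.+1; first by rewrite nth_mkseq.
  by rewrite nth_default ?size_mkseq // f0.
by rewrite sumnE big_map -[iota _ _]/(index_iota 0 B.+1) big_mkord.
Qed.

Lemma mpart_of_rows n (f : nat -> nat -> nat) B :
    (forall k a b, k < r -> a <= b -> f k b <= f k a) ->
    (forall k a, k < r -> B <= a -> f k a = 0) ->
    \sum_(k < r) \sum_(a < B) f k a = n ->
  exists l : mpart r n, forall k a, k < r -> mrow l k a = f k a.
Proof.
move=> ni f0 sf.
have ex (k : 'I_r) : exists s, [/\ is_part s, nth 0 s =1 f k & sumn s = \sum_(a < B) f k a].
  by apply: part_of_fun => [a b|a]; [apply: ni|apply: f0].
have [g gE] := choice ex.
have ok : all is_part [tuple g k | k < r] && (\sum_(k < r) sumn (tnth [tuple g k | k < r] k) == n).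
  apply/andP; split; first by apply/all_tnthP => k; rewrite tnth_mktuple; have [] := gE k.
  rewrite -sf; apply/eqP/eq_bigr => k _; rewrite tnth_mktuple; have [_ _ ->] := gE k.
  by [].
exists (MPart ok) => k a lt_k; rewrite /mrow -[k in LHS]/(nat_of_ord (Ordinal lt_k)) -tnth_nth tnth_mktuple.
by have [_ -> _] := gE (Ordinal lt_k).
Qed.

Lemma mrow_sum n (l : mpart r n) B : n <= B -> \sum_(k < r) \sum_(a < B) mrow l k a = n.
Proof.
move=> le_B; rewrite -[RHS](mpart_sum l); apply: eq_bigr => k _.
have nz : size (tnth l k) <= B.
  have /andP[_ nz] := mpart_part l k; apply: leq_trans (sumn_ge_size nz) _.
  by apply: leq_trans _ le_B; rewrite -{2}(mpart_sum l) (bigD1 k) //= leq_addr.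
rewrite sumnE (big_nth 0) big_mkord (big_ord_widen _ (nth 0 (tnth l k)) nz).
rewrite [RHS]big_mkcond; apply: eq_bigr => a _; rewrite /mrow -tnth_nth.
by case: ltnP => // le_a; rewrite nth_default.
Qed.

Lemma coversE n k a (m : mpart r n) (l : mpart r n.+1) :
  covers k a m l <-> forall k' a', k' < r -> mrow l k' a' = mrow m k' a' + ((k' == k) && (a' == a)).
Proof. by []. Qed.

Definition addable n (m : mpart r n) k a := (a == 0) || (mrow m k a < mrow m k a.-1).
Definition removable n (m : mpart r n) k a := mrow m k a.+1 < mrow m k a.

Lemma covers_addable n k a (m : mpart r n) (l : mpart r n.+1) : k < r ->
  covers k a m l -> addable m k a /\ removable l k a.
Proof.
move=> lt_k cov; rewrite /addable /removable; split.
  case: a cov => //= a cov; have := mrow_noninc l lt_k (leqnSn a).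
  by rewrite /mrow !cov // !eqxx /= [a == a.+1]ltn_eqF // addn0 addn1.
have := mrow_noninc m lt_k (leqnSn a).
by rewrite /mrow !cov // !eqxx /= gtn_eqF // addn0 addn1 ltnS.
Qed.

Lemma addable_bound n (m : mpart r n) k a : k < r -> addable m k a -> a <= n.
Proof.
move=> lt_k; case: a => //= a; rewrite /addable /= => lt; rewrite ltnNge; apply/negP => le.
by rewrite (mrow_bound _ lt_k le) in lt.
Qed.

Lemma removable_bound n (m : mpart r n) k a : k < r -> removable m k a -> a < n.
Proof.
move=> lt_k; rewrite /removable => lt; rewrite ltnNge; apply/negP => le.
by rewrite (mrow_bound _ lt_k le) in lt.
Qed.

Lemma sum_box k a B : k < r -> a < B ->
  \sum_(k' < r) \sum_(a' < B) ((nat_of_ord k' == k) && (nat_of_ord a' == a) : nat) = 1.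
Proof.
move=> lt_k lt_a; rewrite (bigD1 (Ordinal lt_k)) //= [X in _ + X]big1 => [|k' nk]; last first.
  by rewrite big1 // => a' _; rewrite (negPf (nk : nat_of_ord k' != k)).
rewrite addn0 (bigD1 (Ordinal lt_a)) //= !eqxx big1 // => a' na.
by rewrite (negPf (na : nat_of_ord a' != a)).
Qed.

Lemma addable_covers n k a (m : mpart r n) : k < r -> addable m k a ->
  exists l : mpart r n.+1, covers k a m l.
Proof.
move=> lt_k ad; have le_a := addable_bound lt_k ad.
apply: (@mpart_of_rows _ _ n.+1) => [k' b c lt_k' bc|k' b lt_k' lt_b|].
- have := mrow_noninc m lt_k' bc; rewrite -/(mrow m k' c) -/(mrow m k' b).
  case: (eqVneq c a) => [ec|nca]; last by rewrite andbF addn0 => h; apply: leq_trans h (leq_addr _ _).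
  case: (eqVneq b a) => [->|nba]; first by rewrite leq_add2r.
  case: (eqVneq k' k) => [ek|_] /=; last by rewrite !addn0.
  move: ad bc nba; rewrite ec ek /addable addn0 addn1 => /orP[/eqP->|lt bc nba _].
    by rewrite leqn0 => /eqP->; rewrite eqxx.
  apply: leq_trans lt _; apply: mrow_noninc => //.
  by case: a bc nba {ec le_a} => [|a]; [case: b|rewrite leq_eqVlt => /orP[/eqP->|//]; rewrite eqxx].
- rewrite -/(mrow m k' b) mrow_bound ?(ltnW lt_b) // (gtn_eqF (leq_ltn_trans le_a lt_b)).
  by rewrite andbF.
have : \sum_(k' < r) \sum_(a' < n.+1) (mrow m k' a' + ((nat_of_ord k' == k) && (nat_of_ord a' == a))) = n.+1.
  under eq_bigr do rewrite big_split.
  by rewrite big_split /= mrow_sum // sum_box // addn1.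
by [].
Qed.

Lemma removable_covers n k a (l : mpart r n.+1) : k < r -> removable l k a ->
  exists m : mpart r n, covers k a m l.
Proof.
move=> lt_k re; have lt_a := removable_bound lt_k re.
have pos k' a' : k' < r -> (k' == k) && (a' == a) <= mrow l k' a'.
  move=> _; case: (eqVneq k' k) => [->|//]; case: (eqVneq a' a) => [->|//].
  exact: leq_ltn_trans re.
suff [m mE] : exists m : mpart r n, forall k' a', k' < r ->
    mrow m k' a' = mrow l k' a' - ((k' == k) && (a' == a)).
  by exists m; apply/coversE => k' a' lt_k'; rewrite mE // subnK // pos.
apply: (@mpart_of_rows _ _ n.+1) => [k' b c lt_k' bc|k' b lt_k' lt_b|].
- have := mrow_noninc l lt_k' bc.
  case: (eqVneq b a) => [eb|nba]; last by rewrite andbF subn0 => h; apply: leq_trans h; apply: leq_subr.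
  case: (eqVneq c a) => [->|nca]; first by move=> h; apply: leq_sub2r.
  case: (eqVneq k' k) => [ek|_] /=; last by rewrite !subn0.
  move=> _; rewrite subn0 subn1 ek eb -ltnS prednK; last exact: leq_ltn_trans re.
  apply: leq_ltn_trans re; apply: mrow_noninc => //.
  by move: bc nca; rewrite eb leq_eqVlt => /orP[/eqP->|//]; rewrite eqxx.
- by rewrite mrow_bound.
apply: (@addnI 1); rewrite [RHS]add1n -[RHS](mrow_sum l (leqnn _)) -(sum_box lt_k lt_a) -big_split.
by apply: eq_bigr => k' _; rewrite -big_split; apply: eq_bigr => a' _; rewrite /= subnKC // pos.
Qed.

Lemma covers_inj_node n k a k' a' (m : mpart r n) (l : mpart r n.+1) : k < r ->
  covers k a m l -> covers k' a' m l -> k = k' /\ a = a'.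
Proof.
move=> lt_k c c'; have := c k a lt_k; rewrite c' // !eqxx => /addnI.
by case: eqP => // ->; case: eqP.
Qed.

Lemma covers_inj_up n k a (m : mpart r n) (l l' : mpart r n.+1) :
  covers k a m l -> covers k a m l' -> l = l'.
Proof. by move=> c c'; apply: mrow_eq => k' a' lt_k'; rewrite /mrow c // c'. Qed.

Lemma covers_inj_down n k a (m m' : mpart r n) (l : mpart r n.+1) :
  covers k a m l -> covers k a m' l -> m = m'.
Proof.
move=> c c'; apply: mrow_eq => k' a' lt_k'.
by apply: (@addIn ((k' == k) && (a' == a))); rewrite -c // -c'.
Qed.

Definition covered n k (m : mpart r n) (l : mpart r n.+1) : bool := `[< exists a, covers k a m l >].

Lemma coveredP n k (m : mpart r n) (l : mpart r n.+1) :
  reflect (exists a, covers k a m l) (covered k m l).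
Proof. exact: asboolP. Qed.

(** [w] is the intersection of the two diagrams, the rowwise minimum; its size follows because [l]
    is their union. *)
Lemma diamond_down n k k' (m m' : mpart r n.+1) (l : mpart r n.+2) : k < r -> k' < r -> m != m' ->
  covered k m l -> covered k' m' l -> exists w : mpart r n, covered k' w m && covered k w m'.
Proof.
move=> lt_k lt_k' nm /coveredP[a c] /coveredP[a' c'].
have nx : ~~ ((k == k') && (a == a')).
  by apply: contra nm => /andP[/eqP ek /eqP ea]; subst k' a'; apply/eqP; apply: covers_inj_down c c'.
have mE j b : j < r -> mrow m j b + ((j == k) && (b == a)) = mrow m' j b + ((j == k') && (b == a')).
  by move=> lt_j; rewrite -[LHS]c // -[RHS]c'.
have [w wE] : exists w : mpart r n, forall j b, j < r -> mrow w j b = minn (mrow m j b) (mrow m' j b).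
  apply: (@mpart_of_rows _ _ n.+2) => [j b c0 lt_j bc|j b lt_j le_b|].
  - by rewrite leq_min !geq_min !(mrow_noninc _ lt_j bc) orbT.
  - by rewrite mrow_bound // ?min0n // ltnW.
  apply: (@addIn n.+2); rewrite -[X in _ + X = _](mrow_sum l (leqnn n.+2)) -big_split.
  have -> : n + n.+2 = n.+1 + n.+1 by lia.
  rewrite -[X in _ = X + _](mrow_sum m (leqnSn n.+1)) -[X in _ = _ + X](mrow_sum m' (leqnSn n.+1)) -big_split.
  apply: eq_bigr => j _; rewrite -!big_split; apply: eq_bigr => b _ /=.
  rewrite [mrow l j b]c //; have := mE j b (ltn_ord j); rewrite -/(mrow m j b).
  case: (eqVneq (nat_of_ord j) k) => ejk; case: (eqVneq (nat_of_ord j) k') => ejk'; case: (eqVneq (nat_of_ord b) a) => eba;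
    case: (eqVneq (nat_of_ord b) a') => eba' //=; rewrite ?addn0 ?addn1; try lia.
exists w; apply/andP; split; apply/coveredP; [exists a'|exists a]; move=> j b lt_j.
  have := mE j b lt_j; rewrite -/(mrow m j b) -/(mrow w j b) wE //.
  case: (eqVneq j k) => ejk; case: (eqVneq j k') => ejk'; case: (eqVneq b a) => eba;
    case: (eqVneq b a') => eba' //=; rewrite ?addn0 ?addn1; try lia.
have := mE j b lt_j; rewrite -/(mrow m' j b) -/(mrow w j b) wE //.
case: (eqVneq j k) => ejk; case: (eqVneq j k') => ejk'; case: (eqVneq b a) => eba;
  case: (eqVneq b a') => eba' //=; rewrite ?addn0 ?addn1; try lia.
Qed.

(** [l] is the union, the rowwise maximum, and [w] the intersection. *)
Lemma diamond_up n k k' (m m' : mpart r n.+1) (w : mpart r n) : k < r -> k' < r -> m != m' ->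
  covered k' w m -> covered k w m' -> exists l : mpart r n.+2, covered k m l && covered k' m' l.
Proof.
move=> lt_k lt_k' nm /coveredP[a' c'] /coveredP[a c].
have nx : ~~ ((k == k') && (a == a')).
  by apply: contra nm => /andP[/eqP ek /eqP ea]; subst k' a'; apply/eqP; apply: covers_inj_up c' c.
have mE j b : j < r -> mrow m j b + ((j == k) && (b == a)) = mrow m' j b + ((j == k') && (b == a')).
  by move=> lt_j; rewrite /mrow c // c' // addnAC.
have [l lE] : exists l : mpart r n.+2, forall j b, j < r -> mrow l j b = maxn (mrow m j b) (mrow m' j b).
  apply: (@mpart_of_rows _ _ n.+2) => [j b c0 lt_j bc|j b lt_j le_b|].
  - by rewrite geq_max !leq_max !(mrow_noninc _ lt_j bc) orbT.
  - by rewrite !mrow_bound // ltnW.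
  have le_n : n <= n.+2 by lia.
  apply: (@addIn n); rewrite -[X in _ + X = _](mrow_sum w le_n) -big_split.
  have -> : n.+2 + n = n.+1 + n.+1 by lia.
  rewrite -[X in _ = X + _](mrow_sum m (leqnSn n.+1)) -[X in _ = _ + X](mrow_sum m' (leqnSn n.+1)) -big_split.
  apply: eq_bigr => j _; rewrite -!big_split; apply: eq_bigr => b _ /=.
  have := mE j b (ltn_ord j); rewrite /mrow c // c' // -/(mrow w j b).
  case: (eqVneq (nat_of_ord j) k) => ejk; case: (eqVneq (nat_of_ord j) k') => ejk'; case: (eqVneq (nat_of_ord b) a) => eba;
    case: (eqVneq (nat_of_ord b) a') => eba' //=; rewrite ?addn0 ?addn1; try lia.
exists l; apply/andP; split; apply/coveredP; [exists a|exists a']; move=> j b lt_j.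
  have := mE j b lt_j; rewrite -/(mrow m j b) -/(mrow l j b) lE //.
  case: (eqVneq j k) => ejk; case: (eqVneq j k') => ejk'; case: (eqVneq b a) => eba;
    case: (eqVneq b a') => eba' //=; rewrite ?addn0 ?addn1; try lia.
have := mE j b lt_j; rewrite -/(mrow m' j b) -/(mrow l j b) lE //.
case: (eqVneq j k) => ejk; case: (eqVneq j k') => ejk'; case: (eqVneq b a) => eba;
  case: (eqVneq b a') => eba' //=; rewrite ?addn0 ?addn1; try lia.
Qed.

End Rows.

(** Counting along a relation, since the boxes are only known to exist. *)
Lemma leq_card_graph (A B : finType) (P : simpl_pred A) (Q : simpl_pred B) (R : A -> B -> Prop) :
    (forall a, P a -> exists2 b, Q b & R a b) ->
    (forall a a' b, P a -> P a' -> R a b -> R a' b -> a = a') ->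
  #|P| <= #|Q|.
Proof.
move=> ex inj; have ex' (a : {a | P a}) : exists b, Q b /\ R (val a) b.
  by have [b] := ex _ (valP a); exists b.
have [f fE] := boolp.choice ex'.
have f_inj : injective f.
  move=> a a' e; apply/val_inj/(inj _ _ (f a)); first exact: valP.
  - exact: valP.
  - exact: (fE a).2.
  by rewrite e; exact: (fE a').2.
rewrite -card_sig -(card_codom f_inj); apply/subset_leq_card/subsetP => _ /codomP[a ->].
exact: (fE a).1.
Qed.

Lemma eq_card_graph (A B : finType) (P : simpl_pred A) (Q : simpl_pred B) (R : A -> B -> Prop) :
    (forall a, P a -> exists2 b, Q b & R a b) ->
    (forall b, Q b -> exists2 a, P a & R a b) ->
    (forall a a' b, P a -> P a' -> R a b -> R a' b -> a = a') ->
    (forall a b b', Q b -> Q b' -> R a b -> R a b' -> b = b') ->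
  #|P| = #|Q|.
Proof.
move=> ex ex' inj inj'; apply/eqP; rewrite eqn_leq (leq_card_graph ex inj).
by apply: leq_card_graph (fun b a => R a b) ex' _ => b b' a Qb Qb'; apply: inj'.
Qed.

Section UpDown.

Variable r : nat.

Lemma covered_node n k a (m : mpart r n) (l : mpart r n.+1) : covers k a m l -> covered k m l.
Proof. by move=> c; apply/coveredP; exists a. Qed.

Lemma card_up n N k (m : mpart r n) : k < r -> n < N ->
  #|[pred l | covered k m l]| = #|[pred a : 'I_N | addable m k a]|.
Proof.
move=> lt_k lt_n; apply: (@eq_card_graph _ _ _ _ (fun l (a : 'I_N) => covers k a m l)).
- move=> l /coveredP[a c]; have [ad _] := covers_addable lt_k c.
  by exists (Ordinal (leq_ltn_trans (addable_bound lt_k ad) lt_n)).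
- by move=> a /(addable_covers lt_k)[l c]; exists l => //; apply: covered_node c.
- by move=> l l' a _ _; apply: covers_inj_up.
by move=> l a a' _ _ c c'; apply/val_inj; apply: (covers_inj_node lt_k c c').2.
Qed.

Lemma card_down n N k (l : mpart r n.+1) : k < r -> n < N ->
  #|[pred m | covered k m l]| = #|[pred a : 'I_N | removable l k a]|.
Proof.
move=> lt_k lt_n; apply: (@eq_card_graph _ _ _ _ (fun m (a : 'I_N) => covers k a m l)).
- move=> m /coveredP[a c]; have [_ re] := covers_addable lt_k c.
  by exists (Ordinal (leq_ltn_trans (removable_bound lt_k re : a <= n) lt_n)).
- by move=> a /(removable_covers lt_k)[m c]; exists m => //; apply: covered_node c.
- by move=> m m' a _ _; apply: covers_inj_down.
by move=> m a a' _ _ c c'; apply/val_inj; apply: (covers_inj_node lt_k c c').2.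
Qed.

(** Row 0 always accepts a box, and row a+1 accepts one exactly when row a can lose one. *)
Lemma card_addable n N k (m : mpart r n) : k < r -> n <= N ->
  #|[pred a : 'I_N.+1 | addable m k a]| = #|[pred a : 'I_N | removable m k a]|.+1.
Proof.
move=> lt_k le_n; rewrite (cardD1 ord0) inE /= add1n; congr _.+1.
rewrite -[RHS](card_image (@lift_inj _ ord0)); apply: eq_card => a; rewrite !inE.
apply/andP/imageP => [[na]|[b] + ->]; last by rewrite inE.
by case: (unliftP ord0 a) na => [b|] -> // _ ad; exists b.
Qed.

Lemma card_up_down n k (m : mpart r n.+1) : k < r ->
  #|[pred l | covered k m l]| = #|[pred w | covered k w m]|.+1.
Proof.
by move=> lt_k; rewrite (card_up _ lt_k (ltnSn _)) card_addable // -(card_down _ lt_k).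
Qed.

Lemma card_up0 k (m : mpart r 0) : k < r -> #|[pred l | covered k m l]| = 1.
Proof.
move=> lt_k; rewrite (card_up _ lt_k (ltnSn _)) card_addable //.
by rewrite eq_card0 // => -[].
Qed.

Lemma covered_eq n k k' (m : mpart r n) (l : mpart r n.+1) : k < r ->
  covered k m l -> covered k' m l -> k = k'.
Proof. by move=> lt_k /coveredP[a c] /coveredP[a' c']; case: (covers_inj_node lt_k c c'). Qed.

Lemma covered_uniq n k k' (m m' : mpart r n) (l l' : mpart r n.+1) : k < r -> k' < r -> m != m' ->
  covered k m l -> covered k' m' l -> covered k m l' -> covered k' m' l' -> l = l'.
Proof.
move=> lt_k lt_k' nm /coveredP[a c] /coveredP[a' c'] /coveredP[b e] /coveredP[b' e'].
have nx : ~~ ((k == k') && (a == a')).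
  by apply: contra nm => /andP[/eqP ek /eqP ea]; subst k' a'; apply/eqP; apply: covers_inj_down c c'.
suff eb : a = b by rewrite -eb in e; apply: covers_inj_up c e.
have := e k a lt_k; rewrite e' // => h; have := c k a lt_k; rewrite c' // (negPf nx) !eqxx /=.
move: h; case: (eqVneq a b) => // _; rewrite eqxx /= => h h'; lia.
Qed.

Lemma covered_uniq_down n k k' (m m' : mpart r n.+1) (w w' : mpart r n) : k < r -> k' < r -> m != m' ->
  covered k w m -> covered k' w m' -> covered k w' m -> covered k' w' m' -> w = w'.
Proof.
move=> lt_k lt_k' nm /coveredP[a c] /coveredP[a' c'] /coveredP[b e] /coveredP[b' e'].
have nx : ~~ ((k == k') && (a == a')).
  by apply: contra nm => /andP[/eqP ek /eqP ea]; subst k' a'; apply/eqP; apply: covers_inj_up c c'.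
suff eb : a = b by rewrite -eb in e; apply: covers_inj_down c e.
have := e k a lt_k; rewrite c // => h; have := e' k a lt_k; rewrite c' // (negPf nx).
move: h; case: (eqVneq a b) => // _; rewrite !eqxx /= => h h'; lia.
Qed.

(** For m and m' distinct, each side counts at most one diagram, and the two exist together by the
    diamond lemmas. For m = m' both counts vanish unless k = k', where [card_up_down] gives the
    difference 1. *)
Lemma card_diamond n (k k' : 'I_r) (m m' : mpart r n.+1) :
  #|[pred l | covered k m l && covered k' m' l]| =
  ((k == k') && (m == m')) + #|[pred w | covered k' w m && covered k w m']|.
Proof.
case: (eqVneq m m') => [->|nm] /=.
  case: (eqVneq k k') => [->|nk] /=.
    rewrite add1n (eq_card (B := [pred l | covered k' m' l])) => [|l]; last by rewrite !inE andbb.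
    rewrite card_up_down //; congr _.+1; apply: eq_card => w; by rewrite !inE andbb.
  have nk' : nat_of_ord k != k' by [].
  rewrite !eq_card0 // => [w|l]; rewrite !inE; apply/negP => /andP[c c'];
    by move: nk'; rewrite (covered_eq _ c c') ?eqxx.
rewrite andbF add0n; apply: (@eq_card_graph _ _ _ _ (fun _ _ => True)).
- by move=> l /andP[c c']; have [w] := diamond_down (ltn_ord k) (ltn_ord k') nm c c'; exists w.
- by move=> w /andP[c' c]; have [l] := diamond_up (ltn_ord k) (ltn_ord k') nm c' c; exists l.
- by move=> l l' _ /andP[c c'] /andP[e e'] _ _; apply: covered_uniq c c' e e'.
by move=> _ w w' /andP[c c'] /andP[e e'] _ _; apply: (covered_uniq_down _ _ nm c c' e e').
Qed.

(** The relation UD = 1 + DU, with U adding a box of component k and D removing any box, applied to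
    an arbitrary function d. *)
Lemma up_down n (k : 'I_r) (m : mpart r n.+1) (d : mpart r n.+1 -> nat) :
  \sum_(l | covered k m l) \sum_(k' < r) \sum_(m' | covered k' m' l) d m' =
  d m + \sum_(k' < r) \sum_(w | covered k' w m) \sum_(m' | covered k w m') d m'.
Proof.
transitivity (\sum_(k' < r) \sum_m' #|[pred l | covered k m l && covered k' m' l]| * d m').
  rewrite exchange_big; apply: eq_bigr => k' _.
  rewrite (exchange_big_dep xpredT) //=; apply: eq_bigr => m' _.
  by rewrite sum_nat_const.
transitivity (d m + \sum_(k' < r) \sum_m' #|[pred w | covered k' w m && covered k w m']| * d m').
  under eq_bigr do under eq_bigr do rewrite card_diamond mulnDl.
  under eq_bigr do rewrite big_split.
  rewrite big_split; congr (_ + _); rewrite (bigD1 k) //= [X in _ + X]big1 => [|k' nk]; last first.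
    by rewrite big1 // => m' _; rewrite eq_sym (negPf nk).
  rewrite addn0 (bigD1 m) //= !eqxx mul1n big1 ?addn0 // => m' nm.
  by rewrite andTb eq_sym (negPf nm).
congr (_ + _); apply: eq_bigr => k' _; rewrite [RHS](exchange_big_dep xpredT) //=.
by apply: eq_bigr => m' _; rewrite sum_nat_const.
Qed.

End UpDown.

Local Open Scope ring_scope.

(** * Degrees of the modules V^lambda, and completeness *)

Section Dimensions.

Variables (C : numClosedFieldType) (r : nat) (z : C) (z_prim : r.-primitive_root z).
Let r_gt0 := prim_order_gt0 z_prim.

Notation L1 n := (last_emb_morphism r n @* setT)%G.

(** A coset of the stabilizer of the last point is determined by the image of that point. *)
Lemma index_last n : (#|rcosets (L1 n) [set: gpm r n.+1]| <= n.+1)%N.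
Proof.
pose f (i : 'I_#|rcosets (L1 n) [set: gpm r n.+1]|) := gpm_perm (coset_rep i) ord_max.
suff f_inj : injective f by have := leq_card f f_inj; rewrite !card_ord.
move=> i j e; apply: enum_val_inj; rewrite -!coset_repE; apply/rcoset_eqP.
rewrite mem_rcoset (in_last z_prim) gpm_permM permM -/(f i) e.
have -> : gpm_perm (coset_rep j)^-1%g = (gpm_perm (coset_rep j))^-1%g by [].
by rewrite permK.
Qed.

(** The modules V^m (x) sigma with m below l are irreducible, pairwise nonisomorphic and embed in
    V^l, hence so does their sum. *)
Lemma sum_down_leq n (l : mpart r n.+1) :
  (\sum_(k < r) \sum_(m | covered k m l) rdegree (Vlam z_prim m) <= rdegree (Vlam z_prim l))%N.
Proof.
pose U (x : 'I_r * mpart r n) := last_repr z_prim x.2 x.1.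
pose s := [seq x : 'I_r * mpart r n <- enum {: 'I_r * mpart r n} | covered x.1 x.2 l].
have -> : (\sum_(k < r) \sum_(m | covered k m l) rdegree (Vlam z_prim m))%N =
    (\sum_(x <- s) rdegree (U x))%N.
  by rewrite pair_big_dep /= big_filter big_enum_cond.
apply: (@embeds_dsum_leq C _ _ _ U _ (res_repr (subsetT (L1 n)) (Vlam z_prim l))) => /=.
- by rewrite filter_uniq // enum_uniq.
- by move=> x _; apply: last_irr.
- move=> [k m] [k' m'] _ _ sim; have [e em] := last_rsim_eq (ltn_ord k) (ltn_ord k') sim.
  by rewrite (val_inj e : k = k') -[m]/((k, m).2) em.
move=> [k m]; rewrite mem_filter => /andP[/coveredP[a c] _].
exact: cover_embeds (ltn_ord k) c.
Qed.

Lemma irr_dim_gt0 (gT : finGroupType) (G : {group gT}) n (W : mx_representation C G n) :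
  mx_irreducible W -> (0 < n)%N.
Proof. by case/mx_irrP. Qed.

(** By Frobenius reciprocity all [U x] embed in one induced module of degree at most n+1 times that
    of V^m. The family is arbitrary so that a hypothetical further irreducible module can be
    included. *)
Lemma sum_up_leq n k (m : mpart r n) (I : eqType) (U : I -> representation C [set: gpm r n.+1])
    (s : seq I) : uniq s -> {in s, forall x, mx_irreducible (U x)} ->
    {in s &, forall x y, mx_rsim (U x) (U y) -> x = y} ->
    {in s, forall x, embeds (last_repr z_prim m k) (res_repr (subsetT (L1 n)) (U x))} ->
  (\sum_(x <- s) rdegree (U x) <= n.+1 * rdegree (Vlam z_prim m))%N.
Proof.
move=> us irrU simU embU.
apply: leq_trans (_ : _ <= rdegree (ind_repr (subsetT (L1 n)) (last_repr z_prim m k)))%N _.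
  apply: (embeds_dsum_leq us irrU simU) => x sx; have [f ff hf] := embU x sx.
  apply: (frobenius_embeds (irrU x sx) hf); have n_gt0 := irr_dim_gt0 (last_irr z_prim m k).
  by rewrite -mxrank_eq0 (eqP ff) -lt0n.
by rewrite rdegree_ind leq_mul2r index_last orbT.
Qed.

Lemma sum_up_Vlam n k (m : mpart r n) : (k < r)%N ->
  (\sum_(l | covered k m l) rdegree (Vlam z_prim l) <= n.+1 * rdegree (Vlam z_prim m))%N.
Proof.
move=> lt_k; pose s := [seq l : mpart r n.+1 <- enum {: mpart r n.+1} | covered k m l].
have -> : (\sum_(l | covered k m l) rdegree (Vlam z_prim l))%N =
    (\sum_(l <- s) rdegree (Vlam z_prim l))%N by rewrite big_filter big_enum_cond.
apply: sum_up_leq => [|l _|l l' _ _|l]; first by rewrite filter_uniq // enum_uniq.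
- exact: Vlam_irr.
- exact: Vlam_rsim_eq.
by rewrite mem_filter => /andP[/coveredP[a c] _]; apply: cover_embeds c.
Qed.

(** Without a removable box the rows of each component have constant length, hence length 0, against
    the n+1 boxes. *)
Lemma exists_covered n (l : mpart r n.+1) : exists (k : 'I_r) (m : mpart r n), covered k m l.
Proof.
have [[k [a re]]|no] := pselect (exists (k : 'I_r) a, removable l k a).
  have [m c] := removable_covers (ltn_ord k) re.
  by exists k, m; apply: covered_node c.
have row0 (k : 'I_r) a : mrow l k a = mrow l k 0.
  elim: a => // a <-; apply/eqP; rewrite eqn_leq mrow_noninc //= leqNgt.
  by apply/negP => re; apply: no; exists k, a.
have := mrow_sum l (leqnn _); rewrite big1 // => k _; rewrite big1 // => a _.
by rewrite row0 -(row0 k n.+1) mrow_bound.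
Qed.

(* The up and down operators satisfy [U, D] = 1, which turns the two          *)
(* inequalities into equalities.                                              *)
Lemma branching_dim n :
  (forall l : mpart r n.+1, rdegree (Vlam z_prim l) =
     (\sum_(k < r) \sum_(m | covered k m l) rdegree (Vlam z_prim m))%N) /\
  (forall (k : 'I_r) (m : mpart r n),
     (\sum_(l | covered k m l) rdegree (Vlam z_prim l))%N = (n.+1 * rdegree (Vlam z_prim m))%N).
Proof.
pose d n (l : mpart r n) := rdegree (Vlam z_prim l).
(* The hypothesis says that the lower bounds for all l above m add up to the upper bound n.+1 * d m.
   Every inequality in between is then an equality, and each l is above some m. *)
have step : forall n, (forall (k : 'I_r) (m : mpart r n),
    (\sum_(l | covered k m l) \sum_(k' < r) \sum_(m' | covered k' m' l) d n m' = n.+1 * d n m)%N) ->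
  (forall l : mpart r n.+1, d n.+1 l = (\sum_(k < r) \sum_(m | covered k m l) d n m)%N) /\
  (forall (k : 'I_r) (m : mpart r n), (\sum_(l | covered k m l) d n.+1 l)%N = (n.+1 * d n m)%N).
  move=> {}n up; have eqs (k : 'I_r) (m : mpart r n) :
      (\sum_(l | covered k m l) rdegree (Vlam z_prim l))%N = (n.+1 * rdegree (Vlam z_prim m))%N.
    apply/eqP; rewrite eqn_leq sum_up_Vlam //= -(up k m).
    by apply: leq_sum => l _; apply: sum_down_leq.
  split=> // l.
  have [k [m c]] := exists_covered l; apply/eqP; rewrite eqn_leq sum_down_leq andbT.
  have := eqs k m; rewrite -(up k m) (bigD1 l) // [RHS](bigD1 l) //=.
  have : (\sum_(l' | covered k m l' && (l' != l)) \sum_(k' < r) \sum_(m' | covered k' m' l') d n m' <=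
      \sum_(l' | covered k m l' && (l' != l)) rdegree (Vlam z_prim l'))%N.
    by apply: leq_sum => l' _; apply: sum_down_leq.
  by move=> h e; rewrite -(leq_add2r (\sum_(l' | covered k m l' && (l' != l)) rdegree (Vlam z_prim l'))%N) [in X in (X <= _)%N]e leq_add2l.
elim: n => [|n [IHd IHu]]; apply: step => k m.
  (* With no boxes, exactly one l lies above m through component k, and its only box is the one that
     was added. *)
  rewrite (eq_bigr (fun=> d 0%N m)) => [|l c].
    by rewrite sum_nat_const card_up0 // mul1n.
  rewrite (bigD1 k) //= [X in (_ + X)%N]big1 => [|k' nk]; last first.
    apply: big1 => m' c'; have em : m' = m by apply: mrow_eq => j b lt_j; rewrite !mrow_bound.
    by move: nk; rewrite -val_eqE /= (covered_eq (ltn_ord k') _ c) ?eqxx // -em.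
  rewrite addn0 (bigD1 m) //= big1 ?addn0 // => m' /andP[_ /eqP[]].
  by apply: mrow_eq => j b lt_j; rewrite !mrow_bound.
(* After commuting, the upward sums give n+1 times the downward sums, which add up to d m by the
   equalities one level below. *)
rewrite up_down /d mulSn IHd big_distrr /=; congr (_ + _)%N; apply: eq_bigr => k' _.
by rewrite big_distrr /=; apply: eq_bigr => w _; rewrite IHu.
Qed.

End Dimensions.

Section Completeness.

Variables (C : numClosedFieldType) (r : nat) (z : C) (z_prim : r.-primitive_root z).
Let r_gt0 := prim_order_gt0 z_prim.

Notation L1 n := (last_emb_morphism r n @* setT)%G.

Lemma mem_L1 n (x : gpm r n * Zmod r) : last_emb x \in L1 n.
Proof. by apply/morphimP; exists x; rewrite ?inE. Qed.

Lemma last_repr_emb n (m : mpart r n) k (x : gpm r n * Zmod r) :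
  last_repr z_prim m k (last_emb x) = z ^+ (x.2 * k) *: Vlam z_prim m x.1.
Proof.
by rewrite /= (invmE (last_emb_inj r n)) // inE.
Qed.

Lemma last_emb_split n (g : gpm r n) (a : Zmod r) :
  last_emb (g, a) = (last_emb (g, 1%g) * last_emb (1%g, a))%g.
Proof. by rewrite -last_embM; congr last_emb; congr pair; rewrite ?mulg1 ?mul1g. Qed.

(** The factor Z/r is central, so by Schur it acts by scalars, and these are powers of an r-th root
    of unity. *)
Lemma last_char n d (U : mx_representation C (L1 n) d) : mx_irreducible U ->
  exists2 k : 'I_r, true & forall a : Zmod r, U (last_emb (1%g, a)) = (z ^+ (a * k))%:M.
Proof.
move=> irrU; have d_gt0 := irr_dim_gt0 irrU.
have [c cE] : exists c, U (last_emb (1%g, inZp 1 : Zmod r)) = c%:M.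
  apply: (irr_endo_scalar irrU) => _ /morphimP[[g b] _ _ ->].
  rewrite -!repr_mxM ?mem_L1 // -!last_embM; congr (U (last_emb _)).
  by congr pair; rewrite ?mulg1 ?mul1g // Zp_mulgC.
have cX a : U (last_emb (1%g, inZp a : Zmod r)) = (c ^+ a)%:M.
  elim: a => [|a IHa].
    have -> : last_emb (1%g, inZp 0 : Zmod r) = 1%g :> gpm r n.+1.
      rewrite -(morph1 (last_emb_morphism r n)); congr last_emb; congr pair.
      by apply: val_inj; rewrite /= mod0n.
    by rewrite repr_mx1.
  rewrite exprSr scalar_mxM -IHa -cE -repr_mxM ?mem_L1 // -last_embM.
  congr (U (last_emb _)); congr pair; first by rewrite mulg1.
  by apply: val_inj; rewrite /= modnDm addn1.
have cr : c ^+ r = 1.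
  have := cX r; rewrite (_ : inZp r = inZp 0 :> Zmod r); last first.
    by apply: val_inj; rewrite /= (prednK r_gt0) modnn mod0n.
  rewrite cX expr0 => /matrixP/(_ (Ordinal d_gt0) (Ordinal d_gt0)).
  by rewrite !mxE eqxx.
have [k ck] := prim_rootP z_prim cr; exists k => // a.
by rewrite -[a in LHS]valZpK cX ck -exprM mulnC.
Qed.

(** In an irreducible submodule Z/r acts by a character, so an irreducible G(r,1,n)-submodule of it
    is stable under the whole product. *)
Lemma last_submod n d (U : mx_representation C (L1 n) d) : (0 < d)%N ->
    (forall W : representation C [set: gpm r n], mx_irreducible W ->
       exists m, mx_rsim W (Vlam z_prim m)) ->
  exists (k : 'I_r) (m : mpart r n), embeds (last_repr z_prim m k) U.
Proof.
move=> d_gt0 complete; have [U' [irrU' emU']] := embeds_irr_submod U d_gt0.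
have [k _ kE] := last_char irrU'; exists k.
have d'_gt0 := irr_dim_gt0 irrU'.
pose U1 := @pull_repr C _ _ _ _ (last_emb_morphism r n) U' (subxx _).
pose U2 := @pull_repr C _ _ _ _ (pairg1_morphism (gpm r n) (Zmod r)) U1 (subsetT _).
have [U0 [irrU0 emU0]] := embeds_irr_submod U2 d'_gt0.
have [m sim] := complete _ irrU0; exists m.
apply: embeds_trans emU'; have [h fh hh] := embeds_trans (rsim_embeds (mx_rsim_sym sim)) emU0.
exists h => // _ /morphimP[[g a] _ _ ->].
rewrite -/(last_emb _) last_repr_emb /= last_emb_split repr_mxM ?mem_L1 // kE.
rewrite mulmxA mul_mx_scalar -scalemxAl; congr (_ *: _).
by have := hh g (in_setT _).
Qed.

(** The restriction of W contains some V^m (x) sigma, so W embeds in the module induced from it. If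
    W were new, its degree would have to fit beside those of the V^l with l above m, which already
    fill the bound of [sum_up_leq]. *)
Lemma Vlam_complete n (W : representation C [set: gpm r n]) : mx_irreducible W ->
  exists l, mx_rsim W (Vlam z_prim l).
Proof.
elim: n W => [|n IHn] W irrW; have W_gt0 := irr_dim_gt0 irrW.
  have [l _] : exists l : mpart r 0, forall k a, (k < r)%N -> mrow l k a = 0%N.
    apply: (@mpart_of_rows r 0 (fun _ _ => 0%N) 0) => //.
    by rewrite big1 // => k _; rewrite big_ord0.
  exists l; have V_gt0 := irr_dim_gt0 (Vlam_irr z_prim l).
  apply: (@irr_intertwines_rsim _ _ _ _ _ _ _ (delta_mx (Ordinal W_gt0) (Ordinal V_gt0)) irrW (Vlam_irr _ _)).
    move=> g _; have -> : g = 1%g by apply: gpm_eq => [|[]] //; apply/permP => -[].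
    by rewrite !repr_mx1 mul1mx mulmx1.
  apply/eqP => /matrixP/(_ (Ordinal W_gt0) (Ordinal V_gt0)).
  by rewrite !mxE !eqxx => /eqP; rewrite oner_eq0.
apply: contrapT => no.
have [k [m em]] := last_submod (res_repr (subsetT (L1 n)) W) W_gt0 IHn.
pose s := [seq l : mpart r n.+1 <- enum {: mpart r n.+1} | covered k m l].
(* [None] stands for the hypothetical new module [W]. *)
pose U (x : option (mpart r n.+1)) := if x is Some l then Vlam z_prim l else W.
have : (\sum_(x <- None :: map Some s) rdegree (U x) <= n.+1 * rdegree (Vlam z_prim m))%N.
  apply: (@sum_up_leq _ _ _ z_prim n k) => [|[l|] _|[l|] [l'|] _ _ sim|[l|]] //.
  - rewrite cons_uniq map_inj_uniq ?filter_uniq ?enum_uniq ?andbT => [|||x y [->]] //.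
      by apply/mapP => -[].
    by rewrite -enumT enum_uniq.
  - exact: Vlam_irr.
  - by rewrite (Vlam_rsim_eq sim).
  - by case: no; exists l; apply: mx_rsim_sym.
  - by case: no; exists l'.
  rewrite inE mem_map => [|x y [->]] //=; rewrite mem_filter => /andP[/coveredP[a c] _].
  exact: cover_embeds c.
have [_ up] := branching_dim z_prim n.
rewrite big_cons big_map big_filter big_enum_cond /= -(up k m).
by rewrite -[X in (_ <= X)%N]add0n leq_add2r leqNgt W_gt0.
Qed.

End Completeness.

(** * Associators and their eigenspaces *)

Section Stabilizer.

Variables (C : numClosedFieldType) (r p n : nat) (z : C) (z_prim : r.-primitive_root z).
Hypotheses (p_gt0 : (0 < p)%N) (p_dvd_r : (p %| r)%N).
Variable l : mpart r n.
Let r_gt0 := prim_order_gt0 z_prim.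

Notation m := (r %/ p)%N.
Notation V := (Vlam z_prim l).

(** Membership in [Cstab] for arbitrary exponents, so that they can be added without reduction
    modulo p. *)
Definition stabilizes e := `[< mx_rsim (delta0_twist z_prim (m * e) V) V >].

Lemma stabilizesP e : reflect (exists2 f, row_free f &
    forall g, delta0 z g ^+ (m * e) *: (V g *m f) = f *m V g) (stabilizes e).
Proof.
apply: (iffP (asboolP _)) => [[f _ ff hf]|[f ff hf]]; exists f => // g.
  by rewrite -hf ?inE //= scalemxAl.
by move=> _ /=; rewrite -hf scalemxAl.
Qed.

Lemma stabilizesD e e' : stabilizes e -> stabilizes e' -> stabilizes (e + e').
Proof.
move=> /stabilizesP[f ff hf] /stabilizesP[f' ff' hf']; apply/stabilizesP.
exists (f *m f'); first by rewrite /row_free mxrankMfree.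
move=> g; rewrite mulnDr exprD mulrC -scalerA mulmxA scalemxAl hf.
by rewrite -[f *m V g *m f']mulmxA scalemxAr hf' mulmxA.
Qed.

Lemma stabilizes_mod e e' : e = e' %[mod p] -> stabilizes e -> stabilizes e'.
Proof.
move=> ee /stabilizesP[f ff hf]; apply/stabilizesP; exists f => // g; rewrite -hf; congr (_ *: _).
rewrite /delta0 -!exprM; apply/eqP; rewrite (eq_prim_root_expr z_prim); apply/eqP.
have h : (m * e = m * e' %[mod m * p])%N by rewrite -!muln_modr ee.
move: h; rewrite divnK // => h; by rewrite -[in LHS]modnMmr -[in RHS]modnMmr h.
Qed.

Lemma stabilizes0 : stabilizes 0.
Proof.
apply/stabilizesP; exists 1%:M; first by rewrite row_free_unit unitmx1.
by move=> g; rewrite muln0 expr0 scale1r mulmx1 mul1mx.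
Qed.

Lemma stabilizesM e i : stabilizes e -> stabilizes (e * i).
Proof.
move=> Se; elim: i => [|i IHi]; first by rewrite muln0; apply: stabilizes0.
by rewrite mulnS; apply: stabilizesD.
Qed.

(** The stabilizing exponents are closed under addition, contain p and depend only on the residue
    modulo p, so they are the multiples of the least positive one. *)
Lemma stab_index_exists : exists b, [/\ (0 < b)%N, (b %| p)%N & forall e, stabilizes e = (b %| e)%N].
Proof.
have exS : exists e, (0 < e)%N && stabilizes e.
  by exists p; rewrite p_gt0; apply: stabilizes_mod stabilizes0; rewrite mod0n modnn.
case: (ex_minnP exS) => b /andP[b_gt0 Sb] b_min.
have Smod e : stabilizes e -> stabilizes (e %% b).
  (* Modulo p this is e minus b (e %/ b), with [p.-1] in the place of -1. *)
  move=> Se; apply: (@stabilizes_mod (e + b * (e %/ b * p.-1))).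
    set q := (e %/ b)%N; suff -> : (e + b * (q * p.-1) = q * b * p + e %% b)%N by rewrite modnMDl.
    rewrite {1}(divn_eq e b) -/q -[in RHS](prednK p_gt0) mulnS mulnA [(b * q)%N]mulnC; lia.
  by apply: stabilizesD => //; apply: stabilizesM.
have Sdvd e : stabilizes e = (b %| e)%N.
  apply/idP/idP => [Se|/dvdnP[q ->]]; last by rewrite mulnC; apply: stabilizesM.
  rewrite /dvdn; case: posnP => // e_gt0; have := b_min (e %% b)%N.
  by rewrite e_gt0 Smod // => /(_ isT); rewrite leqNgt ltn_mod b_gt0.
exists b; split=> //; rewrite -Sdvd; apply: stabilizes_mod stabilizes0; by rewrite mod0n modnn.
Qed.

Lemma stab_facts : [/\ (0 < stab_index z_prim p l)%N,
  (stab_order z_prim p l * stab_index z_prim p l = p)%N &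
  forall e, stabilizes e = (stab_index z_prim p l %| e)%N].
Proof.
have [b [b_gt0 b_dvd Sb]] := stab_index_exists.
have pE : p = (p %/ b * b)%N by rewrite divnK.
have oE : stab_order z_prim p l = (p %/ b)%N.
  rewrite /stab_order -[RHS]card_ord; apply/eqP.
  have lt_b (i : 'I_(p %/ b)) : (i * b < p)%N by rewrite {2}pE ltn_pmul2r.
  pose f i := Ordinal (lt_b i).
  have f_inj : injective f.
    by move=> i j /(congr1 val) /= /eqP; rewrite eqn_pmul2r // => /eqP/val_inj.
  rewrite -(card_codom f_inj); apply/eqP/eq_card => e; rewrite inE -/(stabilizes e) Sb.
  apply/idP/codomP => [/dvdnP[q eq]|[i ->]]; last by rewrite dvdn_mull.
  have lt_q : (q < p %/ b)%N by rewrite -(ltn_pmul2r b_gt0) -pE -eq.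
  by exists (Ordinal lt_q); apply: val_inj.
have u_gt0 : (0 < p %/ b)%N by rewrite divn_gt0 // dvdn_leq.
have iE : stab_index z_prim p l = b by rewrite /stab_index oE {1}pE mulKn.
by rewrite iE oE.
Qed.

End Stabilizer.

Lemma sum_unity (F : fieldType) (x : F) N : x ^+ N = 1 -> x != 1 -> \sum_(i < N) x ^+ i = 0.
Proof.
move=> xN x1; have := subrX1 x N; rewrite xN subrr => /esym/eqP.
by rewrite mulf_eq0 subr_eq0 (negPf x1) => /eqP.
Qed.

Section CyclicProjections.

Variables (F : fieldType) (N u : nat) (A : 'M[F]_N).
Hypotheses (u_gt0 : (0 < u)%N) (Au : A ^+ u = 1).

(** When [A ^+ u = 1] and w is a u-th root of unity, this is u times the projection to the
    w-eigenspace. *)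
Definition eigen_proj (w : F) := \sum_(t < u) w^-1 ^+ t *: A ^+ t.

Lemma eigen_projP w : w ^+ u = 1 -> (eigen_proj w <= eigenspace A w)%MS.
Proof.
move=> wu; have w0 : w != 0.
  by apply: contraTneq (oner_neq0 F) => w0; rewrite -wu w0 expr0n (gtn_eqF u_gt0) eqxx.
apply/eigenspaceP; rewrite /eigen_proj mulmx_suml.
rewrite (eq_bigr (fun t : 'I_u => w *: (w^-1 ^+ t.+1 *: A ^+ t.+1))) => [|t _]; last first.
  by rewrite -scalemxAl scalerA exprS mulrA divff // mul1r exprSr -mulmxE.
rewrite -scaler_sumr; congr (_ *: _).
apply: (@addrI _ (w^-1 ^+ 0 *: A ^+ 0)).
rewrite -(big_ord_recl u (fun t => w^-1 ^+ t *: A ^+ t)) big_ord_recr /= addrC; congr (_ + _).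
by rewrite exprVn wu invr1 Au !expr0.
Qed.

Lemma eigen_proj_sum w : u.-primitive_root w -> \sum_(t < u) eigen_proj (w ^+ t) = u%:R%:M.
Proof.
move=> w_prim; have wu := prim_expr_order w_prim; rewrite /eigen_proj exchange_big /=.
rewrite (bigD1 (Ordinal u_gt0)) //= [X in _ + X]big1 => [|t nt].
  rewrite addr0 (eq_bigr (fun=> 1%:M)) => [|i _]; last by rewrite !expr0 scale1r.
  by rewrite big_const_ord iter_addr_0 raddfMn.
rewrite -scaler_suml (eq_bigr (fun i : 'I_u => (w^-1 ^+ t) ^+ i)) => [|i _].
  rewrite sum_unity ?scale0r //; first by rewrite exprAC exprVn wu invr1 expr1n.
  rewrite exprVn invr_eq1 -(prim_order_dvd w_prim).
  apply: contra nt => h; rewrite -val_eqE /=; case: posnP (ltn_ord t) => // t_gt0.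
  by rewrite ltnNge dvdn_leq.
by rewrite !exprVn -!exprM mulnC.
Qed.

End CyclicProjections.

Section SubmodEmbeds.

Variables (F : numClosedFieldType) (gT : finGroupType) (G H : {group gT}).
Variables (n1 n2 : nat) (sHG : H \subset G).
Variables (U : mx_representation F H n1) (W : mx_representation F G n2).

Lemma intertwines_submod (X : 'M_n2) (modX : mxmodule W X) (f : 'M_(n1, n2)) :
  intertwines U (subg_repr W sHG) f -> (f <= X)%MS ->
  intertwines U (subg_repr (submod_repr modX) sHG) (in_submod X f).
Proof.
move=> hf fX g Hg; have Gg := subsetP sHG g Hg.
rewrite -[RHS](in_submodJ modX) // -/(subg_repr W sHG g) -hf //.
by rewrite /in_submod mulmxA.
Qed.

Lemma in_submod_neq0 (X : 'M[F]_n2) (f : 'M[F]_(n1, n2)) :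
  (f <= X)%MS -> f != 0 -> in_submod X f != 0.
Proof.
by move=> fX; apply: contraNneq => f0; rewrite -(in_submodK fX) f0 linear0.
Qed.

End SubmodEmbeds.

Section Eigenspaces.

Variables (C : numClosedFieldType) (r p n : nat) (z : C) (z_prim : r.-primitive_root z).
Hypotheses (p_gt0 : (0 < p)%N) (p_dvd_r : (p %| r)%N).
Variable l : mpart r n.
Let r_gt0 := prim_order_gt0 z_prim.

Notation m := (r %/ p)%N.
Notation V := (Vlam z_prim l).
Notation u := (stab_order z_prim p l).
Notation b := (stab_index z_prim p l).

Lemma stab_order_gt0 : (0 < u)%N.
Proof.
have [_ ub _] := stab_facts z_prim p_gt0 p_dvd_r l.
by move: p_gt0; rewrite -[X in (_ < X)%N]ub muln_gt0 => /andP[].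
Qed.

Lemma stab_exponent : (m * b * u = r)%N.
Proof.
have [_ ub _] := stab_facts z_prim p_gt0 p_dvd_r l.
by rewrite -mulnA [(b * u)%N]mulnC ub divnK.
Qed.

Lemma stab_root_prim : u.-primitive_root (z ^+ (m * b)).
Proof.
have u_dvd : (u %| r)%N by rewrite -[X in (_ %| X)%N]stab_exponent dvdn_mull.
have := mulnK (m * b) stab_order_gt0; rewrite stab_exponent => <-.
exact: (@dvdn_prim_root C r z z_prim u u_dvd).
Qed.

Section Associator.

Variables (A : 'M[C]_(rdegree V)) (hA : associator p A).

Lemma associatorE h : V h *m A = delta0 z h ^+ (m * b) *: (A *m V h).
Proof.
apply/row_matrixP => i; rewrite rowE [RHS]rowE mulmxA hA.1.
by rewrite -scalemxAr mulmxA.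
Qed.

Lemma associatorX h t : V h *m A ^+ t = (delta0 z h ^+ (m * b)) ^+ t *: (A ^+ t *m V h).
Proof.
elim: t => [|t IHt]; first by rewrite !expr0 scale1r mulmx1 mul1mx.
rewrite exprSr -mulmxE mulmxA IHt -scalemxAl -[A ^+ t *m V h *m A]mulmxA associatorE.
by rewrite -scalemxAr scalerA mulmxA -exprSr.
Qed.

Lemma eigen_proj_comm w g : g \in Grp r p n ->
  V g *m eigen_proj u A w = eigen_proj u A w *m V g.
Proof.
rewrite (in_Grp z_prim) => /eqP dg; rewrite /eigen_proj mulmx_sumr mulmx_suml.
apply: eq_bigr => t _; rewrite -scalemxAr associatorX exprM dg !expr1n scale1r.
by rewrite -scalemxAl.
Qed.

End Associator.

End Eigenspaces.

(** The translates f A^t have pairwise different weights under the operators Y. The average Q keeps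
    the term t = 0 of the projection, as r times f, and kills the others. *)
Lemma eigen_proj_neq0 (F : numFieldType) (n1 N u r : nat) (A : 'M[F]_N) (f : 'M[F]_(n1, N))
    (Y : nat -> 'M[F]_N) (a x w : F) : (0 < r)%N -> u.-primitive_root x -> (u %| r)%N -> a != 0 ->
    (forall s t, f *m A ^+ t *m Y s = (a * x^-1 ^+ t) ^+ s *: (f *m A ^+ t)) -> f != 0 ->
  f *m eigen_proj u A w != 0.
Proof.
move=> r_gt0 x_prim ur a0 fY f0; have u_gt0 := prim_order_gt0 x_prim.
pose Q := \sum_(s < r) a^-1 ^+ s *: Y s.
have fQ t : f *m A ^+ t *m Q = (\sum_(s < r) (x^-1 ^+ t) ^+ s) *: (f *m A ^+ t).
  rewrite mulmx_sumr scaler_suml; apply: eq_bigr => s _.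
  by rewrite -scalemxAr fY scalerA exprMn mulrA -exprMn mulVf // expr1n mul1r.
have : f *m eigen_proj u A w *m Q = r%:R *: f.
  rewrite [f *m eigen_proj _ _ _]mulmx_sumr mulmx_suml (bigD1 (Ordinal u_gt0)) //= big1 ?addr0 => [|t nt].
    rewrite -scalemxAr -scalemxAl fQ !expr0 scale1r mulmx1; congr (_ *: _).
    by rewrite (eq_bigr (fun=> 1)) ?sumr_const ?card_ord // => s _; rewrite expr1n.
  rewrite -scalemxAr -scalemxAl fQ sum_unity ?scale0r ?scaler0 //.
    by rewrite exprAC exprVn -(divnK ur) mulnC exprM (prim_expr_order x_prim) expr1n invr1 expr1n.
  rewrite exprVn invr_eq1 -(prim_order_dvd x_prim).
  apply: contra nt => h; rewrite -val_eqE /=; case: posnP (ltn_ord t) => // t_gt0.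
  by rewrite ltnNge dvdn_leq.
apply: contra_eqN => /eqP->; rewrite mul0mx eq_sym scaler_eq0 (negPf f0) orbF.
by rewrite pnatr_eq0 -lt0n.
Qed.

(** * Deletions of a box inside an eigenspace of the associator *)

Section DownEmbeds.

Variables (C : numClosedFieldType) (r p n : nat) (z : C) (z_prim : r.-primitive_root z).
Hypotheses (p_gt0 : (0 < p)%N) (p_dvd_r : (p %| r)%N).
Let r_gt0 := prim_order_gt0 z_prim.

Notation m := (r %/ p)%N.

Lemma delta0_last (s : nat) : delta0 z (last_emb (1%g : gpm r n, inZp s : Zmod r)) = z ^+ s.
Proof.
have degE : gpm_deg (last_emb (1%g : gpm r n, inZp s : Zmod r)) = inZp s.
  rewrite /gpm_deg (bigD1 ord_max) //= big1 => [|i ni]; first by rewrite addr0 ffunE unlift_none.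
  by rewrite ffunE; case: unliftP ni => [j|] -> /=; rewrite ?ffunE ?eqxx.
by rewrite /delta0 degE /= (prednK r_gt0) (prim_expr_mod z_prim).
Qed.

(** The projection to the eigenspace commutes with G(r,p,n+1), so following the embedding in
    V^lambda by it gives an intertwiner from an irreducible module, and only its nonvanishing is at
    stake. *)
Lemma down_embeds (l : mpart r n.+1) (mu : mpart r n) (k : 'I_r) (A : 'M[C]_(rdegree (Vlam z_prim l)))
    (hA : associator p A) (w : C) :
    w ^+ stab_order z_prim p l = 1 -> covered k mu l ->
  embeds (res_repr (Lrp_sub_last r n p) (last_repr z_prim mu k))
    (res_repr (Lrp_sub r n p) (Representation (submod_repr (associator_module w hA)))).
Proof.
move=> wu /coveredP[a c]; have [f ff hf] := cover_embeds z_prim (ltn_ord k) c.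
set u := stab_order z_prim p l in wu *; set P := eigen_proj u A w.
have ug := stab_order_gt0 z_prim p_gt0 p_dvd_r l.
have fP : (f *m P <= eigenspace A w)%MS.
  by apply: submx_trans (submxMl _ _) _; apply: eigen_projP => //; apply: hA.2.
have hfP : intertwines (res_repr (Lrp_sub_last r n p) (last_repr z_prim mu k))
    (subg_repr (res_repr (subsetT (Grp r p n.+1)) (Vlam z_prim l)) (Lrp_sub r n p)) (f *m P).
  move=> g Lg; have Gg := subsetP (Lrp_sub r n p) g Lg.
  rewrite mulmxA [X in X *m P](hf g (subsetP (Lrp_sub_last r n p) g Lg)) -!mulmxA; congr (_ *m _).
  exact: (eigen_proj_comm hA w Gg).
have f0 : f != 0.
  have n_gt0 := irr_dim_gt0 (last_irr z_prim mu k).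
  by rewrite -mxrank_eq0 (eqP ff) -lt0n.
have fP0 : f *m P != 0.
  apply: (@eigen_proj_neq0 _ _ _ u r A f
      (fun s => Vlam z_prim l (last_emb (1%g : gpm r n, inZp s : Zmod r))) (z ^+ k)
      (z ^+ (m * stab_index z_prim p l)) w r_gt0 (stab_root_prim z_prim p_gt0 p_dvd_r l) _ _ _ f0).
  - by rewrite -(stab_exponent z_prim p_gt0 p_dvd_r l) dvdn_mull.
  - exact: (z_neq0 z_prim).
  move=> s t; set g := last_emb _.
  (* diag(1,...,1,zeta^s) acts on the image of f by zeta^(s k). Moving it past A^t changes this
     weight by the t-th power of the inverse of a primitive u-th root of unity. *)
  have hg : z ^+ (s * k) *: f = f *m Vlam z_prim l g.
    have := hf g (mem_L1 _); rewrite last_repr_emb (repr_mx1 (Vlam z_prim mu)) scalemx1.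
    by rewrite mul_scalar_mx /= (prednK r_gt0) exprM (prim_expr_mod z_prim) -exprM.
  have := associatorX hA g t; rewrite delta0_last => /(congr1 (mulmx f)).
  rewrite mulmxA -hg -scalemxAl -scalemxAr mulmxA => e.
  have c0 : ((z ^+ s) ^+ (m * stab_index z_prim p l)) ^+ t != 0.
    by rewrite -!exprM; apply: (z_neq0 z_prim).
  apply: (scalerI c0); rewrite -e scalerA; congr (_ *: _).
  rewrite exprMn !exprVn -!exprM mulrCA [(k * s)%N]mulnC -[LHS]mulr1; congr (_ * _).
  by rewrite mulnA [(s * _)%N]mulnC -mulnA [(s * t)%N]mulnC divff // (z_neq0 z_prim).
have hS := intertwines_submod (associator_module w hA) hfP fP.
exists (in_submod (eigenspace A w) (f *m P)) => //.
apply: irr_intertwines_free hS _; first exact: lastL_irr.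
exact: in_submod_neq0.
Qed.

End DownEmbeds.

Local Open Scope nat_scope.

(** In a weakly decreasing list the zeros come last, so dropping them moves no other entry. *)
Lemma nth_filter_pos (t : seq nat) b : sorted geq t -> nth 0 [seq x <- t | x != 0] b = nth 0 t b.
Proof.
have geq_tr : transitive geq by move=> u v w /= h1 h2; apply: leq_trans h2 h1.
elim: t b => //= a t IHt b so; have so' := path_sorted so.
case: eqVneq so => [->|_] so /=; last by case: b => //= b; apply: IHt.
have t0 x : x \in t -> x = 0.
  by move: (order_path_min geq_tr so) => /allP h /h; rewrite /= leqn0 => /eqP.
rewrite (_ : [seq x <- t | x != 0] = [::]); last first.
  by apply/eqP; rewrite -(negbK (_ == _)) -has_filter -all_predC; apply/allP => x /t0 ->.
rewrite nth_nil; case: b => //= b; case: (ltnP b (size t)) => [lt|le]; last by rewrite nth_default.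
by rewrite (t0 _ (mem_nth 0 lt)).
Qed.

Lemma sorted_geq_nth (s : seq nat) a b : sorted geq s -> a <= b -> nth 0 s b <= nth 0 s a.
Proof.
move=> so ab; have [lt_b|le_b] := ltnP b (size s); last by rewrite nth_default.
have geq_tr : transitive geq by move=> u v w /= h1 h2; apply: leq_trans h2 h1.
apply: (sorted_leq_nth geq_tr (fun u => leqnn u) 0 so a b _ _ ab); last by rewrite inE.
by rewrite inE (leq_ltn_trans ab).
Qed.

Lemma delete_boxP (s : seq nat) a : is_part s -> a < size s -> inner_corner s a ->
  is_part (delete_box s a) /\ forall b, nth 0 (delete_box s a) b = nth 0 s b - (b == a).
Proof.
case/andP=> so _ lt_a co; set t := set_nth 0 s a (nth 0 s a).-1.
have tE b : nth 0 t b = nth 0 s b - (b == a).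
  by rewrite nth_set_nth /=; case: eqVneq => [->|_]; rewrite ?subn1 ?subn0.
have sot : sorted geq t.
  apply/(sortedP 0) => i _; rewrite /= !tE.
  have := sorted_geq_nth so (leqnSn i).
  case: (eqVneq i a) => [->|_]; last by rewrite subn0 => h; apply: leq_trans (leq_subr _ _) h.
  by rewrite [a.+1 == a]gtn_eqF // subn0 subn1 => _; move: co; rewrite /inner_corner; case: (nth 0 s a).
rewrite /delete_box; split=> [|b]; last by rewrite nth_filter_pos.
rewrite /is_part mem_filter eqxx andbT; apply: sorted_filter => //.
by move=> u v w /= h1 h2; apply: leq_trans h2 h1.
Qed.

(** * Colored necklaces *)

Section Colored.

Variables (r p n : nat).
Hypotheses (r_gt0 : 0 < r) (p_gt0 : 0 < p) (p_dvd_r : p %| r).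

Notation m := (r %/ p).

Lemma mulp_period : p * m = r. Proof. by rewrite mulnC divnK. Qed.

Lemma period_gt0 : 0 < m. Proof. by rewrite divn_gt0 // dvdn_leq. Qed.

Definition color (c : colored r p n) := c.2 * m + c.1.2.

Lemma color_bound (i : 'I_m) (j : 'I_p) : j * m + i < r.
Proof.
have h : j * m + i < j.+1 * m by rewrite mulSn addnC ltn_add2r.
by apply: leq_trans h _; rewrite -[X in _ <= X]mulp_period leq_mul2r ltn_ord orbT.
Qed.

Lemma color_lt c : color c < r.
Proof. exact: color_bound. Qed.

Lemma color_split k : k < r -> exists (i : 'I_m) (j : 'I_p), k = j * m + i.
Proof.
move=> lt_k; have lt_i : k %% m < m by rewrite ltn_mod period_gt0.
have lt_j : k %/ m < p by rewrite ltn_divLR ?period_gt0 // mulp_period.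
by exists (Ordinal lt_i), (Ordinal lt_j) => /=; rewrite -divn_eq.
Qed.

Lemma color_inj (i i' : 'I_m) (j j' : 'I_p) : j * m + i = j' * m + i' -> i = i' /\ j = j'.
Proof.
move=> e; have ei : i = i' :> nat by have := congr1 (modn^~ m) e; rewrite !modnMDl !modn_small.
split; apply: val_inj => //=; move: e; rewrite ei => /addIn/eqP.
by rewrite eqn_pmul2r ?period_gt0 // => /eqP.
Qed.

(** Rotating the necklace by e shifts the index in lambda by (r/p) e modulo r; this is the
    dictionary between necklaces and [rotated]. *)
Lemma color_rot (i : 'I_m) (j : nat) e : (j * m + i + m * e) %% r = ((j + e) %% p) * m + i.
Proof.
have -> : j * m + i + m * e = (j + e) * m + i by rewrite mulnDl addnAC [m * e]mulnC.
rewrite {1}(divn_eq (j + e) p) mulnDl -mulnA mulp_period -addnA modnMDl modn_small //.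
by apply: (color_bound i (Ordinal (ltn_pmod (j + e) p_gt0))).
Qed.

Lemma down_cond (l : mpart r n.+1) (mu : mpart r n) (i : 'I_m) (j : 'I_p) :
  (neck p mu i j \in box_deletions (neck p l i j)) &&
      [forall a : 'I_m, forall b : 'I_p, ((a, b) != (i, j)) ==> (neck p mu a b == neck p l a b)] =
  covered (j * m + i) mu l.
Proof.
set k := j * m + i; have lt_k : k < r := color_bound i j.
have pl : is_part (nth [::] l k) by have := mpart_part l (Ordinal lt_k); rewrite (tnth_nth [::]).
have pmu : is_part (nth [::] mu k) by have := mpart_part mu (Ordinal lt_k); rewrite (tnth_nth [::]).
apply/andP/coveredP => [[/mapP[a] + e /forallP eqs]|[a c]].
  rewrite mem_filter mem_iota => /andP[co /= lt_a]; exists a => k' b lt_k'.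
  have [_ dE] := delete_boxP pl lt_a co.
  have [ek|nk] := eqVneq k' k; last first.
    rewrite addn0; have [i' [j' kE]] := color_split lt_k'.
    have /forallP/(_ j')/implyP h := eqs i'; have := h _.
    rewrite /neck -kE => /(_ _)/eqP-> //.
    by apply: contra nk => /eqP[ei ej]; rewrite kE ei ej.
  rewrite ek; have -> : nth [::] mu k = delete_box (nth [::] l k) a by exact: e.
  rewrite dE subnK //; case: eqVneq => // ->.
  by apply: leq_ltn_trans co.
have [_ re] := covers_addable lt_k c; split; last first.
  apply/forallP => i'; apply/forallP => j'; apply/implyP => ne; apply/eqP.
  have lt' := color_bound i' j'.
  have pl' := mpart_part l (Ordinal lt'); have pmu' := mpart_part mu (Ordinal lt').
  rewrite !(tnth_nth [::]) /= in pl' pmu'.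
  apply: part_nth_eq => // b; rewrite /neck c // (_ : j' * m + i' == k = false) ?addn0 //.
  by apply: contraNF ne => /eqP/color_inj[-> ->].
have lt_a : a < size (nth [::] l k).
  by rewrite ltnNge; apply/negP => le; move: re; rewrite /removable /mrow ![nth 0 _ _]nth_default // ltnW.
have [pd dE] := delete_boxP pl lt_a re.
apply/mapP; exists a; first by rewrite mem_filter mem_iota; apply/andP; split; [exact: re|exact: lt_a].
apply: part_nth_eq => // b; rewrite dE c // eqxx /=.
by rewrite addnK.
Qed.

Lemma colored_equivP (c d : colored r p n) :
  reflect (exists e : 'I_p, color d = (color c + m * e) %% r /\ rotated (m * e) c.1.1 d.1.1)
    (colored_equiv c d).
Proof.
case: c d => [[mu i] j] [[nu s] t]; rewrite /color /=.
apply: (iffP existsP) => -[e]; last first.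
  move=> [cE rot]; exists e; rewrite color_rot in cE.
  have [es et] := @color_inj s i t (Ordinal (ltn_pmod (j + e) p_gt0)) cE.
  rewrite es et !eqxx /=; apply/forallP => a; apply/forallP => b.
  by rewrite /neck -color_rot rot // color_bound.
move=> /and3P[/eqP<- /eqP-> /forallP eqs]; exists e; rewrite color_rot; split=> // k lt_k.
have [a [b ->]] := color_split lt_k; rewrite color_rot.
by have /forallP/(_ b)/eqP := eqs a.
Qed.

End Colored.

Section Classes.

Variables (r p n : nat).
Hypotheses (r_gt0 : 0 < r) (p_gt0 : 0 < p) (p_dvd_r : p %| r).

Notation m := (r %/ p).

Lemma mpart_nth_part N (l : mpart r N) k : k < r -> is_part (nth [::] l k).
Proof. by move=> lt_k; have := mpart_part l (Ordinal lt_k); rewrite (tnth_nth [::]). Qed.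

Lemma rot_modp x e : (x + m * (e %% p)) %% r = (x + m * e) %% r.
Proof.
have h : m * e = e %/ p * r + m * (e %% p).
  by rewrite {1}(divn_eq e p) mulnDr mulnCA [m * p]mulnC mulp_period.
by rewrite h addnCA modnMDl.
Qed.

Lemma colored_equivI (c d : colored r p n) e :
  color d = (color c + m * e) %% r -> rotated (m * e) c.1.1 d.1.1 -> colored_equiv c d.
Proof.
move=> dE rot; apply/colored_equivP => //.
exists (Ordinal (ltn_pmod e p_gt0)) => /=; rewrite rot_modp; split=> // j lt_j.
by rewrite rot_modp rot.
Qed.

(** The rotation by [p.-1 * e] is inverse to the one by e. *)
Lemma rot_back x e : x < r -> ((x + m * e) %% r + m * (p.-1 * e)) %% r = x.
Proof.
move=> lt_x; rewrite modnDml -addnA -mulnDr -mulSn (prednK p_gt0) mulnA [m * p]mulnC mulp_period //.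
by rewrite addnC mulnC modnMDl modn_small.
Qed.

Lemma rotated_sym N (l l' : mpart r N) e : rotated (m * e) l l' -> rotated (m * (p.-1 * e)) l' l.
Proof.
move=> rot j lt_j; rewrite -rot ?ltn_mod // -{2}(rot_back e lt_j); congr (nth _ _ _).
by rewrite modnDml modnDml addnAC.
Qed.

Lemma colored_equiv_refl (c : colored r p n) : colored_equiv c c.
Proof.
apply: (@colored_equivI _ _ 0); first by rewrite muln0 addn0 modn_small // color_lt.
by move=> j lt_j; rewrite muln0 addn0 modn_small.
Qed.

Lemma colored_equiv_sym (c d : colored r p n) : colored_equiv c d -> colored_equiv d c.
Proof.
move=> /colored_equivP[] // e [dE rot]; apply: (@colored_equivI _ _ (p.-1 * e)).
  by rewrite dE rot_back // color_lt.
exact: rotated_sym.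
Qed.

Lemma colored_equiv_trans (c d f : colored r p n) :
  colored_equiv c d -> colored_equiv d f -> colored_equiv c f.
Proof.
move=> /colored_equivP[] // e [dE rot] /colored_equivP[] // e' [fE rot'].
apply: (@colored_equivI _ _ (e + e')); first by rewrite fE dE modnDml -addnA -mulnDr.
by move=> j lt_j; rewrite mulnDr addnA -modnDml rot' ?ltn_mod // rot.
Qed.

Lemma colored_classP (c d : colored r p n) :
  reflect (colored_class c = colored_class d) (colored_equiv c d).
Proof.
apply: (iffP idP) => [cd|e].
  apply/setP => f; rewrite !inE; apply/idP/idP; apply: colored_equiv_trans => //.
  exact: colored_equiv_sym.
by have := colored_equiv_refl d; rewrite -[_ d d]/(colored_equiv d d); move/setP: e => /(_ d); rewrite !inE => ->.
Qed.

Lemma rotated_exists (mu : mpart r n) c : exists nu, rotated c mu nu.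
Proof.
have lt_mod k : (k + c * r.-1) %% r < r by rewrite ltn_mod.
pose h (k : 'I_r) := Ordinal (lt_mod k).
have h_inj : injective h.
  move=> k k' /(congr1 val) /= e; apply: val_inj; exact: (mod_add_inj (ltn_ord k) (ltn_ord k') e).
have [nu nuE] : exists nu : mpart r n, forall k a, k < r ->
    mrow nu k a = mrow mu ((k + c * r.-1) %% r) a.
  apply: (@mpart_of_rows _ _ _ n) => [k a b lt_k ab|k a lt_k le_a|].
  - exact: mrow_noninc.
  - exact: mrow_bound.
  by rewrite -[RHS](mrow_sum mu (leqnn n)) [RHS](reindex_inj h_inj).
exists nu => j lt_j; apply: part_nth_eq; [exact: mpart_nth_part (ltn_pmod _ r_gt0)|exact: mpart_nth_part|].
move=> a; rewrite -/(mrow nu _ a) nuE ?ltn_mod // modnDml -addnA -mulnS (prednK r_gt0).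
by rewrite addnC modnMDl modn_small.
Qed.

Lemma covers_nth k a (mu : mpart r n) (l : mpart r n.+1) j : j < r -> j != k ->
  covers k a mu l -> nth [::] l j = nth [::] mu j.
Proof.
move=> lt_j nj c; apply: part_nth_eq; [exact: mpart_nth_part|exact: mpart_nth_part|].
by move=> b; rewrite c // (negPf nj) addn0.
Qed.

(* Away from the deleted box the rotation of mu is one of l; following the    *)
(* orbit of its color back to that color covers the remaining component.      *)
Lemma covered_rotated k c (mu mu' : mpart r n) (l : mpart r n.+1) : k < r ->
  covered k mu l -> covered ((k + c) %% r) mu' l -> rotated c mu mu' -> rotated c l l.
Proof.
move=> lt_k /coveredP[a cov] /coveredP[a' cov'] rot.
have off j : j < r -> j != k -> nth [::] l ((j + c) %% r) = nth [::] l j.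
  move=> lt_j nj; rewrite (covers_nth lt_j nj cov) (covers_nth _ _ cov') ?ltn_mod ?rot //.
  by apply: contra nj => /eqP/mod_add_inj->.
suff on t : nth [::] l ((k + c * t.+1) %% r) = nth [::] l ((k + c) %% r).
  move=> j lt_j; have [->|nj] := eqVneq j k; last exact: off.
  by rewrite -(on r.-1) (prednK r_gt0) addnC modnMDl modn_small.
elim: t => [|t IHt]; first by rewrite muln1.
rewrite mulnS addnCA addnC -modnDml.
have [->//|nk] := eqVneq ((k + c * t.+1) %% r) k.
by rewrite off ?ltn_mod.
Qed.

Lemma covered_equiv (c d : colored r p n) (l : mpart r n.+1) :
  covered (color c) c.1.1 l -> covered (color d) d.1.1 l -> colored_equiv c d ->
  exists e : 'I_p, [/\ color d = (color c + m * e) %% r, rotated (m * e) c.1.1 d.1.1 &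
    rotated (m * e) l l].
Proof.
move=> cc cd /colored_equivP[] // e [dE rot]; exists e; split=> //.
by rewrite dE in cd; apply: covered_rotated cc cd rot; apply: color_lt.
Qed.

Lemma downE (l : mpart r n.+1) i j :
  down l i j = [set colored_class (mu, i, j) | mu : mpart r n & covered (j * m + i) mu l] :> {set {set colored r p n}}.
Proof.
apply/setP => X; apply/imsetP/imsetP => -[mu]; rewrite inE => h ->; exists mu => //.
  by rewrite inE -(down_cond r_gt0 p_gt0 p_dvd_r).
by rewrite inE (down_cond r_gt0 p_gt0 p_dvd_r).
Qed.

(** A common class comes with a rotation from (i,j) to (i,j') that stabilizes [l], by
    [covered_equiv]. This rotation carries every deletion at (i,j) to one at (i,j'). *)
Lemma down_meet (l : mpart r n.+1) i (j j' : 'I_p) :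
  ~~ [disjoint down l i j & down l i j'] -> down l i j \subset down l i j'.
Proof.
move=> /pred0Pn[X /andP[]]; rewrite !downE /= => /imsetP[mu]; rewrite inE => c1 ->.
case/imsetP=> mu'; rewrite inE => c2 /colored_classP eq12.
have [e [cE _ rotl]] := @covered_equiv (mu, i, j) (mu', i, j') l c1 c2 eq12.
apply/subsetP => X' /imsetP[nu]; rewrite inE => /coveredP[a c3] ->.
have [nu' rot] := rotated_exists nu (m * e).
apply/imsetP; exists nu'; last first.
  by apply/colored_classP; exact: (@colored_equivI (nu, i, j) (nu', i, j') e cE rot).
rewrite inE; apply/coveredP; exists a => k b lt_k.
have [k0 lt_k0 ->] : exists2 k0, k0 < r & k = (k0 + m * e) %% r.
  exists ((k + m * (p.-1 * e)) %% r); first by rewrite ltn_mod.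
  by rewrite modnDml addnAC -modnDml rot_back.
rewrite rotl // rot // c3 //; congr (_ + _); congr (nat_of_bool (_ && _)).
move: cE; rewrite /color /= => ->; apply/eqP/eqP => [->//|].
by apply: mod_add_inj => //; apply: color_bound.
Qed.

Lemma down_color (l : mpart r n.+1) i i' (j j' : 'I_p) X :
  X \in down l i j -> X \in down l i' j' -> i = i'.
Proof.
rewrite !downE => /imsetP[mu _ ->] /imsetP[mu' _ /colored_classP/existsP[e /and3P[/eqP->]]].
by [].
Qed.

End Classes.

Local Open Scope ring_scope.

(** * Dimensions of the eigenspaces of the associator *)

Section Restriction.

Variables (C : numClosedFieldType) (r p n : nat) (z : C) (z_prim : r.-primitive_root z).
Hypotheses (p_gt0 : (0 < p)%N) (p_dvd_r : (p %| r)%N).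
Let r_gt0 := prim_order_gt0 z_prim.

Notation m := (r %/ p)%N.

Definition colored_repr (c : colored r p n) :=
  res_repr (Lrp_sub_last r n p) (last_repr z_prim c.1.1 (color c)).

Lemma colored_repr_rsim (c d : colored r p n) :
  mx_rsim (colored_repr c) (colored_repr d) <-> colored_equiv c d.
Proof.
split=> [sim|/colored_equivP[] // e [dE rot]]; last first.
  by apply: lastL_rotated rot dE => //; rewrite ?dvdn_mulr ?color_lt.
have [e [/dvdnP[q qE] dE rot]] := last_shift p_dvd_r p_gt0 (color_lt p_dvd_r c) (color_lt p_dvd_r d) sim.
by rewrite qE mulnC in dE rot; apply: colored_equivI dE rot.
Qed.

Lemma Vcolored_rsim (c : colored r p n) :
  mx_rsim (Vcolored z_prim (colored_class c)) (colored_repr c).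
Proof.
rewrite /Vcolored; case: pickP => [[[mu i] j]|/(_ c)]; last first.
  by rewrite inE colored_equiv_refl.
by rewrite inE => /colored_repr_rsim/mx_rsim_sym.
Qed.

Variables (l : mpart r n.+1) (A : 'M[C]_(rdegree (Vlam z_prim l))) (hA : associator p A).

Notation u := (stab_order z_prim p l).
Notation b := (stab_index z_prim p l).

Definition removals := [pred c : colored r p n | covered (color c) c.1.1 l].
Definition removal_classes := [set colored_class c | c in removals].

Lemma sum_removals : (\sum_(c | removals c) rdegree (Vlam z_prim c.1.1))%N = rdegree (Vlam z_prim l).
Proof.
have [-> _] := branching_dim z_prim n; rewrite pair_big_dep /=.
pose h (c : colored r p n) := (Ordinal (color_lt p_dvd_r c), c.1.1).
have h_inj : injective h.
  move=> [[mu i] j] [[mu' i'] j'] [e ->].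
  by have [-> ->] : i = i' /\ j = j' := color_inj r_gt0 p_gt0 p_dvd_r e.
have h_bij : bijective h.
  apply: inj_card_bij h_inj _; rewrite !card_prod !card_ord.
  by rewrite -mulnA [(m * p)%N]mulnC mulp_period // mulnC.
by rewrite (reindex h) //; apply: onW_bij.
Qed.

(** A deletion in the class of c0 is determined by the rotation leading to it from c0. That rotation
    stabilizes lambda, hence its exponent lies in [Cstab]. *)
Lemma card_fiber (c0 : colored r p n) : c0 \in removals ->
  (#|[pred c | removals c && (colored_class c == colored_class c0)]| <= u)%N.
Proof.
move=> r0; rewrite /stab_order.
apply: (@leq_card_graph _ _ [pred c | removals c && (colored_class c == colored_class c0)]
  [pred e in Cstab z_prim p l] (fun c e =>
  color c = ((color c0 + m * e) %% r)%N /\ rotated (m * e) c0.1.1 c.1.1)).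
  move=> c /= /andP[rc /eqP/esym/(colored_classP r_gt0 p_gt0 p_dvd_r) eqc].
  have [e [cE rot rotl]] := covered_equiv r_gt0 p_gt0 p_dvd_r r0 rc eqc.
  by exists e => //=; rewrite inE; apply/asboolP; apply: Vlam_rotated.
move=> [[mu i] j] [[mu' i'] j'] e _ _ [cE rot] [cE' rot'].
have [-> ->] : i = i' /\ j = j'.
  by apply: (color_inj r_gt0 p_gt0 p_dvd_r); rewrite -/(color (mu, i, j)) cE -/(color (mu', i', j')) cE'.
congr (_, _, _); apply: mpart_eqP => k lt_k.
have [k0 lt_k0 ->] : exists2 k0, (k0 < r)%N & k = ((k0 + m * e) %% r)%N.
  exists ((k + m * (p.-1 * e)) %% r)%N; first by rewrite ltn_mod.
  by rewrite modnDml addnAC -modnDml rot_back.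
by rewrite rot // rot'.
Qed.

Lemma rsim_degree (gT : finGroupType) (G : {group gT}) n1 n2 (U : mx_representation C G n1)
  (W : mx_representation C G n2) : mx_rsim U W -> n1 = n2.
Proof. by case. Qed.

Notation S := (\sum_(X in removal_classes) rdegree (Vcolored z_prim X))%N.

Lemma degree_leq_classes : (rdegree (Vlam z_prim l) <= u * S)%N.
Proof.
rewrite -sum_removals (partition_big (@colored_class r p n) (mem removal_classes)) => [|c rc]; last first.
  exact: imset_f.
rewrite big_distrr; apply: leq_sum => _ /imsetP[c0 r0 ->] /=.
rewrite (eq_bigr (fun=> rdegree (Vcolored z_prim (colored_class c0)))) => [|c /andP[_ /eqP<-]]; last first.
  exact/esym/(rsim_degree (Vcolored_rsim c)).
by rewrite sum_nat_const leq_mul2r card_fiber ?orbT.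
Qed.

Lemma classes_irr X : X \in removal_classes -> mx_irreducible (Vcolored z_prim X).
Proof.
by case/imsetP=> c _ ->; apply: mx_rsim_irr (mx_rsim_sym (Vcolored_rsim c)) (lastL_irr _ _ _ _).
Qed.

Lemma classes_inj X Y : X \in removal_classes -> Y \in removal_classes ->
  mx_rsim (Vcolored z_prim X) (Vcolored z_prim Y) -> X = Y.
Proof.
case/imsetP=> c _ -> /imsetP[d _ ->] sim; apply/(colored_classP r_gt0 p_gt0 p_dvd_r)/colored_repr_rsim.
exact: mx_rsim_trans (mx_rsim_sym (Vcolored_rsim c)) (mx_rsim_trans sim (Vcolored_rsim d)).
Qed.

Notation E w := (Representation (submod_repr (associator_module w hA))).

Lemma classes_embed w X : w ^+ u = 1 -> X \in removal_classes ->
  embeds (Vcolored z_prim X) (res_repr (Lrp_sub r n p) (E w)).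
Proof.
move=> wu /imsetP[c rc ->]; apply: embeds_trans (rsim_embeds (Vcolored_rsim c)) _.
exact: (@down_embeds C r p n z z_prim p_gt0 p_dvd_r l c.1.1 (Ordinal (color_lt p_dvd_r c))).
Qed.

Lemma classes_leq w : w ^+ u = 1 -> (S <= \rank (eigenspace A w))%N.
Proof.
move=> wu; rewrite -big_enum.
apply: (@embeds_dsum_leq C _ _ _ _ _ (res_repr (Lrp_sub r n p) (E w))).
- exact: enum_uniq.
- by move=> X; rewrite mem_enum; apply: classes_irr.
- by move=> X Y; rewrite !mem_enum; apply: classes_inj.
by move=> X; rewrite mem_enum; apply: classes_embed.
Qed.

Lemma eigen_rank_sum :
  (\sum_(t < u) \rank (eigenspace A ((z ^+ (m * b)) ^+ t)) <= rdegree (Vlam z_prim l))%N.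
Proof.
have inj : {in xpredT &, injective (fun t : 'I_u => (z ^+ (m * b)) ^+ t)}.
  move=> t t' _ _ /eqP; rewrite (eq_prim_root_expr (stab_root_prim z_prim p_gt0 p_dvd_r l)).
  by rewrite !modn_small // => /eqP/val_inj.
have /mxdirectP/= <- := mxdirect_sum_eigenspace A inj.
exact: rank_leq_col.
Qed.

(** All u eigenspaces have dimension at least S, and together at most the degree of V^lambda, which
    is at most u S. *)
Lemma eigen_rank (t : 'I_u) : \rank (eigenspace A ((z ^+ (m * b)) ^+ t)) = S.
Proof.
have leS (s : 'I_u) : (S <= \rank (eigenspace A ((z ^+ (m * b)) ^+ s)))%N.
  apply: classes_leq; rewrite (exprAC (z ^+ (m * b)) s u) (prim_expr_order (stab_root_prim z_prim p_gt0 p_dvd_r l)).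
  exact: expr1n.
apply/eqP; rewrite eqn_leq leS andbT.
have h1 : (\sum_(s < u | s != t) S <= \sum_(s < u | s != t) \rank (eigenspace A ((z ^+ (m * b)) ^+ s)))%N.
  by apply: leq_sum => s _; apply: leS.
have h2 := leq_trans eigen_rank_sum degree_leq_classes; move: h2.
have -> : (u * S = \sum_(s < u) S)%N by rewrite sum_nat_const card_ord.
rewrite (bigD1 t) // [X in (_ <= X)%N](bigD1 t) //= => h2.
rewrite -(leq_add2r (\sum_(s < u | s != t) S)%N); apply: leq_trans h2.
by rewrite leq_add2l.
Qed.

Lemma eigen_degree (d : 'I_p) : d \in Cstab z_prim p l -> \rank (eigenspace A (z ^+ (m * d))) = S.
Proof.
rewrite inE -/(stabilizes p z_prim l d); have [b_gt0 ub ->] := stab_facts z_prim p_gt0 p_dvd_r l.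
case/dvdnP=> t dE; have lt_t : (t < u)%N by rewrite -(ltn_pmul2r b_gt0) ub -dE.
by rewrite dE [(t * b)%N]mulnC mulnA exprM (eigen_rank (Ordinal lt_t)).
Qed.

End Restriction.

Section DirectSums.

Variables (C : numClosedFieldType) (gT : finGroupType) (G : {group gT}).
Variables (I : finType) (P : pred I) (U : I -> representation C G).

Notation dsum := (\big[@dadd_grepr C _ G/grepr0]_(x | P x) U x).

Lemma embeds_dsum_cond n (W : mx_representation C G n) :
    (forall x y (f : 'M_(rdegree (U x), rdegree (U y))), P x -> P y -> x != y ->
      intertwines (U x) (U y) f -> f = 0) ->
    (forall x, P x -> embeds (U x) W) -> embeds dsum W.
Proof.
move=> hom0 emb; rewrite -big_filter; apply: embeds_dsum => [|x y f|x].
- by rewrite filter_uniq // index_enum_uniq.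
- by rewrite !mem_filter => /andP[Px _] /andP[Py _]; apply: hom0.
by rewrite mem_filter => /andP[Px _]; apply: emb.
Qed.

Lemma dsum_hom0 n (W : mx_representation C G n) (f : 'M_(rdegree dsum, n)) :
  (forall x (f' : 'M_(rdegree (U x), n)), P x -> intertwines (U x) W f' -> f' = 0) ->
  intertwines dsum W f -> f = 0.
Proof.
rewrite -big_filter in f *; move=> hom0; apply: dsum_intertwines0 => x f'.
by rewrite mem_filter => /andP[Px _]; apply: hom0.
Qed.

Lemma hom_dsum0 n (W : mx_representation C G n) (f : 'M_(n, rdegree dsum)) :
  (forall x (f' : 'M_(n, rdegree (U x))), P x -> intertwines W (U x) f' -> f' = 0) ->
  intertwines W dsum f -> f = 0.
Proof.
rewrite -big_filter in f *; move=> hom0; apply: intertwines_dsum0 => x f'.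
by rewrite mem_filter => /andP[Px _]; apply: hom0.
Qed.

Lemma rdegree_dsum_cond : rdegree dsum = (\sum_(x | P x) rdegree (U x))%N.
Proof. by rewrite -big_filter rdegree_dsum big_filter. Qed.

End DirectSums.

(** * The direct sum over the maximal sets J(i) *)

Section Decomposition.

Variables (C : numClosedFieldType) (r p n : nat) (z : C) (z_prim : r.-primitive_root z).
Hypotheses (p_gt0 : (0 < p)%N) (p_dvd_r : (p %| r)%N).
Let r_gt0 := prim_order_gt0 z_prim.

Notation m := (r %/ p)%N.

Variables (l : mpart r n.+1) (J : 'I_m -> {set 'I_p}).
Hypothesis J_max : forall i, maxset (pairwise_disjoint l i) (J i).

Notation RC := (removal_classes p l).

Lemma down_removal i (j : 'I_p) X : X \in down l i j -> X \in RC.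
Proof.
rewrite downE // => /imsetP[mu]; rewrite inE => h ->.
by apply/imsetP; exists (mu, i, j).
Qed.

(** If j is outside J(i), maximality makes the set of j meet that of some s in J(i), and by
    [down_meet] it is then contained in it. *)
Lemma removal_down X : X \in RC -> exists i, exists2 j, j \in J i & X \in down l i j.
Proof.
case/imsetP=> [[[mu i] j] rc ->]; exists i; set X0 := colored_class _.
have dX : X0 \in down l i j by rewrite downE //; apply/imsetP; exists mu => //; rewrite inE.
have /maxsetP[/forallP PJ maxJ] := J_max i.
have [jJ|njJ] := boolP (j \in J i); first by exists j.
have [/existsP[s /andP[sJ meet]]|no] := boolP [exists s, (s \in J i) && ~~ [disjoint down l i j & down l i s]].
  by exists s => //; apply: (subsetP (down_meet r_gt0 p_gt0 p_dvd_r meet)).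
have disj s : s \in J i -> [disjoint down l i j & down l i s].
  by move=> sJ; apply: contraR no => nd; apply/existsP; exists s; rewrite sJ.
have Pj : pairwise_disjoint l i (j |: J i).
  apply/forallP => s; apply/implyP => /setU1P[->|sJ]; apply/forallP => t; apply/implyP => /setU1P[->|tJ].
  - by rewrite eqxx.
  - by apply/implyP => _; apply: disj.
  - by apply/implyP => _; rewrite disjoint_sym disj.
  have /implyP/(_ sJ)/forallP/(_ t)/implyP := PJ s; exact.
by case/negP: njJ; rewrite -(maxJ _ Pj) ?setU11 // subsetUr.
Qed.

Notation Vc := (Vcolored z_prim).
Notation blockJ i j := (\big[@dadd_grepr C _ (Lrp r n p)/grepr0]_(X in down l i j) Vc X).
Notation block i := (\big[@dadd_grepr C _ (Lrp r n p)/grepr0]_(j in J i) blockJ i j).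
Notation total := (\big[@dadd_grepr C _ (Lrp r n p)/grepr0]_(i < m) block i).

Lemma total_degree : (\sum_(X in RC) rdegree (Vc X) <= rdegree total)%N.
Proof.
have -> : rdegree total = (\sum_(i < m) \sum_(j in J i) \sum_(X in down l i j) rdegree (Vc X))%N.
  rewrite rdegree_dsum_cond; apply: eq_bigr => i _; rewrite rdegree_dsum_cond.
  by apply: eq_bigr => j _; rewrite rdegree_dsum_cond.
rewrite pair_big_dep /= (exchange_big_dep xpredT) //= big_mkcond.
apply: leq_sum => X _; case: ifP => // /removal_down[i [j jJ dX]].
by rewrite (bigD1 (i, j)) ?leq_addr //= jJ.
Qed.

Lemma Vcolored_hom0 X Y (f : 'M_(rdegree (Vc X), rdegree (Vc Y))) : X \in RC -> Y \in RC -> X != Y ->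
  intertwines (Vc X) (Vc Y) f -> f = 0.
Proof.
move=> XR YR nXY hf; apply: contraNeq nXY => f0; apply/eqP.
apply: (@classes_inj _ _ _ _ _ z_prim p_gt0 p_dvd_r l _ _ XR YR); apply: irr_intertwines_rsim hf f0.
  exact: classes_irr XR.
exact: classes_irr YR.
Qed.

Lemma blockJ_hom0 i i' j j' (f : 'M_(rdegree (blockJ i j), rdegree (blockJ i' j'))) :
    (forall X, X \in down l i j -> X \in down l i' j' -> False) ->
  intertwines (blockJ i j) (blockJ i' j') f -> f = 0.
Proof.
move=> disj; apply: dsum_hom0 => X f1 dX; apply: hom_dsum0 => Y f2 dY.
apply: Vcolored_hom0; [exact: down_removal dX|exact: down_removal dY|].
by apply/eqP => e; apply: (disj X) => //; rewrite e.
Qed.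

(** No class occurs twice: i is determined by the class ([down_color]), and for fixed i the sets
    with j in J(i) are disjoint. All intertwiners between different summands therefore vanish. *)
Lemma total_embeds N (W : mx_representation C (Lrp r n p) N) :
  (forall X, X \in RC -> embeds (Vc X) W) -> embeds total W.
Proof.
move=> emb; apply: embeds_dsum_cond => [i i' f _ _ ni|i _].
  apply: dsum_hom0 => j f1 _; apply: hom_dsum0 => j' f2 _; apply: blockJ_hom0 => X dX dX'.
  by move: ni; rewrite (down_color _ _ _ dX dX') ?eqxx.
have /maxsetP[/forallP PJ _] := J_max i.
apply: embeds_dsum_cond => [j j' f jJ jJ' nj|j _].
  apply: blockJ_hom0 => X dX dX'.
  have /implyP/(_ jJ)/forallP/(_ j')/implyP/(_ jJ')/implyP/(_ nj) := PJ j.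
  by move=> /pred0P/(_ X); rewrite /= dX dX'.
apply: embeds_dsum_cond => [X Y f dX dY nXY|X dX]; last by apply: emb; apply: down_removal dX.
by apply: Vcolored_hom0 => //; [exact: down_removal dX|exact: down_removal dY].
Qed.

(** The direct sum embeds in V^(lambda,delta), and the latter has dimension S by [eigen_degree]. *)
Lemma Vdelta_branching (A : 'M[C]_(rdegree (Vlam z_prim l))) (hA : associator p A) (d : 'I_p) :
    d \in Cstab z_prim p l ->
  mx_rsim (res_repr (Lrp_sub r n p) (Vdelta hA d)) total.
Proof.
move=> dC; have [b_gt0 ub sb] := stab_facts z_prim p_gt0 p_dvd_r l.
have wu : (z ^+ (m * d)) ^+ stab_order z_prim p l = 1.
  move: dC; rewrite inE -/(stabilizes p z_prim l d) sb => /dvdnP[t ->].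
  rewrite -exprM [(t * _)%N]mulnC mulnA mulnAC (stab_exponent z_prim p_gt0 p_dvd_r l) exprM.
  by rewrite (prim_expr_order z_prim) expr1n.
have emb : embeds total (res_repr (Lrp_sub r n p) (Vdelta hA d)).
  by apply: total_embeds => X XR; apply: classes_embed.
apply: mx_rsim_sym; apply: (embeds_rsim emb); apply/eqP; rewrite eqn_leq (embeds_leq emb) /=.
by rewrite (eigen_degree p_gt0 p_dvd_r hA dC); apply: total_degree.
Qed.

End Decomposition.

(** * Multiplicities *)

Section MultiplicityFree.

Variables (C : numClosedFieldType) (gT : finGroupType) (G : {group gT}).

(* Every irreducible representation occurs at most once in W. *)
Definition hom_unique n (W : mx_representation C G n) :=
  forall n' (U : mx_representation C G n') (f g : 'M_(n', n)), mx_irreducible U ->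
    intertwines U W f -> intertwines U W g -> f != 0 -> exists c, g = c *: f.

Lemma irr_hom_unique n (W : mx_representation C G n) : mx_irreducible W -> hom_unique W.
Proof.
move=> irrW n' U f g irrU hf hg f0.
have ff := irr_intertwines_free irrU hf f0.
have /row_fullP[f' f'f] := irr_intertwines_full irrW hf f0.
have ff' : f *m f' = 1%:M.
  by apply: (row_free_inj ff); rewrite -mulmxA f'f mulmx1 mul1mx.
have hf' : intertwines W U f'.
  move=> x Gx; rewrite -[RHS]mulmx1 -ff' mulmxA -[f' *m U x *m f]mulmxA hf //.
  by rewrite !mulmxA f'f mul1mx.
have [c gf'] := irr_endo_scalar irrU (intertwines_mul hg hf').
by exists c; rewrite -[g]mulmx1 -f'f mulmxA gf' mul_scalar_mx.
Qed.

Lemma embeds_hom_unique n1 n2 (W : mx_representation C G n1) (W' : mx_representation C G n2) :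
  embeds W W' -> hom_unique W' -> hom_unique W.
Proof.
move=> [h fh hh] uW n' U f g irrU hf hg f0.
have fh0 : f *m h != 0 by apply: contraNneq f0 => e; apply/eqP; apply: (row_free_inj fh); rewrite mul0mx.
have [c e] := uW _ _ _ _ irrU (intertwines_mul hf hh) (intertwines_mul hg hh) fh0.
by exists c; apply: (row_free_inj fh); rewrite e scalemxAl.
Qed.

(** At most one summand is isomorphic to a given irreducible module, and only that one receives a
    nonzero map. *)
Lemma dsum_hom_unique (I : eqType) (U : I -> representation C G) (s : seq I) : uniq s ->
    {in s, forall x, mx_irreducible (U x)} -> {in s &, forall x y, mx_rsim (U x) (U y) -> x = y} ->
  hom_unique (\big[@dadd_grepr C _ G/grepr0]_(x <- s) U x).
Proof.
elim: s => [|x s IHs] us irr sim n' V f g irrV hf hg f0.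
  by case/eqP: f0; rewrite -[f]/(f : 'M_(_, _)); apply: (intertwines_dsum0 (s := [::])) hf.
move: f g hf hg f0; rewrite big_cons => f g /intertwines_daddr[hf1 hf2] /intertwines_daddr[hg1 hg2] f0.
have irrx := irr x (mem_head _ _).
have [VUx|VUx] := pselect (mx_rsim V (U x)).
  have zero (h : 'M_(n', rdegree (\big[@dadd_grepr C _ G/grepr0]_(y <- s) U y))) :
      intertwines V (\big[@dadd_grepr C _ G/grepr0]_(y <- s) U y) h -> h = 0.
    apply: intertwines_dsum0 => y f' sy hf'; apply: contraTeq isT => f'0.
    have sy' : y \in x :: s by rewrite inE sy orbT.
    have Vy := irr_intertwines_rsim irrV (irr y sy') hf' f'0.
    have exy := sim _ _ (mem_head _ _) sy' (mx_rsim_trans (mx_rsim_sym VUx) Vy).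
    by move: us; rewrite /= exy sy.
  have f10 : lsubmx f != 0.
    by apply: contraNneq f0 => e; rewrite -[f]hsubmxK e (zero _ hf2) row_mx0 eqxx.
  have [c ce] := irr_hom_unique irrx irrV hf1 hg1 f10.
  by exists c; rewrite -[f]hsubmxK -[g]hsubmxK ce (zero _ hf2) (zero _ hg2) scale_row_mx scaler0.
have zero (h : 'M_(n', rdegree (U x))) : intertwines V (U x) h -> h = 0.
  by move=> hh; apply: contra_notP VUx => /eqP; apply: irr_intertwines_rsim.
have f20 : rsubmx f != 0.
  by apply: contraNneq f0 => e; rewrite -[f]hsubmxK e (zero _ hf1) row_mx0 eqxx.
have us' : uniq s by case/andP: us.
have irr' : {in s, forall x, mx_irreducible (U x)}.
  by move=> y sy; apply: irr; rewrite inE sy orbT.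
have sim' : {in s &, forall x y, mx_rsim (U x) (U y) -> x = y}.
  by move=> y y' sy sy'; apply: sim; rewrite inE ?sy ?sy' orbT.
have [c ce] := IHs us' irr' sim' _ _ _ _ irrV hf2 hg2 f20.
by exists c; rewrite -[f]hsubmxK -[g]hsubmxK ce (zero _ hf1) (zero _ hg1) scale_row_mx scaler0.
Qed.

(** Two embeddings of a simple U are proportional, so every submodule isomorphic to U lies in U. The
    isotypic component is then U itself, and the multiplicity, a quotient of ranks, is 1. *)
Lemma hom_unique_free (W : representation C G) : hom_unique W -> multiplicity_free W.
Proof.
move=> uW X; have simX := socle_simple X; set U := socle_base X in simX *.
have modU := mxsimple_module simX.
have val_hom V (modV : mxmodule W V) : intertwines (submod_repr modV) W (val_submod 1%:M).
  by move=> x Gx; rewrite -val_submodJ // mul1mx -val_submodE.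
have irrU : mx_irreducible (submod_repr modU) by apply/submod_mx_irr.
have U0 : \rank U != 0%N by rewrite mxrank_eq0; case: simX.
have vU0 : val_submod 1%:M != 0 :> 'M[C]_(\rank U, rdegree W).
  by rewrite -mxrank_eq0 (val_submod1 U).
have [I [Wi isoW cE]] := component_mx_def simX.
have WiU i : (Wi i <= U)%MS.
  have modW := mxsimple_module (mx_iso_simple (isoW i) simX).
  have [B [B' BB' hB]] := mx_rsim_def ((mx_rsim_iso modU modW).2 (isoW i)).
  have hB1 : intertwines (submod_repr modU) (submod_repr modW) B.
    by move=> x Gx; rewrite hB // -[LHS]mulmxA BB' mulmx1.
  have [c ce] := uW _ _ _ _ irrU (val_hom _ modU) (intertwines_mul hB1 (val_hom _ modW)) vU0.
  suff : (val_submod (1%:M : 'M_(\rank (Wi i))) <= U)%MS by rewrite val_submod1.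
  set v := val_submod _ in ce *.
  have -> : v = B' *m (B *m v) by rewrite mulmxA BB' mul1mx.
  by rewrite ce -scalemxAr scalemx_sub // mulmx_sub // val_submod1.
have cU : (component_mx W U :=: U)%MS.
  apply/eqmxP; rewrite component_mx_id // andbT cE; apply/sumsmx_subP => i _; exact: WiU.
by rewrite /socle_mult /socle_val -/U cU divnn lt0n U0.
Qed.

End MultiplicityFree.

Lemma scalemx_exp (F : comNzRingType) N (a : F) (f : 'M[F]_N) t : (a *: f) ^+ t = a ^+ t *: f ^+ t.
Proof.
elim: t => [|t IHt]; first by rewrite !expr0 scale1r.
by rewrite !exprS IHt -!mulmxE -scalemxAl -scalemxAr scalerA.
Qed.

(** * Multiplicity freeness of the restriction to L(r,p,n+1) *)

Section MultiplicityFreeRestriction.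

Variables (C : numClosedFieldType) (r p n : nat) (z : C) (z_prim : r.-primitive_root z).
Hypotheses (p_gt0 : (0 < p)%N) (p_dvd_r : (p %| r)%N).
Let r_gt0 := prim_order_gt0 z_prim.

Notation m := (r %/ p)%N.

(** An isomorphism between V^lambda and its twist has a scalar u-th power by Schur; dividing by a
    u-th root of that scalar gives an associator. *)
Lemma associator_exists N (l : mpart r N) : exists A, associator (z_prim := z_prim) (l := l) p A.
Proof.
set V := Vlam z_prim l; set u := stab_order z_prim p l; set b := stab_index z_prim p l.
have [b_gt0 ub sb] := stab_facts z_prim p_gt0 p_dvd_r l.
have u_pos : (0 < u)%N := stab_order_gt0 z_prim p_gt0 p_dvd_r l.
(* The exponent is -b, written as b (u-1), because an associator carries the character on the
   opposite side from the isomorphism with the twist. *)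
have : stabilizes p z_prim l (b * u.-1) by rewrite sb dvdn_mulr.
case/stabilizesP=> f ff hf.
have dX g : (delta0 z g ^+ (m * b)) ^+ u = 1 :> C.
  rewrite -exprM (stab_exponent z_prim p_gt0 p_dvd_r l) /delta0 -exprM mulnC exprM.
  by rewrite (prim_expr_order z_prim) expr1n.
have hf1 g : V g *m f = delta0 z g ^+ (m * b) *: (f *m V g).
  rewrite -hf scalerA -exprD -mulnDr -mulnS (prednK u_pos).
  by rewrite mulnA exprM dX scale1r.
have hfX g t : V g *m f ^+ t = (delta0 z g ^+ (m * b)) ^+ t *: (f ^+ t *m V g).
  elim: t => [|t IHt]; first by rewrite !expr0 scale1r mulmx1 mul1mx.
  rewrite exprSr -mulmxE mulmxA IHt -scalemxAl -[f ^+ t *m V g *m f]mulmxA hf1.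
  by rewrite -scalemxAr scalerA mulmxA -exprSr.
have [c cE] : exists c, f ^+ u = c%:M.
  apply: (irr_endo_scalar (Vlam_irr z_prim l)) => g _.
  by rewrite hfX dX scale1r.
have fX t : row_free (f ^+ t).
  elim: t => [|t IHt]; first by rewrite expr0 row_free_unit unitmx1.
  by rewrite exprS -mulmxE /row_free mxrankMfree.
have V_gt0 := irr_dim_gt0 (Vlam_irr z_prim l).
have c0 : c != 0.
  apply: contraTneq (fX u) => c0; rewrite cE c0 /row_free raddf0 mxrank0.
  by rewrite eq_sym -lt0n.
exists ((u.-root c)^-1 *: f); split.
  move=> g v; rewrite -!mulmxA -scalemxAr hf1 scalerA mulrC -scalerA -scalemxAr.
  by rewrite -scalemxAl.
by rewrite scalemx_exp exprVn rootCK // cE scale_scalar_mx mulVf.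
Qed.

(** An irreducible submodule of the induced module is some V^lambda by completeness; reciprocity
    turns the retraction onto it into a nonzero map from W. *)
Lemma irr_sub_Vlam N (W : representation C (Grp r p N)) : mx_irreducible W ->
  exists (l : mpart r N) h, h != 0 /\ intertwines W (res_repr (subsetT (Grp r p N)) (Vlam z_prim l)) h.
Proof.
move=> irrW; set I := ind_repr (subsetT (Grp r p N)) W.
have I_gt0 : (0 < rdegree I)%N.
  by rewrite rdegree_ind muln_gt0 (irr_dim_gt0 irrW) andbT indexg_gt0.
have [V [irrV [f ff hf]]] := embeds_irr_submod I I_gt0.
have [l [g _ fg hg]] := Vlam_complete z_prim irrV.
have [f' ff' hf'] := embeds_retract ff hf.
have f'0 : f' != 0.
  apply: contraTneq (irr_dim_gt0 irrV) => f'0; move: ff'; rewrite f'0 mulmx0 => /(congr1 mxrank).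
  by rewrite mxrank0 mxrank1 => <-.
have [h h0 hh] := frobenius_unit hf' f'0.
exists l, (h *m g); split.
  by apply: contraNneq h0 => e; apply/eqP; apply: (row_free_inj fg); rewrite mul0mx.
by apply: intertwines_mul hh _ => x Gx; apply: hg.
Qed.

(** Some eigenprojection of the map from W to V^lambda is nonzero, so W embeds in an eigenspace,
    whose restriction is a sum of pairwise nonisomorphic irreducibles. *)
Lemma restriction_free (W : representation C (Grp r p n.+1)) : mx_irreducible W ->
  multiplicity_free (res_repr (Lrp_sub r n p) W).
Proof.
move=> irrW; apply: hom_unique_free; have [l [h [h0 hh]]] := irr_sub_Vlam irrW.
have [A hA] := associator_exists l; set u := stab_order z_prim p l.
have zb := stab_root_prim z_prim p_gt0 p_dvd_r l; rewrite -/u in zb.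
set x := z ^+ _ in zb.
have u_pos : (0 < u)%N := stab_order_gt0 z_prim p_gt0 p_dvd_r l.
(* The eigenprojections add up to u times the identity, so they cannot all kill h. *)
have [t ht] : exists t : 'I_u, h *m eigen_proj u A (x ^+ t) != 0.
  apply/existsP; apply: contraNT h0; rewrite negb_exists => /forallP h1.
  have := congr1 (mulmx h) (eigen_proj_sum A u_pos zb).
  rewrite mulmx_sumr big1 => [|t _]; last by apply/eqP; have := h1 t; rewrite negbK.
  rewrite mul_mx_scalar => /esym/eqP; rewrite scaler_eq0 pnatr_eq0.
  by rewrite (gtn_eqF u_pos).
set w := x ^+ t in ht.
have wu : w ^+ u = 1 by rewrite /w (exprAC x t u) (prim_expr_order zb) expr1n.
set P := eigen_proj u A w in ht.
have hP : (h *m P <= eigenspace A w)%MS.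
  by apply: submx_trans (submxMl _ _) _; apply: eigen_projP => //; apply: hA.2.
have hhP : intertwines W (subg_repr (res_repr (subsetT (Grp r p n.+1)) (Vlam z_prim l)) (subxx _)) (h *m P).
  move=> g Gg; rewrite mulmxA [X in X *m P]hh // -!mulmxA; congr (_ *m _).
  exact: (eigen_proj_comm hA w Gg).
have hS := intertwines_submod (associator_module w hA) hhP hP.
have embWE : embeds (res_repr (Lrp_sub r n p) W)
    (res_repr (Lrp_sub r n p) (Representation (submod_repr (associator_module w hA)))).
  exists (in_submod (eigenspace A w) (h *m P)); last first.
    by move=> g Lg; apply: hS; apply: (subsetP (Lrp_sub r n p)).
  by apply: irr_intertwines_free irrW hS _; apply: in_submod_neq0.
pose s := enum (removal_classes p l).
pose flat := \big[@dadd_grepr C _ (Lrp r n p)/grepr0]_(X <- s) Vcolored z_prim X.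
have irr_s : {in s, forall X, mx_irreducible (Vcolored z_prim X)}.
  by move=> X; rewrite mem_enum; apply: classes_irr.
have inj_s : {in s &, forall X Y, mx_rsim (Vcolored z_prim X) (Vcolored z_prim Y) -> X = Y}.
  by move=> X Y; rewrite !mem_enum; apply: classes_inj.
have emb : embeds flat
    (res_repr (Lrp_sub r n p) (Representation (submod_repr (associator_module w hA)))).
  apply: embeds_dsum_irr irr_s inj_s _ => [|X]; first exact: enum_uniq.
  by rewrite mem_enum; apply: classes_embed.
have sim : mx_rsim flat
    (res_repr (Lrp_sub r n p) (Representation (submod_repr (associator_module w hA)))).
  apply: (embeds_rsim emb); rewrite rdegree_dsum big_enum /=.
  by rewrite /w /x (eigen_rank p_gt0 p_dvd_r hA t).
apply: embeds_hom_unique (embeds_trans embWE (rsim_embeds (mx_rsim_sym sim))) _.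
by apply: dsum_hom_unique irr_s inj_s; apply: enum_uniq.
Qed.

End MultiplicityFreeRestriction.

Theorem theorem4p12 (C : numClosedFieldType) (r p n : nat) (z : C)
    (r_gt0 : (0 < r)%N) (p_gt0 : (0 < p)%N) (p_dvd_r : (p %| r)%N)
    (z_prim : r.-primitive_root z) :
  (forall (lam : mpart r n.+1) (d : 'I_p) (d_stab : d \in Cstab z_prim p lam)
          (A : 'M[C]_(rdegree (Vlam z_prim lam)))
          (A_assoc : associator p A)
          (J : 'I_(r %/ p) -> {set 'I_p})
          (J_max : forall i, maxset (pairwise_disjoint lam i) (J i)),
     mx_rsim
       (res_repr (Lrp_sub r n p) (Vdelta A_assoc d))
       (\big[@dadd_grepr C _ (Lrp r n p)/grepr0]_(i < r %/ p)
          \big[@dadd_grepr C _ (Lrp r n p)/grepr0]_(j in J i)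
            \big[@dadd_grepr C _ (Lrp r n p)/grepr0]_(X in down lam i j)
              Vcolored z_prim X))
  /\
  (forall W : representation C (Grp r p n.+1),
     mx_irreducible W -> multiplicity_free (res_repr (Lrp_sub r n p) W)).
Proof.
split=> [lam d d_stab A A_assoc J J_max|W irrW]; first exact: Vdelta_branching.
exact: (restriction_free z_prim).
Qed.
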